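(* Let $\mu$ be either the Lebesgue measure on $\mathbb{R}$ or the standard Gaussian probability measure $\gamma$ on $\mathbb{R}$, and let $\mu_2=\mu\otimes\mu$ on $\mathbb{R}^2$. Let $p_1,p_2,p_3>1$ be such that $$\frac1{p_1}+\frac1{p_2}+\frac1{p_3}=2,$$ and let $\theta_2,\theta_3\in(0,\pi)$ be defined by $$(\cos\theta_2,\sin\theta_2)=\left(\sqrt{(p_1-1)(p_2-1)},\ \sqrt{\frac{p_1p_2(p_3-1)}{p_3}}\right),$$ $$(\cos\theta_3,\sin\theta_3)=\left(-\sqrt{(p_1-1)(p_3-1)},\ \sqrt{\frac{p_1p_3(p_2-1)}{p_2}}\right).$$ Then: (i) For all random variables $X,Y\in\mathbb{R}$, $$\frac1{p_1}S_\mu(X)+\frac1{p_2}S_\mu\big(\cos(\theta_2)X+\sin(\theta_2)Y\big)+\frac1{p_3}S_\mu\big(\cos(\theta_3)X+\sin(\theta_3)Y\big)\le S_{\mu_2}(X,Y),$$ with equality if and only if $X$ and $Y$ are independent identically distributed Gaussian variables. (ii) Equivalently, setting $p_1'=\frac{p_1}{p_1-1}$, for all functions $g\in L^{p_2}(\mu)$ and $h\in L^{p_3}(\mu)$, $$\left\|\int_{\mathbb{R}} g\big(\cos(\theta_2)x+\sin(\theta_2)y\big)\,h\big(\cos(\theta_3)x+\sin(\theta_3)y\big)\,d\mu(y)\right\|_{L^{p_1'}(d\mu(x))}\le\|g\|_{L^{p_2}(\mu)}\,\|h\|_{L^{p_3}(\mu)},$$ with equality if and only if $g$ and $h$ are of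 constant sign with $|g(t)|^{p_2}\,d\mu(t)=K_2\,e^{-\lambda(t-a_2)^2}\,dt$ and $|h(t)|^{p_3}\,d\mu(t)=K_3\,e^{-\lambda(t-a_3)^2}\,dt$ for some $a_2,a_3\in\mathbb{R}$ and $K_2,K_3,\lambda\ge0$.
   Context: The standard Gaussian measure $\gamma$ on $\mathbb{R}$ has density $(2\pi)^{-1/2}e^{-t^2/2}$ with respect to Lebesgue measure. For $n\ge1$, $\mu_n:=\mu^{\otimes n}$ is correspondingly Lebesgue measure or the standard Gaussian measure on $\mathbb{R}^n$. If a random vector $X\in\mathbb{R}^n$ has law with density $f$ with respect to $\mu_n$, its entropy with respect to $\mu_n$ is (note the sign convention) $S_{\mu_n}(X):=\int_{\mathbb{R}^n} f\log f\,d\mu_n$. We write $S_\mu=S_{\mu_1}$, and $S_{\mu_2}(X,Y)$ is the entropy of the random vector $(X,Y)\in\mathbb{R}^2$. Standing assumption: only random variables and vectors having a density and a well-defined, finite entropy with respect to the corresponding measure are considered.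
   Formalization: In (i), equality holds iff X and Y are independent Gaussians with a common variance, the means being free, instead of identically distributed; in (ii), equality also holds when g = 0 a.e. or h = 0 a.e., with the other function arbitrary. *)

(* Defs.v *)
From HB Require Import structures.
From mathcomp Require Import all_boot all_order all_algebra.
From mathcomp Require Import all_classical all_reals all_analysis.

Set Implicit Arguments.
Unset Strict Implicit.
Unset Printing Implicit Defensive.

Import Order.TTheory GRing.Theory Num.Theory.
Import numFieldNormedType.Exports.

Local Open Scope classical_set_scope.
Local Open Scope ring_scope.

Definition lebesgue_or_gaussian (R : realType)
    (mu : {sigma_finite_measure set (measurableTypeR R) -> \bar R}) : Prop :=
  mu = lebesgue_measure :> (set (measurableTypeR R) -> \bar R) \/
  mu = normal_prob 0 1 :> (set (measurableTypeR R) -> \bar R).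

Section entropy.
Context d d' (T : measurableType d) (U : measurableType d') (R : realType).
Variables (P : probability T R) (m : {measure set U -> \bar R}).
Implicit Types (Z : T -> U) (f : U -> R).

Definition has_density Z f : Prop :=
  [/\ measurable_fun [set: U] f,
      forall x, 0 <= f x &
      forall A, measurable A ->
        pushforward P Z A = (\int[m]_(x in A) (f x)%:E)%E].

(* 0 log 0 = 0 here, whatever the value of [ln 0]. *)
Definition flogf f (x : U) : R := f x * ln (f x).

Definition finite_entropy Z : Prop :=
  exists2 f, has_density Z f & m.-integrable [set: U] (EFin \o flogf f).

(* The integral of f log f with respect to m, without a minus sign.  For a
   sigma-finite m, two densities of Z agree m-almost everywhere, so the choice
   of f is immaterial; the value is meaningful only under
   [finite_entropy Z]. *)
Definition entropy Z : R :=
  let f := xget (cst 0) [set f | has_density Z f] in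
  \int[m]_x (flogf f x).

End entropy.

Section random_variables.
Context d (T : measurableType d) (R : realType).
Variable P : probability T R.
Implicit Types X Y : T -> measurableTypeR R.

Definition independent X Y : Prop :=
  forall A B : set (measurableTypeR R), measurable A -> measurable B ->
    P (X @^-1` A `&` Y @^-1` B) = (P (X @^-1` A) * P (Y @^-1` B))%E.

Definition gaussian X (a s : R) : Prop :=
  forall A : set (measurableTypeR R), measurable A ->
    pushforward P X A = normal_prob a s A.

(* Entropies with respect to Lebesgue measure are invariant under translation
   of X and of Y separately, so "identically distributed" can only be meant up
   to translation: the variance is common, the two means are free. *)
Definition independent_gaussians_same_variance X Y : Prop :=
  independent X Y /\
  exists a b s : R, [/\ 0 < s, gaussian X a s & gaussian Y b s].

End random_variables.

Section functions.
Context (R : realType).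
Variable mu : {measure set (measurableTypeR R) -> \bar R}.
Implicit Type g : measurableTypeR R -> R.

Definition constant_sign g : Prop :=
  {ae mu, forall x, 0 <= g x} \/ {ae mu, forall x, g x <= 0}.

(* Equality of measures |g|^p dmu = K exp(- l (t - a)^2) dt. *)
Definition gaussian_power g (p K l a : R) : Prop :=
  forall A : set (measurableTypeR R), measurable A ->
    (\int[mu]_(t in A) (`|g t| `^ p)%:E =
     \int[lebesgue_measure]_(t in A) (K * expR (- (l * (t - a) ^+ 2)))%:E)%E.

(* The extended-real integral is -oo, +oo or finite, and it is finite exactly
   when both the positive and the negative part have finite integral. *)
Definition directional_convolution (t2 t3 : R) g (h : measurableTypeR R -> R)
    (x : measurableTypeR R) : \bar R :=
  (\int[mu]_y (g (cos t2 * x + sin t2 * y) *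
               h (cos t3 * x + sin t3 * y))%:E)%E.

End functions.

(* Main.v *)
(* With c_i = 1/p_i and u_1 = (1, 0), u_i = (cos t_i, sin t_i), one has
   sum c_i u_i u_i^T = Id, and the statement is a rank-one Brascamp-Lieb
   inequality in the plane:
     int prod f_i(u_i . z)^c_i dz <= prod (int f_i)^c_i   (f_i >= 0).
   For positive continuous probability densities, transport f_1 to the standard
   Gaussian, transport the Gaussian to f_2 and f_3, and take u_2 . z, u_3 . z as
   coordinates; weighted AM-GM bounds the integrand by the density of a planar
   Gaussian times a Jacobian. Equality forces the derivatives of the transport
   maps to be constant, so the densities are Gaussian with equal variance. The
   inequality passes to all densities by mollification and Fatou's lemma. If
   arbitrary f_i are extremal, so are their convolutions with a Gaussian
   (superpose the inequality), which are regular, hence Gaussian; deconvolving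
   as the variance tends to 0 gives the f_i.

   Both reference measures have a density w with
   w(x) w(y) = prod w(u_i . (x, y))^c_i, which reduces everything to Lebesgue
   measure. For (i), let f be the density of (X, Y), f_i that of u_i . (X, Y)
   and G = prod f_i(u_i . z)^c_i; then E[ln (f / G)] >= E[1 - G / f] >= 0.
   For (ii), let F be the convolution of |g| and |h|: testing against powers of
   F turns the Brascamp-Lieb inequality into the norm bound, and equality gives
   Gaussian |g|^p2 w and |h|^p3 w. Equality also fixes, for almost every x, the
   sign of g(u_2 . z) h(u_3 . z) on the line z = (x, .). Cutting the f_i along
   these signs leaves four products, one of which must be extremal by AM-GM;
   its factors are positive almost everywhere, so g and h have constant sign. *)

Require Import Defs.
From HB Require Import structures.
From mathcomp Require Import all_boot all_order all_algebra.
From mathcomp Require Import all_classical all_reals all_analysis.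
From mathcomp Require Import measurable_realfun ring lra.

Set Implicit Arguments.
Unset Strict Implicit.
Unset Printing Implicit Defensive.

Import Order.TTheory GRing.Theory Num.Theory.
Import numFieldNormedType.Exports.
Import HBNNSimple.

Local Open Scope classical_set_scope.
Local Open Scope ring_scope.

(** Since [sum c_i u_i u_i^T = Id], the map [z |-> (d_i u_i . z)_i] is an isometry of the plane into
    R^3, and [(r1, -r2, r3)] is the unit normal of its image. Most constants come from it: the
    relation [r1 d1 (u_1 . z) - r2 d2 (u_2 . z) + r3 d3 (u_3 . z) = 0], the values
    [|det (u_j, u_k)| = r_i / (d_j d_k)] for distinct i, j, k, and the square dropped when a product
    of Gaussians is bounded by a planar one. By Cauchy-Binet, [z |-> sum c_i t_i(u_i . z) u_i] has
    Jacobian [sum r_i^2 t_j' t_k']. Its weights add up to 1 and [c_i = r_j^2 + r_k^2], so AM-GM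
    bounds it below by exactly [prod (t_i')^c_i]. The same exponents bound products of masses in the
    sign argument. Two kernels smooth the densities. A compactly supported one fits Lebesgue
    differentiation and proves the inequality, but Fatou's lemma loses equality. Gaussians serve for
    the equality case: they factor along the three lines, so smoothing probability densities does
    not decrease the integral, and their semigroup law allows the smoothing to be undone. *)

Section density.
Local Open Scope ereal_scope.
Context d (T : measurableType d) (R : realType).
Implicit Types (m n : {measure set T -> \bar R}) (w : T -> R).

(** The hypothesis settles indicators; simple functions follow by additivity and the rest by
    monotone convergence. [n] is any measure with the right values, so the lemma serves for
    reference measures and for pushforwards alike. *)
Lemma ge0_integral_density m n w : measurable_fun setT w ->
  (forall x, 0 <= w x)%R ->
  (forall A, measurable A -> n A = \int[m]_(x in A) (w x)%:E) ->
  forall f : T -> \bar R, measurable_fun setT f -> (forall x, 0 <= f x) ->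
  \int[n]_x f x = \int[m]_x (f x * (w x)%:E).
Proof.
move=> mw w0 nE f mf f0.
have mT : measurable [set: T] by [].
have mwE : measurable_fun setT (EFin \o w) by exact/measurable_EFinP.
pose g := nnsfun_approx mT mf.
have gf x : (g k x)%:E @[k --> \oo] --> f x.
  by apply: cvg_nnsfun_approx => // *; apply: f0.
transitivity (limn (fun k => \int[n]_x (g k x)%:E)).
  rewrite -monotone_convergence//.
  - by apply: eq_integral => x _; apply/esym/cvg_lim => //; exact: gf.
  - by move=> k; exact/measurable_EFinP/measurable_funP.
  - by move=> k x _; rewrite lee_fin.
  - by move=> x _ i j ij; rewrite lee_fin; exact/lefP/nd_nnsfun_approx.
transitivity (limn (fun k => \int[m]_x ((g k x)%:E * (w x)%:E))); last first.
  rewrite -monotone_convergence//.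
  - apply: eq_integral => x _; apply/cvg_lim => //.
    by apply: cvgeZr => //; exact: gf.
  - by move=> k; apply: emeasurable_funM => //; exact/measurable_EFinP/measurable_funP.
  - by move=> k x _; rewrite mule_ge0// lee_fin.
  - move=> x _ i j ij; rewrite lee_wpmul2r// ?lee_fin//.
    exact/lefP/nd_nnsfun_approx.
congr (limn _); apply/funext => k.
rewrite integralT_nnsfun sintegralE.
under [RHS]eq_integral => x _.
  rewrite fimfunE -fsumEFin// ge0_mule_fsuml; last first.
    by move=> r; rewrite EFinM; exact: nnfun_muleindic_ge0.
  over.
rewrite ge0_integral_fsum//; last 2 first.
- move=> r; apply: emeasurable_funM => //.
  by apply/measurable_EFinP; exact: measurable_funM.
- move=> r x _; rewrite mule_ge0// ?lee_fin//.
  by have := nnfun_muleindic_ge0 (g k) r x; rewrite -EFinM lee_fin.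
apply: eq_fsbigr => r _.
have [r0|r0] := ltP r 0%R.
  rewrite preimage_nnfun0// measure0 mule0 integral0_eq// => x _.
  by rewrite indic0 mulr0 mul0e.
rewrite nE//.
under [RHS]eq_integral => x _ do rewrite EFinM -muleA.
rewrite ge0_integralZl//; last 2 first.
- by apply: emeasurable_funM => //; exact/measurable_EFinP.
- by move=> x _; rewrite mule_ge0// lee_fin.
congr (_ * _); rewrite [LHS]integral_mkcond; apply: eq_integral => x _.
rewrite patchE indicE; case: ifPn => _; by rewrite ?mul1e ?mul0e.
Qed.

Lemma density_measure m w : measurable_fun setT w -> (forall x, 0 <= w x)%R ->
  exists n, forall A, n A = \int[m]_(x in A) (w x)%:E.
Proof.
move=> mw w0.
have mwE : measurable_fun setT (EFin \o w) by exact/measurable_EFinP.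
pose nu A := \int[m]_(x in A) (w x)%:E.
have nu0 : nu set0 = 0 by rewrite /nu integral_set0.
have nu_ge0 A : 0 <= nu A by apply: integral_ge0 => x _; rewrite lee_fin.
have nus : semi_sigma_additive nu.
  move=> F mF tF mUF; rewrite /nu ge0_integral_bigcup//; last 2 first.
  - exact: measurable_funTS.
  - by move=> x _; rewrite lee_fin.
  by apply: is_cvg_ereal_nneg_natsum_cond => k _ _; exact: nu_ge0.
pose H := isMeasure.Build _ _ _ nu nu0 nu_ge0 nus.
pose N : {measure set T -> \bar R} := HB.pack nu H.
by exists N.
Qed.

Lemma pushforward_measure d' (T' : measurableType d') m (f : T -> T') :
  measurable_fun setT f ->
  exists n : {measure set T' -> \bar R},
    n = pushforward m f :> (set T' -> \bar R).
Proof.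
move=> mf.
by exists (measure_function_pushforward__canonical__measure_function_Measure m mf).
Qed.

End density.

(** * Change of variables on the line and null sets *)

Section substitution.
Context (R : realType).
Notation leb := (@lebesgue_measure R).
Implicit Types (h : R -> \bar R).

Definition C1_increasing_bijection (S S' : R -> R) :=
  [/\ forall x : R, is_derive x 1 S (S' x), continuous S',
      forall x, 0 < S' x & forall y, exists x, S x = y].

Lemma is_derive_continuous (f f' : R -> R) :
  (forall x : R, is_derive x 1 f (f' x)) -> continuous f.
Proof.
by move=> df x; apply/differentiable_continuous/derivable1_diffP; case: (df x).
Qed.

Lemma C1ib_continuous {S S'} : C1_increasing_bijection S S' -> continuous S.
Proof. by case=> dS _ _ _; exact: is_derive_continuous dS. Qed.

Lemma is_derive_increasing (f f' : R -> R) :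
  (forall x : R, is_derive x 1 f (f' x)) -> (forall x, 0 < f' x) ->
  {mono f : x y / x <= y}.
Proof.
move=> df f'0; apply: le_mono => x y xy.
have [c _ E] := @MVT R f f' x y xy (fun z _ => df z)
  (continuous_subspaceT (is_derive_continuous df)).
by rewrite -subr_gt0 E mulr_gt0// subr_gt0.
Qed.

Lemma C1ib_mono S S' : C1_increasing_bijection S S' -> {mono S : x y / x <= y}.
Proof. by case=> dS _ S'0 _; exact: is_derive_increasing dS S'0. Qed.

(** The image under [S] of the measure with density [S'] gives every half-open interval its length,
    by the fundamental theorem of calculus; Lebesgue measure is the only measure that does. *)
Lemma lebesgue_measure_C1ib S S' : C1_increasing_bijection S S' ->
  forall A, measurable A ->
  leb A = (\int[leb]_(x in S @^-1` A) (S' x)%:E)%E.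
Proof.
move=> bS; have mS := C1ib_mono bS; have cS := C1ib_continuous bS.
case: (bS) => dS cS' S'0 sS.
have mmS : measurable_fun setT S by exact: continuous_measurable_fun.
have mS' : measurable_fun setT S' by exact: continuous_measurable_fun.
have [N NE] := @density_measure _ (measurableTypeR R) R leb S' mS' (fun x => ltW (S'0 x)).
have [M ME] := @pushforward_measure _ (measurableTypeR R) R _
  (measurableTypeR R) N S mmS.
move=> A mA; rewrite -NE.
have -> : N (S @^-1` A) = M A by rewrite ME.
apply: lebesgue_measure_unique => // _ [[a b] _ <-]/=.
rewrite ME /pushforward NE lebesgue_measure_itv/= lte_fin.
have [c ca] := sS a; have [e eb] := sS b.
have -> : S @^-1` `]a, b] = `]c, e]%classic.
  apply/seteqP; split => x /=; rewrite !in_itv/= -ca -eb mS.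
    by rewrite !ltNge mS.
  by rewrite !ltNge mS.
have -> : (a < b) = (c < e) by rewrite -ca -eb !ltNge mS.
case: ifPn => [ce|]; last first.
  by rewrite -leNgt => ec; rewrite set_itv_ge ?integral_set0// bnd_simp -leNgt.
rewrite integral_itv_obnd_cbnd; last first.
  by apply/measurable_EFinP/measurable_funTS.
rewrite (@continuous_FTC2 _ S' S)//.
- by rewrite ca eb.
- exact: continuous_subspaceT.
- split.
  + by move=> x _; case: (dS x).
  + exact/cvg_at_right_filter/cS.
  + exact/cvg_at_left_filter/cS.
- by move=> x _; rewrite derive1E; apply: derive_val.
Qed.

Lemma ge0_integral_C1ib S S' h : C1_increasing_bijection S S' ->
  measurable_fun setT h -> (forall x, (0 <= h x)%E) ->
  (\int[leb]_x h x = \int[leb]_x (h (S x) * (S' x)%:E))%E.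
Proof.
move=> bS mh h0; have cS := C1ib_continuous bS.
case: (bS) => _ cS' S'0 _.
have mmS : measurable_fun setT S by exact: continuous_measurable_fun.
have mS' : measurable_fun setT S' by exact: continuous_measurable_fun.
have [N NE] := @density_measure _ (measurableTypeR R) R leb S' mS' (fun x => ltW (S'0 x)).
have [M ME] := @pushforward_measure _ (measurableTypeR R) R _
  (measurableTypeR R) N S mmS.
transitivity (\int[M]_x h x)%E.
  apply: eq_measure_integral => A mA _.
  by apply: (etrans (lebesgue_measure_C1ib bS mA)); rewrite -NE ME.
rewrite ME ge0_integral_pushforward// preimage_setT.
apply: (@ge0_integral_density _ (measurableTypeR R) R leb N S') => //.
- by move=> x; exact/ltW.
- exact: measurableT_comp.
- by move=> x; exact: h0.
Qed.

Lemma ge0_integral_affine (a b : R) h : a != 0 ->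
  measurable_fun setT h -> (forall x, (0 <= h x)%E) ->
  (\int[leb]_x h x = `|a|%:E * \int[leb]_x h (a * x + b)%R)%E.
Proof.
have H (c e : R) k : 0 < c -> measurable_fun setT k -> (forall x, (0 <= k x)%E) ->
    (\int[leb]_x k x = c%:E * \int[leb]_x k (c * x + e)%R)%E.
  move=> c0 mk k0.
  have bij : C1_increasing_bijection (fun x => c * x + e) (cst c).
    split => //.
    - move=> x; have -> : cst c x = c *: 1 + 0 by rewrite addr0 /GRing.scale/= mulr1.
      apply: is_deriveD.
    - exact: cst_continuous.
    - by move=> y; exists ((y - e) / c); rewrite mulrC divfK ?subrK// gt_eqF.
  rewrite (ge0_integral_C1ib bij)//.
  rewrite -ge0_integralZl//; last 2 first.
  - by apply: measurableT_comp => //; apply: continuous_measurable_fun; exact: C1ib_continuous bij.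
  - by rewrite lee_fin ltW.
  by apply: eq_integral => x _; rewrite muleC.
move=> a0 mh h0; have [a_gt0|a_lt0] := ltP 0 a; first by rewrite gtr0_norm//; exact: H.
have {a0}a_lt0 : a < 0 by rewrite lt_neqAle a0.
(* A negative slope is reduced by reflection of the line to the slope [- a], covered by [H]. *)
rewrite (_ : \int[leb]_x h x = \int[leb]_x h (- x)%R)%E; last first.
  have mN : measurable_fun setT (-%R : R -> R) by exact: oppr_measurable.
  transitivity (\int[pushforward leb (-%R : measurableTypeR R -> measurableTypeR R)]_x h x)%E; last first.
    by rewrite ge0_integral_pushforward//= ?preimage_setT.
  by apply: eq_measure_integral => A mA _; exact/esym/lebesgue_measureN.
rewrite ltr0_norm// (_ : \int[leb]_x h (- x)%R =
    - a%:E * \int[leb]_x h (- (- a * x + - b))%R)%E.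
  by congr (_ * _)%E; apply: eq_integral => x _; congr h; ring.
rewrite -EFinN (H (- a) (- b) (h \o -%R))/= ?oppr_gt0//.
by apply: measurableT_comp => //; exact: oppr_measurable.
Qed.

Lemma null_affine (a b : R) (A : set R) : a != 0 -> measurable A ->
  leb A = 0%E -> leb ((fun x => a * x + b) @^-1` A) = 0%E.
Proof.
move=> a0 mA A0; set B := _ @^-1` A.
have mf : measurable_fun setT (fun x : R => a * x + b).
  by apply: measurable_funD => //; exact: measurable_funM.
have mB : measurable B by rewrite -[B]setTI; exact: mf.
have := @ge0_integral_affine a b (EFin \o \1_A) a0.
have -> : (\int[leb]_x (EFin \o \1_A) x = 0)%E.
  by rewrite integral_indic// setIT; exact: A0.
move=> /(_ _ _)/esym H.
have /eqP : (`|a|%:E * \int[leb]_x (EFin \o \1_A) (a * x + b)%R = 0)%E.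
  by apply: H => [|x]; [exact/measurable_EFinP|rewrite lee_fin].
rewrite mule_eq0 eqe normr_eq0 (negbTE a0)/= => /eqP I0.
transitivity (\int[leb]_x (EFin \o \1_B) x)%E => //.
by rewrite integral_indic// setIT.
Qed.

Lemma ae_affine (a b : R) (Q : R -> Prop) : a != 0 ->
  {ae leb, forall x, Q x} -> {ae leb, forall x, Q (a * x + b)}.
Proof.
move=> a0 [N [mN N0 NQ]]; exists ((fun x => a * x + b) @^-1` N); split.
- have mf : measurable_fun setT (fun x : R => a * x + b).
    by apply: measurable_funD => //; exact: measurable_funM.
  by rewrite -[_ @^-1` _]setTI; exact: mf.
- exact: null_affine.
- by move=> x nQ; apply: NQ.
Qed.

(** Tonelli applied to the exceptional set. A measurable superset [A] of the bad points is required,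
    because null slices say nothing about a set that is not measurable. *)
Lemma ae_prod (Q : R * R -> Prop) (A : set (R * R)) : measurable A ->
  (forall z, ~ Q z -> A z) ->
  {ae leb, forall x, {ae leb, forall y, ~ A (x, y)}} ->
  {ae (leb \x leb)%E, forall z, Q z}.
Proof.
move=> mA QA aeA; exists A; split => //.
rewrite /product_measure1/=.
rewrite (ae_eq_integral (cst 0%E))//.
- exact: integral0.
- exact: measurable_fun_xsection.
- move: aeA; apply: filterS; first exact: (ae_filter_ringOfSetsType leb).
  move=> x [N [mN N0 AN]] _ /=.
  apply: (subset_measure0 _ mN) => //.
    exact: measurable_xsection.
  by move=> y /= yA; apply: AN => /=; apply; move: yA; rewrite /xsection/= inE.
Qed.

Lemma ae_prod_lin (a b : R) (Q : R -> Prop) : b != 0 ->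
  {ae leb, forall x, Q x} ->
  {ae (leb \x leb)%E, forall z : R * R, Q (a * z.1 + b * z.2)}.
Proof.
move=> b0 [N [mN N0 NQ]].
apply: (@ae_prod _ ((fun z : R * R => a * z.1 + b * z.2) @^-1` N)).
- rewrite -[_ @^-1` _]setTI.
  have : measurable_fun setT (fun z : R * R => a * z.1 + b * z.2).
    by apply: measurable_funD; apply: measurable_funM.
  exact.
- by move=> z nQ; apply: NQ.
- apply: nearW => x; exists ((fun y => b * y + a * x) @^-1` N); split.
  + rewrite -[_ @^-1` _]setTI.
    have : measurable_fun setT (fun y : R => b * y + a * x).
      by apply: measurable_funD => //; exact: measurable_funM.
    exact.
  + exact: null_affine.
  + by move=> y /= /contrapT; rewrite addrC.
Qed.

Lemma ae_prod_fst (Q : R -> Prop) : {ae leb, forall x, Q x} ->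
  {ae (leb \x leb)%E, forall z : R * R, Q z.1}.
Proof.
move=> [N [mN N0 NQ]].
apply: (@ae_prod _ (fst @^-1` N)).
- rewrite -[_ @^-1` _]setTI.
  have : measurable_fun setT (fst : R * R -> R) by [].
  exact.
- by move=> z nQ; apply: NQ.
- exists N; split => // x /= nN; apply: contrapT => nNx; apply: nN.
  exact: nearW.
Qed.

End substitution.

(** * Monotone transport between positive continuous densities *)

Section transport.
Context (R : realType).
Notation leb := (@lebesgue_measure R).

Definition cdf_of_pdf (f : R -> R) (x : R) : R :=
  (\int[leb]_(t in `]-oo, x]) f t)%R.

Section cdf.
Variables (f : R -> R).
Hypotheses (cf : continuous f) (f0 : forall x, 0 < f x)
  (f1 : (\int[leb]_x (f x)%:E = 1)%E).
Notation F := (cdf_of_pdf f).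

Let mf : measurable_fun setT f. Proof. exact: continuous_measurable_fun. Qed.

Let intf : leb.-integrable setT (EFin \o f).
Proof.
apply/integrableP; split; first exact/measurable_EFinP.
under eq_integral do rewrite /= gtr0_norm//.
by rewrite f1 ltry.
Qed.

Lemma cdf_is_derive (x : R) : is_derive x 1 F (f x).
Proof.
have intfx : leb.-integrable `]-oo, x + 1] (EFin \o f).
  by apply: integrableS intf.
have xx1 : x < x + 1 by rewrite ltrDl.
have cfx : {for x, continuous f} by exact: cf.
have [dF F'] := continuous_FTC1 xx1 intfx (ltNyr _) cfx.
by apply: DeriveDef; [exact: dF|rewrite -F' derive1E].
Qed.

Lemma cdf_le1 x : 0 <= F x <= 1.
Proof.
have I : (0 <= \int[leb]_(t in `]-oo, x]) (f t)%:E <= 1)%E.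
  apply/andP; split; first by apply: integral_ge0 => t _; rewrite lee_fin ltW.
  rewrite -f1; apply: ge0_subset_integral => //.
  - exact/measurable_EFinP.
  - by move=> t _; rewrite lee_fin ltW.
have fin : (\int[leb]_(t in `]-oo, x]) (f t)%:E)%E \is a fin_num.
  rewrite ge0_fin_numE; first by case/andP : I => _ /le_lt_trans; apply; rewrite ltry.
  by case/andP : I.
by rewrite -!lee_fin /cdf_of_pdf /Rintegral fineK.
Qed.

Lemma cdf_mono : {mono F : x y / x <= y}.
Proof. exact: is_derive_increasing cdf_is_derive f0. Qed.

Lemma cdf_range x : 0 < F x < 1.
Proof.
have /andP[_ h1] := cdf_le1 (x + 1); have /andP[h0 _] := cdf_le1 (x - 1).
apply/andP; split.
  by apply: le_lt_trans h0 _; rewrite ltNge cdf_mono -ltNge ltrBlDr ltrDl.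
by apply: lt_le_trans h1; rewrite ltNge cdf_mono -ltNge ltrDl.
Qed.

Lemma cdf_cvg_itv : (\int[leb]_(t in `](- n%:R)%R, n%:R%R]) (f t)%:E)%E @[n --> \oo] --> 1%E.
Proof.
have := @ge0_nondecreasing_set_cvg_integral _ (measurableTypeR R) R
  (fun n : nat => `](- n%:R)%R, n%:R]%classic) (EFin \o f) leb.
rewrite bigcup_itvT f1; apply.
- move=> m n mn; apply/subsetPset => x /=; rewrite !in_itv/= => /andP[h1 h2].
  rewrite (le_trans h2) ?ler_nat// andbT (le_lt_trans _ h1)// lerN2 ler_nat//.
- by move=> n; exact: measurable_itv.
- by move=> n; apply/measurable_EFinP/measurable_funTS.
- by move=> n x _; rewrite lee_fin ltW.
Qed.

Lemma cdf_surj v : 0 < v < 1 -> exists x, F x = v.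
Proof.
move=> /andP[v0 v1].
have cF : continuous F by exact: is_derive_continuous cdf_is_derive.
have Fn (n : nat) : (0 < n)%N ->
    fine (\int[leb]_(t in `](- n%:R)%R, n%:R%R]) (f t)%:E)%E = F n%:R - F (- n%:R).
  move=> n0; rewrite integral_itv_obnd_cbnd; last first.
    by apply/measurable_EFinP/measurable_funTS.
  rewrite (@continuous_FTC2 _ f F)//.
  - by rewrite gtrN// ltr0n.
  - exact: continuous_subspaceT.
  - split.
    + by move=> x _; case: (cdf_is_derive x).
    + exact/cvg_at_right_filter/cF.
    + exact/cvg_at_left_filter/cF.
  - by move=> x _; rewrite derive1E; apply: (@derive_val _ _ _ _ _ _ _ (cdf_is_derive x)).
(* An increment [F n - F (- n)] above this threshold puts [v] between the two values: [F (- n) > 0]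
   gives [F n > v], and [F n < 1] gives [F (- n) < v]. *)
have e0 : 1 - Num.min v (1 - v) < 1.
  by rewrite gtrBl lt_min v0 subr_gt0.
have [n n0 nH] : exists2 n : nat, (0 < n)%N & 1 - Num.min v (1 - v) < F n%:R - F (- n%:R).
  have /fine_cvgP[_ /cvgr_gt/(_ _ e0)] := cdf_cvg_itv.
  move=> [m _ H]; exists m.+1 => //.
  by rewrite -Fn//; apply: H => /=.
have /andP[F0 _] := cdf_range (- n%:R).
have /andP[_ F1] := cdf_range n%:R.
have mv : Num.min v (1 - v) <= v by rewrite ge_min lexx.
have mv' : Num.min v (1 - v) <= 1 - v by rewrite ge_min lexx orbT.
have nn : (- n%:R : R) <= n%:R by rewrite ge0_cp// ler0n.
have [||x _ <-] := @IVT R F (- n%:R) n%:R v nn.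
- exact: continuous_subspaceT.
- rewrite ge_min le_max; apply/andP; split; apply/orP; [left|right]; lra.
- by exists x.
Qed.

End cdf.

(** [S] is the monotone rearrangement, the inverse of the distribution function of [f] composed with
    that of [g]; the equation is the derivative of [F (S p) = G p]. Positivity of [f] makes [F]
    invertible with a differentiable inverse. *)
Lemma transport (f g : R -> R) :
  continuous f -> (forall x, 0 < f x) -> (\int[leb]_x (f x)%:E = 1)%E ->
  continuous g -> (forall x, 0 < g x) -> (\int[leb]_x (g x)%:E = 1)%E ->
  exists S S' : R -> R, C1_increasing_bijection S S' /\
    forall p, f (S p) * S' p = g p.
Proof.
move=> cf f0 f1 cg g0 g1.
pose F := cdf_of_pdf f; pose G := cdf_of_pdf g.
have dF : forall x : R, is_derive x 1 F (f x) := cdf_is_derive cf f0 f1.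
have dG : forall x : R, is_derive x 1 G (g x) := cdf_is_derive cg g0 g1.
have mF : {mono F : x y / x <= y} := cdf_mono cf f0 f1.
have mG : {mono G : x y / x <= y} := cdf_mono cg g0 g1.
have Finj : injective F.
  move=> x y Fxy; apply/eqP; rewrite eq_le.
  by rewrite -[x <= y]mF -[y <= x]mF Fxy lexx.
have Ginj : injective G.
  move=> x y Gxy; apply/eqP; rewrite eq_le.
  by rewrite -[x <= y]mG -[y <= x]mG Gxy lexx.
pose K (v : R) : R := xget (0 : R) [set x : R | F x = v].
have FK : cancel F K.
  by move=> x; apply: Finj; rewrite /K; case: xgetP => [y _ ->//|/(_ x)]; case.
have KG p : F (K (G p)) = G p.
  rewrite /K; case: xgetP => [x _ ->//|].
  by have [x Fx] := cdf_surj cf f0 f1 (cdf_range cg g0 g1 p) => /(_ x); case.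
pose S := K \o G; pose S' p := (f (S p))^-1 * g p.
have dS : forall p : R, is_derive p 1 S (S' p).
  move=> p; rewrite /S'; apply: is_derive1_comp => //.
  rewrite -[G p]KG; apply: is_derive_inverse.
  - by exists 1 => //= v _; exact: FK.
  - by exists 1 => //= v _; exact: is_derive_continuous dF v.
  - by rewrite gt_eqF.
exists S, S'; split; last first.
  by move=> p; rewrite /S' mulrA mulfV ?mul1r// gt_eqF.
split => //.
- move=> p; apply: cvgM; last exact: cg.
  apply: cvgV; first by rewrite gt_eqF.
  apply: (@continuous_comp _ _ _ S f); last exact: cf.
  exact: is_derive_continuous dS p.
- by move=> p; rewrite mulr_gt0// invr_gt0.
- move=> y.
  have [p Gp] := cdf_surj cg g0 g1 (cdf_range cf f0 f1 y).
  by exists p; apply: Finj; rewrite /S/= KG.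
Qed.

End transport.

(** * Weighted AM-GM with its equality case, and elementary real functions *)

Section amgm.
Context (R : realType).
Implicit Types a b c u v w : R.

Let ln_le_sub1 a : 0 < a -> ln a <= a - 1.
Proof.
by move=> a0; rewrite lerBrDl -[X in _ <= X]lnK ?posrE// expR_ge1Dx.
Qed.

Let ln_eq_sub1 a : 0 < a -> ln a = a - 1 -> a = 1.
Proof.
move=> a0 H; apply/eqP; rewrite -ln_eq0//; apply: contraT => /expR_gt1Dx.
by rewrite lnK ?posrE// H addrC subrK ltxx.
Qed.

(** Divide by the weighted mean [S] and apply [ln x <= x - 1] to each quotient: the three right-hand
    sides have weighted sum 0. Equality of the weighted sums forces equality in each of the three
    bounds, hence each quotient is 1. *)
Lemma amgm3_gt0 a b c u v w : 0 < a -> 0 < b -> 0 < c ->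
  0 < u -> 0 < v -> 0 < w -> u + v + w = 1 ->
  a `^ u * b `^ v * c `^ w <= u * a + v * b + w * c /\
  (a `^ u * b `^ v * c `^ w = u * a + v * b + w * c -> a = b /\ b = c).
Proof.
move=> a0 b0 c0 u0 v0 w0 uvw.
set S := u * a + v * b + w * c.
have S0 : 0 < S by rewrite !addr_gt0// mulr_gt0.
have aS : 0 < a / S by rewrite divr_gt0.
have bS : 0 < b / S by rewrite divr_gt0.
have cS : 0 < c / S by rewrite divr_gt0.
have E0 : u * (a / S - 1) + v * (b / S - 1) + w * (c / S - 1) = 0.
  have -> : u * (a / S - 1) + v * (b / S - 1) + w * (c / S - 1) =
    S / S - (u + v + w) by rewrite /S; ring.
  by rewrite uvw divff ?subrr// gt_eqF.
have PE : a `^ u * b `^ v * c `^ w =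
    expR (u * ln (a / S) + v * ln (b / S) + w * ln (c / S)) * S.
  have -> : forall X, expR X * S = expR (X + ln S) by move=> X; rewrite expRD lnK.
  rewrite /powR !gt_eqF// -!expRD.
  have {1}-> : ln S = (u + v + w) * ln S by rewrite uvw mul1r.
  rewrite !ln_div ?posrE//.
  by congr expR; ring.
have la := ler_wpM2l (ltW u0) (ln_le_sub1 aS).
have lb := ler_wpM2l (ltW v0) (ln_le_sub1 bS).
have lc := ler_wpM2l (ltW w0) (ln_le_sub1 cS).
split.
  rewrite PE ler_piMl ?(ltW S0)// expR_le1; lra.
rewrite PE => E; have S1 : S != 0 by rewrite gt_eqF.
have {E}/expR_inj H : expR (u * ln (a / S) + v * ln (b / S) + w * ln (c / S)) = expR 0.
  by apply: (mulIf S1); rewrite E expR0 mul1r.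
have ea : u * ln (a / S) = u * (a / S - 1) by lra.
have eb : v * ln (b / S) = v * (b / S - 1) by lra.
have ec : w * ln (c / S) = w * (c / S - 1) by lra.
have {ea}/(ln_eq_sub1 aS)/eqP : ln (a / S) = a / S - 1.
  by apply: (mulfI _ ea); rewrite gt_eqF.
have {eb}/(ln_eq_sub1 bS)/eqP : ln (b / S) = b / S - 1.
  by apply: (mulfI _ eb); rewrite gt_eqF.
have {ec}/(ln_eq_sub1 cS)/eqP : ln (c / S) = c / S - 1.
  by apply: (mulfI _ ec); rewrite gt_eqF.
by rewrite !(can2_eq (divfK _) (mulfK _)) ?(gt_eqF S0)// !mul1r => /eqP -> /eqP -> /eqP ->.
Qed.

Lemma amgm3 a b c u v w : 0 <= a -> 0 <= b -> 0 <= c ->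
  0 < u -> 0 < v -> 0 < w -> u + v + w = 1 ->
  a `^ u * b `^ v * c `^ w <= u * a + v * b + w * c.
Proof.
move=> a0 b0 c0 u0 v0 w0 uvw.
have S0 : 0 <= u * a + v * b + w * c by rewrite !addr_ge0// mulr_ge0// ltW.
have [az|an] := eqVneq a 0.
  by rewrite (_ : a `^ u = 0) ?mul0r// az powR0// gt_eqF.
have [bz|bn] := eqVneq b 0.
  by rewrite (_ : b `^ v = 0) ?mulr0 ?mul0r// bz powR0// gt_eqF.
have [cz|cn] := eqVneq c 0.
  by rewrite (_ : c `^ w = 0) ?mulr0// cz powR0// gt_eqF.
have a1 : 0 < a by rewrite lt_neqAle eq_sym an.
have b1 : 0 < b by rewrite lt_neqAle eq_sym bn.
have c1 : 0 < c by rewrite lt_neqAle eq_sym cn.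
by case: (amgm3_gt0 a1 b1 c1 u0 v0 w0 uvw).
Qed.

End amgm.

Section real_functions.
Context (R : realType).
Notation leb := (@lebesgue_measure R).

Lemma normal_pdf_expR (m s x : R) : s != 0 ->
  normal_pdf m s x = expR (ln (normal_peak s) - (x - m) ^+ 2 / (s ^+ 2 *+ 2)).
Proof.
move=> s0; rewrite normal_pdfE// expRD lnK ?posrE ?normal_peak_gt0//.
by rewrite /normal_fun mulNr.
Qed.

Lemma normal_pdf_gt0 (m s x : R) : s != 0 -> 0 < normal_pdf m s x.
Proof. by move=> s0; rewrite normal_pdf_expR// expR_gt0. Qed.

Lemma is_derive_affine (k c x : R) : is_derive x 1 (fun x => k * x + c) k.
Proof.
suff : is_derive x 1 (fun x => k * x + c) (k *: 1 + 0).
  by rewrite addr0 /GRing.scale/= mulr1.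
exact: is_deriveD.
Qed.

Lemma is_derive_lin2 (f f' h h' : R -> R) (a b : R) :
  (forall x : R, is_derive x 1 f (f' x)) ->
  (forall x : R, is_derive x 1 h (h' x)) ->
  forall x : R, is_derive x 1 (fun x => a * f x + b * h x) (a * f' x + b * h' x).
Proof.
by move=> df dh x; apply: is_deriveD.
Qed.

Lemma C1ib_add_linear (u u' : R -> R) (b c : R) : 0 < b ->
  (forall x : R, is_derive x 1 u (u' x)) -> continuous u' ->
  (forall x, 0 <= u' x) ->
  C1_increasing_bijection (fun x => u x + (b * x + c)) (fun x => u' x + b).
Proof.
move=> b0 du cu' u'0.
have dF : forall x : R, is_derive x 1 (fun x => u x + (b * x + c)) (u' x + b).
  move=> x; have -> : u' x + b = u' x + (b *: 1 + 0).
    by rewrite addr0 /GRing.scale/= mulr1.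
  apply: is_deriveD.
have F'0 x : 0 < u' x + b by rewrite ltr_wpDl.
have um : {homo u : x y / x <= y}.
  move=> x y; rewrite le_eqVlt => /predU1P[->//|xy].
  have [z _ E] := MVT xy (fun z _ => du z)
    (continuous_subspaceT (is_derive_continuous du)).
  by rewrite -subr_ge0 E mulr_ge0// subr_ge0 ltW.
split => //.
  by move=> x; apply: cvgD; [exact: cu'|exact: cvg_cst].
move=> y; pose F x := u x + (b * x + c).
(* [z] solves the equation with [u] frozen at its value in 0. As [u] is nondecreasing, [u z - u 0]
   has the sign of [z], so [y] lies between the values of [F] at 0 and at [z]. *)
pose z := (y - u 0 - c) / b.
have bz : b * z = y - u 0 - c by rewrite /z mulrC divfK// gt_eqF.
have [z0|z0] := leP 0 z.
- have [||x _ <-] := @IVT R F 0 z y z0.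
  + exact/continuous_subspaceT/(is_derive_continuous dF).
  + rewrite ge_min le_max; apply/andP; split; apply/orP; [left|right].
      by rewrite /F mulr0; have : 0 <= b * z by [rewrite mulr_ge0// ltW]; lra.
    by rewrite /F bz; have := um _ _ z0; lra.
  + by exists x.
- have [||x _ <-] := @IVT R F z 0 y (ltW z0).
  + exact/continuous_subspaceT/(is_derive_continuous dF).
  + rewrite ge_min le_max; apply/andP; split; apply/orP; [left|right].
      by rewrite /F bz; have := um _ _ (ltW z0); lra.
    by rewrite /F mulr0; have : b * z <= 0 by [rewrite mulr_ge0_le0// ltW]; lra.
  + by exists x.
Qed.

Lemma continuous_ae_cst (f : R -> R) (c : R) : continuous f ->
  {ae leb, forall x, f x = c} -> forall x, f x = c.
Proof.
move=> cf [N [mN N0 NP]] x; apply: contrapT => fxc.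
have /cf : nbhs (f x) [set y | y != c].
  by apply: open_nbhs_nbhs; split; [exact: open_neq|apply/eqP].
move=> /nbhs_ballP[e /= e0 xe].
have B0 : leb (ball x e) = (e *+ 2)%:E by apply: lebesgue_measure_ball; exact: ltW.
have : (leb (ball x e) <= 0)%E; last by rewrite B0 lee_fin pmulrn_lle0// leNgt e0.
rewrite -N0; apply: le_measure; rewrite ?inE//; first exact: measurable_ball.
by move=> y /xe /= /eqP; exact: NP.
Qed.

End real_functions.

(** * Tonelli and changes of variables in the plane *)

Section plane.
Local Open Scope ereal_scope.
Context (R : realType).
Notation leb := (@lebesgue_measure R).
Implicit Types (F : R * R -> \bar R).

Lemma measurable_lin2 (a b : R) :
  measurable_fun setT (fun z : R * R => a * z.1 + b * z.2)%R.
Proof. by apply: measurable_funD; apply: measurable_funM. Qed.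

Lemma tonelli1 F : measurable_fun setT F -> (forall z, 0 <= F z) ->
  \int[leb \x leb]_z F z = \int[leb]_x \int[leb]_y F (x, y).
Proof.
move=> mF F0.
exact: (@fubini_tonelli1 _ _ (measurableTypeR R) (measurableTypeR R) R leb leb).
Qed.

Lemma tonelli2 F : measurable_fun setT F -> (forall z, 0 <= F z) ->
  \int[leb \x leb]_z F z = \int[leb]_y \int[leb]_x F (x, y).
Proof.
move=> mF F0.
exact: (@fubini_tonelli2 _ _ (measurableTypeR R) (measurableTypeR R) R leb leb).
Qed.

Lemma measurable_tonelli1 F : measurable_fun setT F -> (forall z, 0 <= F z) ->
  measurable_fun setT (fun x => \int[leb]_y F (x, y)).
Proof.
move=> mF F0.
exact: (@measurable_fun_fubini_tonelli_F _ _ (measurableTypeR R) (measurableTypeR R) R leb).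
Qed.

Lemma measurable_tonelli2 F : measurable_fun setT F -> (forall z, 0 <= F z) ->
  measurable_fun setT (fun y => \int[leb]_x F (x, y)).
Proof.
move=> mF F0.
exact: (@measurable_fun_fubini_tonelli_G _ _ (measurableTypeR R) (measurableTypeR R) R leb).
Qed.

(** Linear substitutions in the plane are performed as compositions of shears in one coordinate,
    each of which is an affine substitution on the line inside Tonelli. *)
Lemma ge0_integral_shear2 (c e : R) F : e != 0%R ->
  measurable_fun setT F -> (forall z, 0 <= F z) ->
  \int[leb \x leb]_z F z =
  `|e|%:E * \int[leb \x leb]_z F (z.1, (c * z.1 + e * z.2)%R).
Proof.
move=> e0 mF F0.
have mF' : measurable_fun setT (fun z : R * R => F (z.1, (c * z.1 + e * z.2)%R)).
  apply: measurableT_comp => //; apply: measurable_fun_pair => //.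
  exact: measurable_lin2.
rewrite (tonelli1 mF F0) (tonelli1 mF' (fun z => F0 _)).
rewrite -ge0_integralZl//; last 2 first.
- exact: (measurable_tonelli1 mF' (fun z => F0 _)).
- by move=> x _; exact: integral_ge0.
apply: eq_integral => x _ /=.
rewrite (@ge0_integral_affine _ e (c * x) (fun y => F (x, y)))//; last first.
  by apply: measurableT_comp => //; exact: measurable_pair1.
by congr (_ * _); apply: eq_integral => y _; rewrite addrC.
Qed.

Lemma ge0_integral_shear1 (a b : R) F : a != 0%R ->
  measurable_fun setT F -> (forall z, 0 <= F z) ->
  \int[leb \x leb]_z F z =
  `|a|%:E * \int[leb \x leb]_z F ((a * z.1 + b * z.2)%R, z.2).
Proof.
move=> a0 mF F0.
have mF' : measurable_fun setT (fun z : R * R => F ((a * z.1 + b * z.2)%R, z.2)).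
  apply: measurableT_comp => //; apply: measurable_fun_pair => //.
  exact: measurable_lin2.
rewrite (tonelli2 mF F0) (tonelli2 mF' (fun z => F0 _)).
rewrite -ge0_integralZl//; last 2 first.
- exact: (measurable_tonelli2 mF' (fun z => F0 _)).
- by move=> x _; exact: integral_ge0.
apply: eq_integral => y _ /=.
rewrite (@ge0_integral_affine _ a (b * y) (fun x => F (x, y)))//.
by apply: measurableT_comp => //; exact: measurable_pair2.
Qed.

Lemma ge0_integral_C1ib2 (S S' T T' : R -> R) F :
  C1_increasing_bijection S S' -> C1_increasing_bijection T T' ->
  measurable_fun setT F -> (forall z, 0 <= F z) ->
  \int[leb \x leb]_z F z =
  \int[leb \x leb]_z (F (S z.1, T z.2) * (S' z.1 * T' z.2)%:E).
Proof.
move=> bS bT mF F0.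
have mS : measurable_fun setT S by apply: continuous_measurable_fun; exact: C1ib_continuous bS.
have mT : measurable_fun setT T by apply: continuous_measurable_fun; exact: C1ib_continuous bT.
have [_ cS' S'0 _] := bS; have [_ cT' T'0 _] := bT.
have mS' : measurable_fun setT S' by exact: continuous_measurable_fun.
have mT' : measurable_fun setT T' by exact: continuous_measurable_fun.
have mF' : measurable_fun setT (fun z : R * R => F (S z.1, T z.2) * (S' z.1 * T' z.2)%:E).
  apply: emeasurable_funM.
    apply: measurableT_comp => //; apply: measurable_fun_pair; exact: measurableT_comp.
  by apply/measurable_EFinP; apply: measurable_funM; exact: measurableT_comp.
have F'0 (z : R * R) : 0 <= F (S z.1, T z.2) * (S' z.1 * T' z.2)%:E.
  by rewrite mule_ge0// lee_fin mulr_ge0// ltW.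
rewrite (tonelli1 mF F0) (tonelli1 mF' F'0).
rewrite (ge0_integral_C1ib bS)//; last 2 first.
- exact: measurable_tonelli1.
- by move=> x; exact: integral_ge0.
apply: eq_integral => x _ /=.
rewrite (ge0_integral_C1ib bT)//; last first.
  by apply: measurableT_comp => //; exact: measurable_pair1.
rewrite -ge0_integralZr//; last 3 first.
- apply: emeasurable_funM; last exact/measurable_EFinP.
  apply: measurableT_comp => //; apply: measurable_fun_pair => //.
- by move=> y _; rewrite mule_ge0// lee_fin ltW.
- by rewrite lee_fin ltW.
by apply: eq_integral => y _; rewrite -muleA -EFinM mulrC.
Qed.

End plane.

(** * The Brascamp-Lieb inequality along three lines of the plane *)

(* With [c_i = d_i^2 = 1/p_i] and [r_i^2 = 1 - c_i], the three directions of
   the plane are (1, 0), (cos t2, sin t2) and (cos t3, sin t3). *)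
Record BLdatum (R : realType) := MkBLdatum {
  br1 : R ; br2 : R ; br3 : R ; bd1 : R ; bd2 : R ; bd3 : R ;
  br1_gt0 : 0 < br1 ; br2_gt0 : 0 < br2 ; br3_gt0 : 0 < br3 ;
  bd1_gt0 : 0 < bd1 ; bd2_gt0 : 0 < bd2 ; bd3_gt0 : 0 < bd3 ;
  br_sum : br1 ^+ 2 + br2 ^+ 2 + br3 ^+ 2 = 1 ;
  bd1E : bd1 ^+ 2 = 1 - br1 ^+ 2 ;
  bd2E : bd2 ^+ 2 = 1 - br2 ^+ 2 ;
  bd3E : bd3 ^+ 2 = 1 - br3 ^+ 2 }.

Section BL.
Context (R : realType) (D : BLdatum R).
Notation leb := (@lebesgue_measure R).
Notation r1 := (br1 D). Notation r2 := (br2 D). Notation r3 := (br3 D).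
Notation d1 := (bd1 D). Notation d2 := (bd2 D). Notation d3 := (bd3 D).
Notation g := (@normal_pdf R 0 1).
Implicit Types (f : R -> R) (z : R * R).

(** As [d_i^2 = 1/p_i] and [r_i^2 = 1 - 1/p_i], one has [p_i - 1 = r_i^2 / d_i^2]; the coefficients
    are therefore the cosine and sine of the given angles, without square roots of expressions in
    the exponents. *)
Definition BLu2 z := r1 * r2 / (d1 * d2) * z.1 + r3 / (d1 * d2) * z.2.
Definition BLu3 z := - (r1 * r3 / (d1 * d3)) * z.1 + r2 / (d1 * d3) * z.2.

Definition BLprod f1 f2 f3 z : R :=
  f1 z.1 `^ (d1 ^+ 2) * f2 (BLu2 z) `^ (d2 ^+ 2) * f3 (BLu3 z) `^ (d3 ^+ 2).

Definition BLint f1 f2 f3 : \bar R :=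
  (\int[leb \x leb]_z (BLprod f1 f2 f3 z)%:E)%E.

Let r1n : r1 != 0. Proof. by rewrite gt_eqF ?br1_gt0. Qed.
Let r2n : r2 != 0. Proof. by rewrite gt_eqF ?br2_gt0. Qed.
Let r3n : r3 != 0. Proof. by rewrite gt_eqF ?br3_gt0. Qed.
Let d1n : d1 != 0. Proof. by rewrite gt_eqF ?bd1_gt0. Qed.
Let d2n : d2 != 0. Proof. by rewrite gt_eqF ?bd2_gt0. Qed.
Let d3n : d3 != 0. Proof. by rewrite gt_eqF ?bd3_gt0. Qed.

(** Pythagoras in R^3 for the vector [(d1 a, d2 b, d3 c)]. The first two squares are its components
    in the image of the plane, that is the coordinates of [d1^2 a u_1 + d2^2 b u_2 + d3^2 c u_3];
    the last is its component along the unit normal [(r1, -r2, r3)]. *)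
Lemma BL_identity (a b c : R) :
  d1 ^+ 2 * a ^+ 2 + d2 ^+ 2 * b ^+ 2 + d3 ^+ 2 * c ^+ 2 =
  (d1 ^+ 2 * a + r1 * r2 * d2 / d1 * b - r1 * r3 * d3 / d1 * c) ^+ 2 +
  ((d2 * r3 * b + d3 * r2 * c) / d1) ^+ 2 +
  (r1 * d1 * a - r2 * d2 * b + r3 * d3 * c) ^+ 2.
Proof.
have E1 := bd1E D; have E2 := bd2E D; have E3 := bd3E D; have E := br_sum D.
have r1E : r1 ^+ 2 = 1 - r2 ^+ 2 - r3 ^+ 2 by lra.
have d1E' : d1 ^+ 2 = r2 ^+ 2 + r3 ^+ 2 by lra.
have d2E' : d2 ^+ 2 = 1 - r2 ^+ 2 by lra.
have d3E' : d3 ^+ 2 = 1 - r3 ^+ 2 by lra.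
apply: (mulfI (_ : d1 ^+ 2 != 0)); first by rewrite expf_neq0.
transitivity (d1 ^+ 4 * a ^+ 2 + d1 ^+ 2 * (d2 ^+ 2 * b ^+ 2) + d1 ^+ 2 * (d3 ^+ 2 * c ^+ 2)); first by ring.
transitivity (d1 ^+ 4 * (d1 ^+ 2 + r1 ^+ 2) * a ^+ 2
  + d2 ^+ 2 * (r1 ^+ 2 * r2 ^+ 2 + r3 ^+ 2 + d1 ^+ 2 * r2 ^+ 2) * b ^+ 2
  + d3 ^+ 2 * (r1 ^+ 2 * r3 ^+ 2 + r2 ^+ 2 + d1 ^+ 2 * r3 ^+ 2) * c ^+ 2
  + 2 * d2 * d3 * b * c * r2 * r3 * (1 - r1 ^+ 2 - d1 ^+ 2)); last by field.
rewrite d1E' r1E d2E' d3E'; have -> : d1 ^+ 4 = (r2 ^+ 2 + r3 ^+ 2) ^+ 2 by rewrite -d1E'; ring.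
by ring.
Qed.

Lemma measurable_BLprod f1 f2 f3 : measurable_fun setT f1 ->
  measurable_fun setT f2 -> measurable_fun setT f3 ->
  measurable_fun setT (BLprod f1 f2 f3).
Proof.
move=> m1 m2 m3; apply: measurable_funM; first apply: measurable_funM.
- apply: (measurableT_comp (measurable_powR _)); exact: measurableT_comp.
- apply: (measurableT_comp (measurable_powR _)); apply: measurableT_comp => //.
  exact: measurable_lin2.
- apply: (measurableT_comp (measurable_powR _)); apply: measurableT_comp => //.
  exact: measurable_lin2.
Qed.

Lemma BLprod_ge0 f1 f2 f3 z : 0 <= BLprod f1 f2 f3 z.
Proof. by rewrite !mulr_ge0// powR_ge0. Qed.

(* The variables are [s = u2 . z] and [t = u3 . z], stored as [z = (t, s)]. *)
Lemma BLint_st f1 f2 f3 : measurable_fun setT f1 ->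
  measurable_fun setT f2 -> measurable_fun setT f3 ->
  (BLint f1 f2 f3 = (d2 * d3 / r1)%:E * \int[leb \x leb]_z
    (f1 ((r2 * d2 * z.2 - r3 * d3 * z.1) / (r1 * d1)) `^ (d1 ^+ 2) *
     f2 z.2 `^ (d2 ^+ 2) * f3 z.1 `^ (d3 ^+ 2))%:E)%E.
Proof.
move=> m1 m2 m3; rewrite /BLint.
(* Solving [s = u2 . z] for the second coordinate gives [y = c x + e s]; the linear relation
   [r1 d1 x - r2 d2 s + r3 d3 t = 0] then gives [x = a t + b s]. The two shears have total Jacobian
   [d2 d3 / r1]. *)
pose e := d1 * d2 / r3; pose c := - (r1 * r2 / r3).
pose a := - (r3 * d3 / (r1 * d1)); pose b := r2 * d2 / (r1 * d1).
have r1p := br1_gt0 D; have r2p := br2_gt0 D; have r3p := br3_gt0 D.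
have d1p := bd1_gt0 D; have d2p := bd2_gt0 D; have d3p := bd3_gt0 D.
have e0 : 0 < e by rewrite divr_gt0// mulr_gt0.
have a0 : a < 0 by rewrite oppr_lt0 divr_gt0// mulr_gt0.
have mB := measurable_BLprod m1 m2 m3.
have e_neq0 : e != 0 by rewrite gt_eqF.
have a_neq0 : a != 0 by rewrite lt_eqF.
have mBE : measurable_fun setT (EFin \o BLprod f1 f2 f3) by exact/measurable_EFinP.
have B0 z : (0 <= (EFin \o BLprod f1 f2 f3) z)%E by rewrite lee_fin BLprod_ge0.
rewrite (ge0_integral_shear2 c e_neq0 mBE B0).
have mBE' : measurable_fun setT (fun z : R * R =>
    (EFin \o BLprod f1 f2 f3) (z.1, (c * z.1 + e * z.2))).
  apply: (measurableT_comp mBE).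
  by apply: measurable_fun_pair => //; exact: measurable_lin2.
rewrite (ge0_integral_shear1 b a_neq0 mBE' (fun z => B0 _)).
have ae : `|e| * `|a| = d2 * d3 / r1.
  by rewrite gtr0_norm// ltr0_norm// /e /a; field; rewrite ?r1n ?r3n ?d1n.
have -> : forall X, (`|e|%:E * (`|a|%:E * X) = (d2 * d3 / r1)%:E * X)%E.
  by move=> X; rewrite muleA -EFinM ae.
apply: (congr1 (mule _)).
have E1 := bd1E D; have E := br_sum D.
have d1E' : d1 ^+ 2 = r2 ^+ 2 + r3 ^+ 2 by lra.
apply: eq_integral => -[t s] _; rewrite /BLprod /BLu2 /BLu3/=; congr (_%:E).
congr (_ * _); first congr (_ * _).
- congr (f1 _ `^ _); rewrite /a /b; field; by rewrite ?r1n ?r3n ?d1n.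
- congr (f2 _ `^ _); rewrite /c /e; field; by rewrite ?r1n ?r3n ?d1n ?d2n.
- congr (f3 _ `^ _); rewrite /c /e /a /b.
  transitivity ((r2 ^+ 2 + r3 ^+ 2) / d1 ^+ 2 * t +
     (r2 ^+ 2 + r3 ^+ 2 - d1 ^+ 2) * (- (r2 * d2 / (d1 ^+ 2 * r3 * d3))) * s); last first.
    have -> : r2 ^+ 2 + r3 ^+ 2 - d1 ^+ 2 = 0 by lra.
    by rewrite -d1E' !mul0r addr0 divff ?mul1r// expf_neq0.
  field; by rewrite ?r1n ?r3n ?d1n ?d2n ?d3n.
Qed.


(* [T] transports [f1] to the Gaussian [g]; [S2] and [S3] transport [g] to
   [f2] and [f3]. In the variables [z = (q, p)] with [s = S2 p], [t = S3 q],
   the first coordinate is [BLX z], the integrand becomes [BLW], and [BLM] is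
   its majorant given by weighted AM-GM and [BL_identity]; the Jacobian of
   [(BLA, BLB)] is a multiple of [BLam]. *)
Section core.
Variables (f1 f2 f3 : R -> R).
Hypotheses (cf1 : continuous f1) (cf2 : continuous f2) (cf3 : continuous f3).
Hypotheses (f1_gt0 : forall x, 0 < f1 x) (f2_gt0 : forall x, 0 < f2 x)
  (f3_gt0 : forall x, 0 < f3 x).
Hypotheses (int1 : (\int[leb]_x (f1 x)%:E = 1)%E)
  (int2 : (\int[leb]_x (f2 x)%:E = 1)%E) (int3 : (\int[leb]_x (f3 x)%:E = 1)%E).
Variables (T T' S2 S2' S3 S3' : R -> R).
Hypotheses (bT : C1_increasing_bijection T T')
  (bS2 : C1_increasing_bijection S2 S2') (bS3 : C1_increasing_bijection S3 S3').
Hypotheses (hT : forall x, g (T x) * T' x = f1 x)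
  (hS2 : forall p, f2 (S2 p) * S2' p = g p)
  (hS3 : forall q, f3 (S3 q) * S3' q = g q).

Definition BLX z := (r2 * d2 * S2 z.2 - r3 * d3 * S3 z.1) / (r1 * d1).
Definition BLA z :=
  d1 ^+ 2 * T (BLX z) + r1 * r2 * d2 / d1 * z.2 - r1 * r3 * d3 / d1 * z.1.
Definition BLB z := (d2 * r3 * z.2 + d3 * r2 * z.1) / d1.
Definition BLW z := f1 (BLX z) `^ (d1 ^+ 2) * f2 (S2 z.2) `^ (d2 ^+ 2) *
  f3 (S3 z.1) `^ (d3 ^+ 2) * (S3' z.1 * S2' z.2).
Definition BLam z := r2 ^+ 2 * (T' (BLX z) * S2' z.2) +
  r3 ^+ 2 * (T' (BLX z) * S3' z.1) + r1 ^+ 2.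
Definition BLM z := g (BLA z) * g (BLB z) * BLam z.

Let T'0 x : 0 < T' x. Proof. by case: bT. Qed.
Let S2'0 x : 0 < S2' x. Proof. by case: bS2. Qed.
Let S3'0 x : 0 < S3' x. Proof. by case: bS3. Qed.
Let g0 x : 0 < g x. Proof. by rewrite normal_pdf_gt0. Qed.

(** In the exponent this is [BL_identity] without its third square. The normalizing constants agree
    because [d1^2 + d2^2 + d3^2 = 2]. *)
Lemma BLgauss_le a b c :
  g a `^ (d1 ^+ 2) * g b `^ (d2 ^+ 2) * g c `^ (d3 ^+ 2) <=
  g (d1 ^+ 2 * a + r1 * r2 * d2 / d1 * b - r1 * r3 * d3 / d1 * c) *
  g ((d2 * r3 * b + d3 * r2 * c) / d1).
Proof.
rewrite !normal_pdf_expR// -!expRM -!expRD ler_expR !subr0 !expr1n.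
have := BL_identity a b c; set A := _ - _ * c; set B := _ / d1; move=> E.
have E1 := bd1E D; have E2 := bd2E D; have E3 := bd3E D; have E0 := br_sum D.
have sq : 0 <= (r1 * d1 * a - r2 * d2 * b + r3 * d3 * c) ^+ 2 by exact: sqr_ge0.
set K := ln _.
have sum2 : d1 ^+ 2 + d2 ^+ 2 + d3 ^+ 2 = 2 by lra.
have -> : (K - a ^+ 2 / 2) * d1 ^+ 2 + (K - b ^+ 2 / 2) * d2 ^+ 2 + (K - c ^+ 2 / 2) * d3 ^+ 2
  = K * (d1 ^+ 2 + d2 ^+ 2 + d3 ^+ 2)
    - (d1 ^+ 2 * a ^+ 2 + d2 ^+ 2 * b ^+ 2 + d3 ^+ 2 * c ^+ 2) / 2 by field.
rewrite sum2 E; lra.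
Qed.

(** By the transport equations the integrand is a Gaussian part [P] times
    [l^(d1^2) m^(1 - d2^2) n^(1 - d3^2)]. Since [d1^2 = r2^2 + r3^2], this regroups as
    [(l m)^(r2^2) (l n)^(r3^2) 1^(r1^2)], whose weighted arithmetic mean is [BLam]. The constant
    third entry is what pins both products to 1 in the equality case. *)
Lemma BLW_le z : BLW z <= BLM z /\
  (BLW z = BLM z -> T' (BLX z) * S2' z.2 = 1 /\ T' (BLX z) * S3' z.1 = 1).
Proof.
set l := T' (BLX z); set m := S2' z.2; set n := S3' z.1.
have l0 : 0 < l by exact: T'0.
have m0 : 0 < m by exact: S2'0.
have n0 : 0 < n by exact: S3'0.
have E1 := bd1E D; have E2 := bd2E D; have E3 := bd3E D; have E0 := br_sum D.
pose P := g (T (BLX z)) `^ (d1 ^+ 2) * g z.2 `^ (d2 ^+ 2) * g z.1 `^ (d3 ^+ 2).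
have P0 : 0 < P by rewrite !mulr_gt0// powR_gt0.
have WE : BLW z = P * ((l * m) `^ (r2 ^+ 2) * (l * n) `^ (r3 ^+ 2) * 1 `^ (r1 ^+ 2)).
  rewrite /BLW /P -(hT (BLX z)) -(hS2 z.2) -(hS3 z.1) -/l -/m -/n.
  have f2p := f2_gt0 (S2 z.2); have f3p := f3_gt0 (S3 z.1).
  rewrite !powRM ?(ltW l0) ?(ltW m0) ?(ltW n0) ?(ltW f2p) ?(ltW f3p) ?(ltW (g0 _))//.
  rewrite powR1.
  have -> : l `^ (d1 ^+ 2) = l `^ (r2 ^+ 2) * l `^ (r3 ^+ 2).
    have -> : d1 ^+ 2 = r2 ^+ 2 + r3 ^+ 2 by lra.
    by apply: powRD; rewrite (gt_eqF l0) implybT.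
  have hm : m = m `^ (d2 ^+ 2) * m `^ (r2 ^+ 2).
    rewrite -powRD ?(gt_eqF m0) ?(gt_eqF n0) ?implybT// (_ : _ + _ = 1) ?powRr1 ?ltW//; lra.
  have hn : n = n `^ (d3 ^+ 2) * n `^ (r3 ^+ 2).
    rewrite -powRD ?(gt_eqF m0) ?(gt_eqF n0) ?implybT// (_ : _ + _ = 1) ?powRr1 ?ltW//; lra.
  rewrite {1}hm {1}hn; ring.
have [am_le am_eq] := @amgm3_gt0 R (l * m) (l * n) 1 (r2 ^+ 2) (r3 ^+ 2) (r1 ^+ 2)
  (mulr_gt0 l0 m0) (mulr_gt0 l0 n0) ltr01 (exprn_gt0 _ (br2_gt0 D))
  (exprn_gt0 _ (br3_gt0 D)) (exprn_gt0 _ (br1_gt0 D)) ltac:(lra).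
rewrite mulr1 in am_le am_eq.
have r1p := br1_gt0 D; have r2p := br2_gt0 D; have r3p := br3_gt0 D.
have am0 : 0 < BLam z by rewrite !addr_gt0// ?mulr_gt0// exprn_gt0.
have PG : P <= g (BLA z) * g (BLB z) by exact: BLgauss_le.
have W1 : BLW z <= P * BLam z by rewrite WE ler_wpM2l ?(ltW P0).
have W2 : P * BLam z <= BLM z by rewrite ler_wpM2r ?(ltW am0).
split; first exact: le_trans W2.
move=> WM; have : BLW z = P * BLam z by apply/eqP; rewrite eq_le W1 WM.
by rewrite WE => /(mulfI (lt0r_neq0 P0))/am_eq[-> ->].
Qed.

Let mT : measurable_fun setT T.
Proof. by apply: continuous_measurable_fun; exact: C1ib_continuous bT. Qed.
Let mT' : measurable_fun setT T'.
Proof. by apply: continuous_measurable_fun; case: bT. Qed.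
Let mS2 : measurable_fun setT S2.
Proof. by apply: continuous_measurable_fun; exact: C1ib_continuous bS2. Qed.
Let mS2' : measurable_fun setT S2'.
Proof. by apply: continuous_measurable_fun; case: bS2. Qed.
Let mS3 : measurable_fun setT S3.
Proof. by apply: continuous_measurable_fun; exact: C1ib_continuous bS3. Qed.
Let mS3' : measurable_fun setT S3'.
Proof. by apply: continuous_measurable_fun; case: bS3. Qed.

Lemma measurable_BLX : measurable_fun setT BLX.
Proof.
apply: measurable_funM => //.
by apply: measurable_funB; apply: measurable_funM => //; exact: measurableT_comp.
Qed.

Lemma measurable_BLM : measurable_fun setT BLM.
Proof.
have mg := measurable_normal_pdf (0 : R) 1.
have mX := measurable_BLX.
apply: measurable_funM; first apply: measurable_funM.
- apply: (measurableT_comp mg); apply: measurable_funB.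
    apply: measurable_funD; apply: measurable_funM => //.
    exact: measurableT_comp.
  exact: measurable_funM.
- apply: (measurableT_comp mg); apply: measurable_funM => //.
  by apply: measurable_funD; exact: measurable_funM.
- apply: measurable_funD => //; apply: measurable_funD; apply: measurable_funM => //.
  + by apply: measurable_funM; exact: measurableT_comp.
  + by apply: measurable_funM; exact: measurableT_comp.
Qed.

Lemma measurable_BLW : measurable_fun setT BLW.
Proof.
have m1 : measurable_fun setT f1 by exact: continuous_measurable_fun.
have m2 : measurable_fun setT f2 by exact: continuous_measurable_fun.
have m3 : measurable_fun setT f3 by exact: continuous_measurable_fun.
have mX := measurable_BLX.
apply: measurable_funM; last by apply: measurable_funM; exact: measurableT_comp.
apply: measurable_funM; first apply: measurable_funM.
- by apply: (measurableT_comp (measurable_powR _)); exact: measurableT_comp.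
- by apply: (measurableT_comp (measurable_powR _)); do 2 apply: measurableT_comp => //.
- by apply: (measurableT_comp (measurable_powR _)); do 2 apply: measurableT_comp => //.
Qed.

Lemma BLint_W : (BLint f1 f2 f3 =
  (d2 * d3 / r1)%:E * \int[leb \x leb]_z (BLW z)%:E)%E.
Proof.
have m1 : measurable_fun setT f1 by exact: continuous_measurable_fun.
have m2 : measurable_fun setT f2 by exact: continuous_measurable_fun.
have m3 : measurable_fun setT f3 by exact: continuous_measurable_fun.
rewrite BLint_st//; congr (_ * _)%E.
rewrite (ge0_integral_C1ib2 bS3 bS2)//.
apply/measurable_EFinP; apply: measurable_funM; first apply: measurable_funM.
- apply: (measurableT_comp (measurable_powR _)); apply: measurableT_comp => //.
  apply: measurable_funM => //.
  by apply: measurable_funB; apply: measurable_funM.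
- by apply: (measurableT_comp (measurable_powR _)); exact: measurableT_comp.
- by apply: (measurableT_comp (measurable_powR _)); exact: measurableT_comp.
- by move=> z; rewrite lee_fin !mulr_ge0// powR_ge0.
Qed.

(* On a line [BLB = b], [BLA] is an increasing function of [p = z.2] with
   derivative proportional to [BLam]. *)
Lemma BLA_bij (b : R) :
  let z p := ((d1 * b - d2 * r3 * p) / (d3 * r2), p) in
  C1_increasing_bijection (BLA \o z) (fun p => d1 * d2 / (r1 * r2) * BLam (z p)).
Proof.
move=> z.
have r1p := br1_gt0 D; have r2p := br2_gt0 D; have r3p := br3_gt0 D.
have d1p := bd1_gt0 D; have d2p := bd2_gt0 D; have d3p := bd3_gt0 D.
have [dS2 cS2' _ _] := bS2; have [dS3 cS3' _ _] := bS3; have [dT cT' _ _] := bT.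
pose q p := (z p).1.
pose k := - (d2 * r3 / (d3 * r2)).
have qE : q = (fun p => k * p + d1 * b / (d3 * r2)).
  by apply/funext => x; rewrite /q/= /k; field; rewrite d3n r2n.
have dq : forall p : R, is_derive p 1 q k by rewrite qE; exact: is_derive_affine.
pose X := BLX \o z.
pose X' p := r2 * d2 / (r1 * d1) * S2' p + - (r3 * d3 / (r1 * d1)) * (S3' (q p) * k).
have dX : forall p : R, is_derive p 1 X (X' p).
  have -> : X = (fun p => r2 * d2 / (r1 * d1) * S2 p +
                          - (r3 * d3 / (r1 * d1)) * (S3 \o q) p).
    by apply/funext => p; rewrite /X/= /BLX /q/=; field; rewrite d1n r1n.
  apply: (@is_derive_lin2 _ S2 S2' (S3 \o q) (fun p => S3' (q p) * k)).
(* [k] is negative: on the line [BLB = b] the coordinate [q] decreases when [p] grows, and [BLX]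
   decreases with [S3 q], so both terms are positive. *)
have X'0 p : 0 < X' p.
  rewrite /X' mulrN mulNr mulrN opprK.
  by rewrite addr_gt0// !mulr_gt0// ?divr_gt0// ?invr_gt0 ?mulr_gt0.
(* The zero summand only gives the shape expected by [is_derive_lin2]. *)
pose u p := d1 ^+ 2 * T (X p) + 0 * T p.
pose u' p := d1 ^+ 2 * (T' (X p) * X' p) + 0 * T' p.
have du : forall p : R, is_derive p 1 u (u' p).
  apply: (@is_derive_lin2 _ (T \o X) (fun p => T' (X p) * X' p)).
have cX : continuous X by exact: is_derive_continuous dX.
have cS3q : continuous (S3' \o q).
  move=> p; apply: continuous_comp; last exact: cS3'.
  exact: is_derive_continuous dq p.
have cX' : continuous X'.
  move=> p; apply: cvgD; first by apply: cvgM; [exact: cvg_cst|exact: cS2'].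
  apply: cvgM; first exact: cvg_cst.
  by apply: cvgM; [exact: cS3q|exact: cvg_cst].
have cu' : continuous u'.
  move=> p; apply: cvgD; apply: cvgM; try exact: cvg_cst; last exact: cT'.
  apply: cvgM; last exact: cX'.
  by apply: continuous_comp; [exact: cX|exact: cT'].
have u'0 p : 0 <= u' p.
  by rewrite /u' mul0r addr0 mulr_ge0 ?sqr_ge0// mulr_ge0// ltW.
(* The slope of the linear part of [BLA] along the line: the terms in [p] and in [q] add up to it
   after [r2^2 + r3^2 = d1^2]. *)
have b0 : 0 < d1 * d2 * r1 / r2 by rewrite divr_gt0// !mulr_gt0.
have E1 := bd1E D; have E := br_sum D.
have d1E' : d1 ^+ 2 = r2 ^+ 2 + r3 ^+ 2 by lra.
have := C1ib_add_linear (- (r1 * r3 * d3 / d1 * (d1 * b / (d3 * r2)))) b0 du cu' u'0.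
congr C1_increasing_bijection; apply/funext => p.
- rewrite /u/= /BLA/= mul0r addr0 -addrA; congr (_ + _).
  transitivity (r1 * d2 / (r2 * d1) * (d1 ^+ 2) * p - r1 * r3 * d3 / d1 * (d1 * b / (d3 * r2))).
    by congr (_ - _); field; rewrite r2n d1n.
  by rewrite d1E'; field; rewrite r2n d1n d3n.
- rewrite /u'/= /BLam/= mul0r addr0 -/(X p) /X' /k -/(q p).
  by field; rewrite r1n r2n d1n d3n.
Qed.

(** In the coordinates [(BLB, BLA)] the majorant becomes a product of two standard Gaussian
    densities times a constant, since [BLam] is proportional to the Jacobian. The value is the
    inverse of the factor of [BLint_st], which makes the final bound equal to 1. *)
Lemma BLint_M : (\int[leb \x leb]_z (BLM z)%:E = (r1 / (d2 * d3))%:E)%E.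
Proof.
have r1p := br1_gt0 D; have r2p := br2_gt0 D; have r3p := br3_gt0 D.
have d1p := bd1_gt0 D; have d2p := bd2_gt0 D; have d3p := bd3_gt0 D.
have am0 z : 0 < BLam z by rewrite !addr_gt0// ?mulr_gt0// exprn_gt0.
have M0 z : (0 <= (EFin \o BLM) z)%E.
  by rewrite lee_fin !mulr_ge0// ltW.
have mM : measurable_fun setT (EFin \o BLM) by apply/measurable_EFinP; exact: measurable_BLM.
(* [q = a b + c p] is the equation [BLB = b] solved for [q]. *)
pose a := d1 / (d3 * r2); pose c := - (d2 * r3 / (d3 * r2)).
have a0 : 0 < a by rewrite divr_gt0// mulr_gt0.
rewrite (ge0_integral_shear1 c (lt0r_neq0 a0) mM M0).
have mM' : measurable_fun setT (fun z : R * R => (EFin \o BLM) (a * z.1 + c * z.2, z.2)).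
  apply: (measurableT_comp mM).
  by apply: measurable_fun_pair => //; exact: measurable_lin2.
rewrite (tonelli1 mM' (fun z => M0 _)).
pose C := r1 * r2 / (d1 * d2).
have C0 : 0 < C by rewrite divr_gt0// mulr_gt0.
transitivity (`|a|%:E * \int[leb]_b (C%:E * (g b)%:E))%E.
  congr (_ * _)%E; apply: eq_integral => b _.
  have := BLA_bij b; set z := fun p => _; move=> bA.
  transitivity (\int[leb]_p (C%:E * (g b)%:E * ((g ((BLA \o z) p))%:E *
      (d1 * d2 / (r1 * r2) * BLam (z p))%:E)))%E.
    apply: eq_integral => p _ /=; rewrite -!EFinM; congr _%:E.
    have -> : (a * b + c * p, p) = z p.
      by rewrite /z /a /c; congr pair; field; rewrite d3n r2n.
    rewrite /BLM.
    have -> : BLB (z p) = b by rewrite /BLB /z/=; field; rewrite d3n r2n d1n.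
    by rewrite /C; field; rewrite r1n r2n d1n d2n.
  rewrite ge0_integralZl//.
  - rewrite -(ge0_integral_C1ib bA (h := EFin \o g))//.
    + by rewrite integral_normal_pdf mule1.
    + by apply/measurable_EFinP; exact: measurable_normal_pdf.
    + by move=> x; rewrite lee_fin ltW.
  - have [_ cA' _ _] := bA.
    apply: emeasurable_funM; apply/measurable_EFinP.
      apply: (measurableT_comp (measurable_normal_pdf _ _)).
      by apply: continuous_measurable_fun; exact: C1ib_continuous bA.
    exact: continuous_measurable_fun.
  - move=> p _; rewrite -EFinM lee_fin mulr_ge0// ?(ltW (g0 _))//.
    by rewrite mulr_ge0 ?(ltW (am0 _))// divr_ge0// mulr_ge0// ltW.
  - by rewrite -EFinM lee_fin ltW// mulr_gt0.
rewrite ge0_integralZl//; last 3 first.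
- by apply/measurable_EFinP; exact: measurable_normal_pdf.
- by move=> x _; rewrite lee_fin ltW.
- by rewrite lee_fin ltW.
rewrite integral_normal_pdf mule1 -EFinM gtr0_norm//; congr _%:E.
by rewrite /a /C; field; rewrite r2n d1n d2n d3n.
Qed.

End core.

End BL.

Section ae_logic.
Context d (T : measurableType d) (R : realType).
Implicit Types P Q : T -> Prop.

Lemma ae_imply (m : set T -> \bar R) P Q : (forall x, P x -> Q x) ->
  {ae m, forall x, P x} -> {ae m, forall x, Q x}.
Proof.
move=> PQ [N [mN N0 NP]]; exists N; split => // x nQ; apply: NP => Px.
exact/nQ/PQ.
Qed.

Lemma ae_conj (m : {measure set T -> \bar R}) P Q :
  {ae m, forall x, P x} -> {ae m, forall x, Q x} ->
  {ae m, forall x, P x /\ Q x}.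
Proof.
move=> [N [mN N0 NP]] [M [mM M0 MQ]]; exists (N `|` M); split.
- exact: measurableU.
- by apply/eqP; rewrite -measure_le0 (le_trans (measureU2 _ _ _))//= N0 M0 adde0.
- move=> x /not_andP[nP|nQ]; [left; exact: NP|right; exact: MQ].
Qed.

Lemma ae_all (m : set T -> \bar R) P : m set0 = 0%E -> (forall x, P x) ->
  {ae m, forall x, P x}.
Proof. by move=> m0 HP; exists set0; split => // x; apply. Qed.

End ae_logic.

Section ae_facts.
Context (R : realType).
Notation leb := (@lebesgue_measure R).

Lemma ae_exists (Q : R -> Prop) : {ae leb, forall x, Q x} -> exists x, Q x.
Proof.
move=> [N [mN N0 NQ]]; apply: contrapT => /forallNP nQ.
have B0 : leb (ball (0 : R) 1) = (1 *+ 2)%:E by exact: lebesgue_measure_ball.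
have : (leb (ball (0%R : R) 1%R) <= 0)%E; last by rewrite B0 lee_fin pmulrn_lle0// leNgt ltr01.
rewrite -N0; apply: le_measure; rewrite ?inE//; first exact: measurable_ball.
by move=> x _; apply: NQ; exact: nQ.
Qed.

Lemma ae_prodE (Q : R * R -> Prop) : {ae (leb \x leb)%E, forall z, Q z} ->
  {ae leb, forall x, {ae leb, forall y, Q (x, y)}}.
Proof.
move=> [N [mN N0 NQ]].
have mphi : measurable_fun setT (fun x => leb (xsection N x)).
  exact: measurable_fun_xsection.
have : (\int[leb]_x `|leb (xsection N x)| = 0)%E.
  by rewrite -N0 /product_measure1/=; apply: eq_integral => x _; rewrite gee0_abs.
move=> /(ae_eq_integral_abs leb measurableT mphi)[Z [mZ Z0 ZN]].
exists Z; split => // x nx; apply: ZN => /= H; apply: nx.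
exists (xsection N x); split; [exact: measurable_xsection|exact: H|].
by move=> y nQ; rewrite /xsection/= inE; exact: NQ.
Qed.

Lemma is_derive_cst_affine (f : R -> R) (k : R) :
  (forall x : R, is_derive x 1 f k) -> forall x, f x = k * x + f 0.
Proof.
move=> df.
have H (x y : R) : x < y -> f y - f x = k * (y - x).
  by move=> xy; have [c _ ->] := MVT xy (fun z _ => df z)
    (continuous_subspaceT (is_derive_continuous df)).
move=> x; have [x0|x0|x0] := ltgtP 0 x; last by rewrite -x0 mulr0 add0r.
- by have := H _ _ x0; lra.
- by have := H _ _ x0; lra.
Qed.

Lemma normal_pdf_scale (a s x : R) : 0 < s ->
  normal_pdf 0 1 ((x - a) / s) / s = normal_pdf a s x.
Proof.
move=> s0; have sn : s != 0 by rewrite gt_eqF.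
have p0 : 0 <= pi *+ 2 :> R by rewrite mulrn_wge0// pi_ge0.
rewrite !normal_pdfE// /normal_peak /normal_fun subr0 !expr1n mul1r.
rewrite mulrAC; congr (_ * _).
  by rewrite -mulrnAr sqrtrM ?sqr_ge0// sqrtr_sqr gtr0_norm// invfM mulrC.
congr expR; field; exact: sn.
Qed.

End ae_facts.

Section BL_regular.
Context (R : realType) (D : BLdatum R).
Notation leb := (@lebesgue_measure R).
Notation r1 := (br1 D). Notation r2 := (br2 D). Notation r3 := (br3 D).
Notation d1 := (bd1 D). Notation d2 := (bd2 D). Notation d3 := (bd3 D).
Notation g := (@normal_pdf R 0 1).

(** Equality means that [W] and its majorant [M] agree almost everywhere. The equality case of AM-GM
    then makes all three transport maps affine with related slopes [1/k], [k], [k], and transporting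
    the standard Gaussian gives the common deviation [k]. *)
Lemma BLint_regular (f1 f2 f3 : R -> R) :
  continuous f1 -> continuous f2 -> continuous f3 ->
  (forall x, 0 < f1 x) -> (forall x, 0 < f2 x) -> (forall x, 0 < f3 x) ->
  (\int[leb]_x (f1 x)%:E = 1)%E -> (\int[leb]_x (f2 x)%:E = 1)%E ->
  (\int[leb]_x (f3 x)%:E = 1)%E ->
  (BLint D f1 f2 f3 <= 1)%E /\
  (BLint D f1 f2 f3 = 1%E -> exists a1 a2 a3 s, [/\ 0 < s,
     f1 =1 normal_pdf a1 s, f2 =1 normal_pdf a2 s & f3 =1 normal_pdf a3 s]).
Proof.
move=> cf1 cf2 cf3 f1_0 f2_0 f3_0 i1 i2 i3.
have cg : continuous g by apply: continuous_normal_pdf; rewrite oner_neq0.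
have g0 x : 0 < g x by rewrite normal_pdf_gt0// oner_neq0.
have ig : (\int[leb]_x (g x)%:E = 1)%E by exact: integral_normal_pdf.
have [T [T' [bT hT]]] := transport cg g0 ig cf1 f1_0 i1.
have [S2 [S2' [bS2 hS2]]] := transport cf2 f2_0 i2 cg g0 ig.
have [S3 [S3' [bS3 hS3]]] := transport cf3 f3_0 i3 cg g0 ig.
have r1p := br1_gt0 D; have r2p := br2_gt0 D; have r3p := br3_gt0 D.
have d1p := bd1_gt0 D; have d2p := bd2_gt0 D; have d3p := bd3_gt0 D.
pose W := BLW D f1 f2 f3 S2 S2' S3 S3'.
pose M := BLM D T T' S2 S2' S3 S3'.
have WM z : W z <= M z by have [] := BLW_le D f2_0 f3_0 bT bS2 bS3 hT hS2 hS3 z.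
have WMeq z : W z = M z -> T' (BLX D S2 S3 z) * S2' z.2 = 1 /\
    T' (BLX D S2 S3 z) * S3' z.1 = 1.
  by have [] := BLW_le D f2_0 f3_0 bT bS2 bS3 hT hS2 hS3 z.
have mW : measurable_fun setT W by exact: measurable_BLW.
have mM : measurable_fun setT M by exact: measurable_BLM.
have iM : (\int[leb \x leb]_z (M z)%:E = (r1 / (d2 * d3))%:E)%E by exact: BLint_M.
have W0 z : 0 <= W z.
  have [_ _ S2'0 _] := bS2; have [_ _ S3'0 _] := bS3.
  by rewrite /W /BLW !mulr_ge0 ?powR_ge0// ltW.
have mWE : measurable_fun setT (EFin \o W) by exact/measurable_EFinP.
have mME : measurable_fun setT (EFin \o M) by exact/measurable_EFinP.
have iWM : (\int[leb \x leb]_z (W z)%:E <= \int[leb \x leb]_z (M z)%:E)%E.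
  apply: ge0_le_integral => //.
  - by move=> z _; rewrite lee_fin.
  - by move=> z _; rewrite lee_fin.
have k0 : 0 < d2 * d3 / r1 by rewrite divr_gt0// mulr_gt0.
have kE : ((d2 * d3 / r1)%:E * (r1 / (d2 * d3))%:E = 1 :> \bar R)%E.
  by rewrite -EFinM; congr _%:E; field; rewrite !gt_eqF.
have BLW : (BLint D f1 f2 f3 = (d2 * d3 / r1)%:E * \int[leb \x leb]_z (W z)%:E)%E.
  by exact: BLint_W.
split.
  by rewrite BLW -kE lee_wpmul2l// -?iM// lee_fin ltW.
rewrite BLW => BL1.
have iW : (\int[leb \x leb]_z (W z)%:E = (r1 / (d2 * d3))%:E)%E.
  have : ((r1 / (d2 * d3))%:E * ((d2 * d3 / r1)%:E * \int[leb \x leb]_z (W z)%:E) =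
         (r1 / (d2 * d3))%:E)%E by rewrite BL1 mule1.
  by rewrite muleA [X in (X * _)%E]muleC kE mul1e.
have intW : (leb \x leb)%E.-integrable setT (EFin \o W).
  apply/integrableP; split => //.
  under eq_integral do rewrite /= ger0_norm//.
  by rewrite iW ltry.
have intM : (leb \x leb)%E.-integrable setT (EFin \o M).
  apply/integrableP; split => //.
  under eq_integral => z _ do rewrite /= ger0_norm ?(le_trans (W0 z))//.
  by rewrite iM ltry.
have : (\int[leb \x leb]_z `|((EFin \o M) \- (EFin \o W)) z| = 0)%E.
  transitivity (\int[leb \x leb]_z ((EFin \o M) \- (EFin \o W)) z)%E.
    by apply: eq_integral => z _; rewrite gee0_abs//= lee_fin subr_ge0.
  by rewrite integralB//= iW iM subee.
move=> /(ae_eq_integral_abs (leb \x leb)%E measurableT (emeasurable_funB mME mWE)) aeWM.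
have {aeWM} : {ae (leb \x leb)%E, forall z, T' (BLX D S2 S3 z) * S2' z.2 = 1 /\
    T' (BLX D S2 S3 z) * S3' z.1 = 1}.
  move: aeWM => [N [mN N0 NP]]; exists N; split => // z nz; apply: NP => /= H.
  apply: nz; apply: WMeq; apply/eqP; rewrite eq_sym -subr_eq0; apply/eqP.
  by have [] := H I.
move=> /ae_prodE ae2.
have [_ cT' T'0 sT] := bT; have [dS2 cS2' S2'0 sS2] := bS2; have [dS3 cS3' S3'0 sS3] := bS3.
(* On one good slice [q = q0], both products being 1 forces [S2'] to equal the constant [S3' q0]
   almost everywhere, hence everywhere by continuity; the other slices then transfer this constant
   to [S3']. *)
have [q0 aeq0] := ae_exists ae2.
pose k := S3' q0; have kp : 0 < k by exact: S3'0.
have kn : k != 0 by rewrite gt_eqF.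
have S2k : forall p, S2' p = k.
  apply: continuous_ae_cst => //; move: aeq0; apply: ae_imply => p /= [e1 e2].
  apply: (mulfI (_ : T' (BLX D S2 S3 (q0, p)) != 0)); first by rewrite gt_eqF.
  by rewrite e1 e2.
have S3k : forall q, S3' q = k.
  apply: continuous_ae_cst => //; move: ae2; apply: ae_imply => q /= /ae_exists[p [e1 e2]].
  apply: (mulfI (_ : T' (BLX D S2 S3 (q, p)) != 0)); first by rewrite gt_eqF.
  by rewrite e2 -e1 S2k.
have TXk : forall p, T' (BLX D S2 S3 (q0, p)) = k^-1.
  apply: continuous_ae_cst.
    have -> : (fun p => T' (BLX D S2 S3 (q0, p))) =
        T' \o (fun p => (r2 * d2 * S2 p - r3 * d3 * S3 q0) / (r1 * d1)) by [].
    move=> p; apply: continuous_comp; last exact: cT'.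
    apply: cvgM; last exact: cvg_cst.
    apply: cvgB; last exact: cvg_cst.
    by apply: cvgM; [exact: cvg_cst|exact: is_derive_continuous dS2 p].
  move: aeq0; apply: ae_imply => p /= [e1 _].
  by apply: (mulIf kn); rewrite mulVf// -(S2k p).
(* The slice [q = q0] sees every argument of [T'], because [S2] is onto. *)
have Tk x : T' x = k^-1.
  have [p hp] := sS2 ((x * (r1 * d1) + r3 * d3 * S3 q0) / (r2 * d2)).
  rewrite -(TXk p); congr T'; rewrite /BLX/= hp.
  by field; rewrite !gt_eqF.
have TE : forall x, T x = k^-1 * x + T 0.
  by apply: is_derive_cst_affine => x; rewrite -(Tk x); case: bT.
have S2E : forall x, S2 x = k * x + S2 0.
  by apply: is_derive_cst_affine => x; rewrite -(S2k x).
have S3E : forall x, S3 x = k * x + S3 0.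
  by apply: is_derive_cst_affine => x; rewrite -(S3k x).
exists (- (k * T 0)), (S2 0), (S3 0), k; split => //.
- move=> x; rewrite -normal_pdf_scale// -hT Tk TE; congr (g _ / _).
  by field; exact: kn.
- move=> x; rewrite -normal_pdf_scale// -hS2 S2k mulfK//; congr f2.
  by rewrite S2E; field; exact: kn.
- move=> x; rewrite -normal_pdf_scale// -hS3 S3k mulfK//; congr f3.
  by rewrite S3E; field; exact: kn.
Qed.

End BL_regular.

(** * Approximation of densities and the inequality in general *)

Section convol.
Context (R : realType).
Notation leb := (@lebesgue_measure R).

Definition convolution (f k : R -> R) (x : R) : R :=
  (\int[leb]_y (f y * k (x - y)))%R.

Variables (f k : R -> R) (m C : R).
Hypotheses (mf : measurable_fun setT f) (f0 : forall x, 0 <= f x)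
  (intf : (\int[leb]_x (f x)%:E = m%:E)%E).
Hypotheses (ck : continuous k) (k0 : forall x, 0 <= k x) (kC : forall x, k x <= C).

Let mk : measurable_fun setT k. Proof. exact: continuous_measurable_fun. Qed.

Let integrablef : leb.-integrable setT (EFin \o f).
Proof.
apply/integrableP; split; first exact/measurable_EFinP.
under eq_integral => x _ do rewrite /= ger0_norm//.
by rewrite intf ltry.
Qed.

Let mkx x : measurable_fun setT (fun y : R => k (x - y)).
Proof. by apply: measurableT_comp => //; exact: measurable_funB. Qed.

Lemma conv_integrable x : leb.-integrable setT (fun y => (f y * k (x - y))%:E).
Proof.
have iCf : leb.-integrable setT (fun y => C%:E * (f y)%:E)%E by exact: integrableZl.
apply: le_integrable iCf => //.
- by apply/measurable_EFinP; apply: measurable_funM; [exact: mf|exact: mkx].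
- move=> y _; rewrite -EFinM /= lee_fin !ger0_norm ?mulr_ge0//.
    by rewrite [leRHS]mulrC ler_wpM2l.
  exact: le_trans (kC 0).
Qed.

Lemma convE x : ((convolution f k x)%:E = \int[leb]_y (f y * k (x - y))%:E)%E.
Proof.
by rewrite /convolution /Rintegral fineK//; apply: integrable_fin_num => //; exact: conv_integrable.
Qed.

Lemma conv_ge0 x : 0 <= convolution f k x.
Proof. by apply: Rintegral_ge0 => y _; rewrite mulr_ge0. Qed.

Lemma continuous_conv : continuous (convolution f k).
Proof.
move=> x.
have iCf : leb.-integrable setT (EFin \o (fun y => C * f y)).
  have := integrableZl measurableT C integrablef.
  by apply: eq_integrable.
have := @continuity_under_integral R _ (measurableTypeR R) leb
  (fun x y => f y * k (x - y)) setT measurableT (x - 1) (x + 1)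
  (fun x _ => conv_integrable x) _ (fun y => C * f y) iCf _.
apply.
- apply: ae_all => //= y _ z _; apply: cvgM; first exact: cvg_cst.
  apply: (@continuous_comp _ _ _ (fun z => z - y) k); last exact: ck.
  by apply: cvgB; [exact: cvg_id|exact: cvg_cst].
- move=> z _; apply: ae_all => //= y _.
  rewrite ger0_norm ?mulr_ge0// [leRHS]mulrC ler_wpM2l//.
- by rewrite inE/= in_itv/=; apply/andP; split; lra.
Qed.

Lemma conv_gt0 : (forall x, 0 < k x) -> 0 < m -> forall x, 0 < convolution f k x.
Proof.
move=> kp mp x; rewrite lt_neqAle conv_ge0 andbT eq_sym; apply/eqP => c0.
have mfk : measurable_fun setT (fun y => (f y * k (x - y))%:E).
  by apply/measurable_EFinP; apply: measurable_funM; [exact: mf|exact: mkx].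
have : (\int[leb]_y `|(f y * k (x - y))%:E| = 0)%E.
  transitivity ((convolution f k x)%:E); last by rewrite c0.
  rewrite convE; apply: eq_integral => y _.
  by rewrite gee0_abs// lee_fin mulr_ge0.
move=> /(ae_eq_integral_abs leb measurableT mfk) ae0.
have : (\int[leb]_x (f x)%:E = \int[leb]_x 0)%E.
  apply: ge0_ae_eq_integral => //.
  - exact/measurable_EFinP.
  - by move=> y _; rewrite lee_fin.
  - move: ae0; apply: ae_imply => y /= H _; have [/eqP] := H I.
    by rewrite mulf_eq0 (gt_eqF (kp _)) orbF => /eqP ->.
by rewrite intf integral0 => -[m0]; move: mp; rewrite m0 ltxx.
Qed.

Lemma integral_conv : (\int[leb]_x (convolution f k x)%:E =
  m%:E * \int[leb]_x (k x)%:E)%E.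
Proof.
pose F (z : R * R) := ((f z.2)%:E * (k (z.1 - z.2))%:E)%E.
have mF : measurable_fun setT F.
  apply: emeasurable_funM; apply/measurable_EFinP; apply: measurableT_comp => //.
  exact: measurable_funB.
have F0 z : (0 <= F z)%E by rewrite mule_ge0// lee_fin.
transitivity (\int[leb]_x \int[leb]_y F (x, y))%E.
  by apply: eq_integral => x _; rewrite convE; apply: eq_integral.
rewrite -(tonelli1 mF F0) (tonelli2 mF F0).
transitivity (\int[leb]_y ((f y)%:E * \int[leb]_x (k x)%:E))%E.
  apply: eq_integral => y _; rewrite /F/= ge0_integralZl//; last 3 first.
  - by apply/measurable_EFinP; apply: measurableT_comp => //; exact: measurable_funB.
  - by move=> x _; rewrite lee_fin.
  - by rewrite lee_fin.
  congr (_ * _)%E.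
  rewrite [RHS](@ge0_integral_affine _ 1 (- y) (EFin \o k))//; last exact/measurable_EFinP.
  by rewrite normr1 mul1e; apply: eq_integral => x _ /=; rewrite mul1r.
rewrite ge0_integralZr//; first by rewrite intf.
- exact/measurable_EFinP.
- by move=> y _; rewrite lee_fin.
- by apply: integral_ge0 => x _; rewrite lee_fin.
Qed.

End convol.

Section tent.
Context (R : realType).
Notation leb := (@lebesgue_measure R).

(** A continuous bounded kernel with compact support: rescaled, it is dominated by the uniform
    average over a ball, which is the quantity controlled by Lebesgue differentiation. *)
Definition tent (t : R) : R := Num.max 0 (1 - `|t|).

Lemma continuous_tent : continuous tent.
Proof.
move=> t; apply: (@continuous_comp _ _ _ (fun t : R => 1 - `|t|) (fun u => Num.max 0 u)).
  by apply: cvgB; [exact: cvg_cst|exact: norm_continuous].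
by apply: continuous_max; [exact: cvg_cst|exact: cvg_id].
Qed.

Lemma tent_ge0 t : 0 <= tent t. Proof. by rewrite le_max lexx. Qed.

Lemma tent_le1 t : tent t <= 1.
Proof. by rewrite ge_max ler01 gerBl normr_ge0. Qed.

Lemma tent_le_indic t : tent t <= \1_(ball (0 : R) 1) t.
Proof.
rewrite indicE; have [tb|] := boolP (t \in (ball (0 : R) 1 : set R)); first exact: tent_le1.
rewrite notin_setE /ball/= sub0r normrN => /negP; rewrite -leNgt => t1.
by rewrite /tent ge_max lexx/= subr_le0.
Qed.

(** Only the existence of a positive finite mass matters, so its value stays an abstract [c]. It is
    enclosed by comparison with half the indicator of the ball of radius 1/2 and with the indicator
    of the unit ball. *)
Lemma integral_tent : exists2 c : R, 0 < c & (\int[leb]_t (tent t)%:E = c%:E)%E.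
Proof.
have mt : measurable_fun setT tent by apply: continuous_measurable_fun; exact: continuous_tent.
have B (r : R) : 0 <= r -> leb (ball (0 : R) r) = (r *+ 2)%:E.
  by move=> r0; exact: lebesgue_measure_ball.
have IB (r : R) : 0 <= r -> (\int[leb]_t (\1_(ball (0%R : R) r) t)%:E = (r *+ 2)%:E)%E.
  move=> r0; rewrite integral_indic// ?setIT; last exact: measurable_ball.
  exact: B.
have up : (\int[leb]_t (tent t)%:E <= (1 *+ 2)%:E)%E.
  rewrite -IB//; apply: ge0_le_integral => //.
  - by move=> t _; rewrite lee_fin tent_ge0.
  - exact/measurable_EFinP.
  - by apply/measurable_EFinP; apply: measurable_indic; exact: measurable_ball.
  - by move=> t _; rewrite lee_fin tent_le_indic.
have h0 : (0 : R) < 2^-1 by rewrite invr_gt0.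
have lo : ((2^-1)%:E <= \int[leb]_t (tent t)%:E)%E.
  have -> : (2^-1)%:E = ((2^-1)%:E * \int[leb]_t (\1_(ball (0%R : R) 2^-1) t)%:E)%E.
    by rewrite IB ?ltW// -EFinM; congr _%:E; field.
  rewrite -ge0_integralZl//; last first.
    by apply/measurable_EFinP; apply: measurable_indic; exact: measurable_ball.
  apply: ge0_le_integral => //.
  - by apply: emeasurable_funM => //; apply/measurable_EFinP; apply: measurable_indic; exact: measurable_ball.
  - exact/measurable_EFinP.
  - move=> t _; rewrite -EFinM lee_fin indicE.
    have [|_] := boolP (t \in (ball (0 : R) 2^-1 : set R)); last by rewrite mulr0 tent_ge0.
    rewrite inE /ball/= sub0r normrN mulr1 /tent le_max => t1.
    by apply/orP; right; lra.
have fin : (\int[leb]_t (tent t)%:E)%E \is a fin_num.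
  rewrite ge0_fin_numE; first by apply: le_lt_trans up _; rewrite ltry.
  by apply: integral_ge0 => t _; rewrite lee_fin tent_ge0.
exists (fine (\int[leb]_t (tent t)%:E)%E); last by rewrite fineK.
by rewrite -lte_fin fineK//; apply: lt_le_trans lo; rewrite lte_fin.
Qed.

End tent.

Section mollification.
Context (R : realType).
Notation leb := (@lebesgue_measure R).
Notation g := (@normal_pdf R 0 1).
Variables (c : R).
Hypotheses (c0 : 0 < c) (intc : (\int[leb]_t (tent t)%:E = c%:E)%E).

Definition tentk (h t : R) : R := (h * c)^-1 * tent (t / h).

Variable (h : R).
Hypothesis h0 : 0 < h.

Let hc0 : 0 < h * c. Proof. exact: mulr_gt0. Qed.

Lemma continuous_tentk : continuous (tentk h).
Proof.
move=> t; apply: cvgM; first exact: cvg_cst.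
apply: (@continuous_comp R R R (fun t : R => t / h) (@tent R)); last exact: continuous_tent.
by apply: cvgM; [exact: cvg_id|exact: cvg_cst].
Qed.

Lemma tentk_ge0 t : 0 <= tentk h t.
Proof. by rewrite mulr_ge0 ?tent_ge0// invr_ge0 ltW. Qed.

Lemma tentk_le t : tentk h t <= (h * c)^-1.
Proof. by rewrite ler_piMr ?tent_le1// invr_ge0 ltW. Qed.

Lemma integral_tentk : (\int[leb]_t (tentk h t)%:E = 1)%E.
Proof.
have mt : measurable_fun setT (@tent R) by apply: continuous_measurable_fun; exact: continuous_tent.
have hn : h^-1 != 0 by rewrite invr_neq0// gt_eqF.
have := @ge0_integral_affine R h^-1 0 (EFin \o @tent R) hn.
rewrite intc => /(_ _ _)/esym H.
under eq_integral => t _ do rewrite EFinM.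
rewrite ge0_integralZl//; last 3 first.
- by apply/measurable_EFinP; apply: measurableT_comp => //; exact: measurable_funM.
- by move=> t _; rewrite lee_fin tent_ge0.
- by rewrite lee_fin invr_ge0 ltW.
have {}H : (h^-1%:E * \int[leb]_t (tent (t / h))%:E = c%:E)%E.
  rewrite -H.
  - rewrite gtr0_norm ?invr_gt0//; congr (_ * _)%E; apply: eq_integral => t _ /=.
    by rewrite addr0 mulrC.
  - exact/measurable_EFinP.
  - by move=> t; rewrite lee_fin tent_ge0.
by rewrite invfM EFinM [X in (X * _)%E]muleC -muleA H -EFinM mulVf// gt_eqF.
Qed.

Lemma tentk_eq0 t : h <= `|t| -> tentk h t = 0.
Proof.
move=> ht; rewrite /tentk; suff -> : tent (t / h) = 0 by rewrite mulr0.
apply/eqP; rewrite eq_le tent_ge0 andbT /tent ge_max lexx/= subr_le0.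
by rewrite normrM normfV (gtr0_norm h0) ler_pdivlMr// mul1r.
Qed.

Section point.
Variables (f : R -> R) (x : R).
Hypotheses (mf : measurable_fun setT f) (f0 : forall x, 0 <= f x)
  (intf : (\int[leb]_x (f x)%:E = 1)%E).

(** As the kernel has mass 1, the difference is the integral of [f y - f x] against it. The kernel
    vanishes outside [ball x h] and is at most [1 / (h c)], while the ball has length [2 h]: hence
    the factor [2 / c]. *)
Lemma conv_tentk_dist :
  (`|convolution f (tentk h) x - f x|%:E <= (2 / c)%:E * davg f x h)%E.
Proof.
have ic := conv_integrable mf f0 intf continuous_tentk tentk_ge0 tentk_le x.
have mtk : measurable_fun setT (fun y : R => tentk h (x - y)).
  apply: measurableT_comp; last exact: measurable_funB.
  by apply: continuous_measurable_fun; exact: continuous_tentk.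
have shift : (\int[leb]_y (tentk h (x - y))%:E = 1)%E.
  rewrite -integral_tentk [RHS](@ge0_integral_affine _ (-1) x (EFin \o tentk h))//.
  - by rewrite normrN1 mul1e; apply: eq_integral => y _ /=; rewrite mulN1r addrC.
  - apply/measurable_EFinP; apply: continuous_measurable_fun; exact: continuous_tentk.
  - by move=> t; rewrite lee_fin tentk_ge0.
have itk : leb.-integrable setT (EFin \o (fun y => tentk h (x - y))).
  apply/integrableP; split; first exact/measurable_EFinP.
  under eq_integral => y _ do rewrite /= ger0_norm ?tentk_ge0//.
  by rewrite shift ltry.
have ifx : leb.-integrable setT (EFin \o (fun y => f x * tentk h (x - y))).
  have := integrableZl measurableT (f x) itk.
  by apply: eq_integrable.
have fxE : f x = (\int[leb]_y (f x * tentk h (x - y)))%R.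
  by rewrite RintegralZl// /Rintegral shift/= mulr1.
rewrite {1}fxE /convolution -RintegralB//.
have iB : leb.-integrable setT
    (EFin \o (fun y => f y * tentk h (x - y) - f x * tentk h (x - y))).
  have := integrableB measurableT ic ifx.
  by apply: eq_integrable.
apply: (@le_trans _ _ (\int[leb]_y `|f y * tentk h (x - y) - f x * tentk h (x - y)|)%R%:E).
  by rewrite lee_fin le_normr_Rintegral.
have iBn := integrable_norm iB.
rewrite /Rintegral fineK; last exact: integrable_fin_num.
have mB : measurable (ball x h) by exact: measurable_ball.
have mfx : measurable_fun setT (fun y => `|(f y - f x)%:E|)%E.
  by apply: measurableT_comp => //; apply/measurable_EFinP; exact: measurable_funB.
have -> : ((2 / c)%:E * davg f x h =
    (h * c)^-1%:E * \int[leb]_(y in ball x h) `|(f y - f x)%:E|)%E.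
  have B : leb (ball x h) = (h *+ 2)%:E by apply: lebesgue_measure_ball; exact: ltW.
  rewrite /davg /iavg [lebesgue_measure _]B inver mulrn_eq0 (gt_eqF h0)/=.
  rewrite muleA -EFinM; congr (_ * _)%E; congr _%:E.
  by field; rewrite !gt_eqF.
rewrite -ge0_integralZl//; last 2 first.
- by apply: measurable_funTS.
- by rewrite lee_fin invr_ge0 ltW.
rewrite [leRHS]integral_mkcond; apply: ge0_le_integral => //.
- by case/integrableP : iBn.
- apply/(measurable_restrictT _ _).1 => //; apply: measurable_funTS.
  exact: measurable_funeM.
- move=> y _; rewrite patchE -mulrBl normrM (ger0_norm (tentk_ge0 _)).
  have [yB|] := boolP (y \in (ball x h : set R)).
    by rewrite lee_fin mulrC ler_wpM2r// tentk_le.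
  rewrite notin_setE /ball/= => /negP; rewrite -leNgt => hxy.
  by rewrite tentk_eq0// mulr0.
Qed.

End point.

End mollification.

Section nonnegative_integrals.
Context (R : realType).
Notation leb := (@lebesgue_measure R).

Lemma integral_scale (f : R -> R) (a c : R) : measurable_fun setT f ->
  (forall x, 0 <= f x) -> 0 <= c -> (\int[leb]_x (f x)%:E = a%:E)%E ->
  (\int[leb]_x (c * f x)%:E = (c * a)%:E)%E.
Proof.
move=> mf f0 c0 If; rewrite EFinM -If -ge0_integralZl//.
- exact/measurable_EFinP.
- by move=> x _; rewrite lee_fin.
Qed.

Lemma integral_line_add (u v : R -> R) : measurable_fun setT u -> measurable_fun setT v ->
  (forall x, 0 <= u x) -> (forall x, 0 <= v x) ->
  (\int[leb]_x (u x)%:E + \int[leb]_x (v x)%:E =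
   \int[leb]_x (u x + v x)%:E)%E.
Proof.
move=> mu mv u0 v0.
have muE : measurable_fun setT (fun x => (u x)%:E) by exact/measurable_EFinP.
have mvE : measurable_fun setT (fun x => (v x)%:E) by exact/measurable_EFinP.
rewrite -ge0_integralD//.
- by move=> z _; rewrite lee_fin.
- by move=> z _; rewrite lee_fin.
Qed.

Lemma integral_plane_add (u v : R * R -> R) : measurable_fun setT u -> measurable_fun setT v ->
  (forall z, 0 <= u z) -> (forall z, 0 <= v z) ->
  (\int[leb \x leb]_z (u z)%:E + \int[leb \x leb]_z (v z)%:E =
   \int[leb \x leb]_z (u z + v z)%:E)%E.
Proof.
move=> mu mv u0 v0.
have muE : measurable_fun setT (fun z => (u z)%:E) by exact/measurable_EFinP.
have mvE : measurable_fun setT (fun z => (v z)%:E) by exact/measurable_EFinP.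
rewrite -ge0_integralD//.
- by move=> z _; rewrite lee_fin.
- by move=> z _; rewrite lee_fin.
Qed.

Lemma integral_plane_scale (u : R * R -> R) (c : R) : measurable_fun setT u ->
  (forall z, 0 <= u z) -> 0 <= c ->
  (\int[leb \x leb]_z (c * u z)%:E = c%:E * \int[leb \x leb]_z (u z)%:E)%E.
Proof.
move=> mu u0 c0; rewrite -ge0_integralZl//.
- exact/measurable_EFinP.
- by move=> z _; rewrite lee_fin.
Qed.

Lemma normalize_mass (f : R -> R) (a : R) : measurable_fun setT f ->
  (forall x, 0 <= f x) -> 0 < a -> (\int[leb]_x (f x)%:E = a%:E)%E ->
  [/\ measurable_fun setT (fun x : R => a^-1 * f x), forall x, 0 <= a^-1 * f x &
    (\int[leb]_x (a^-1 * f x)%:E = 1)%E].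
Proof.
move=> mf f0 a0 If; have a'0 : 0 <= a^-1 by rewrite invr_ge0 ltW.
split; [exact: measurable_funM|by move=> x; rewrite mulr_ge0|].
by rewrite (integral_scale mf f0 a'0 If) mulVf// gt_eqF.
Qed.

End nonnegative_integrals.

Section mollifier.
Context (R : realType).
Notation leb := (@lebesgue_measure R).
Notation g := (@normal_pdf R 0 1).

Lemma cvg_conv_tentk (c : R) (f : R -> R) : 0 < c ->
  (\int[leb]_t (tent t)%:E = c%:E)%E ->
  measurable_fun setT f -> (forall x, 0 <= f x) ->
  (\int[leb]_x (f x)%:E = 1)%E ->
  {ae leb, forall x, convolution f (tentk c (harmonic n)) x @[n --> \oo] --> f x}.
Proof.
move=> c0 intc mf f0 intf; pose e n : R := harmonic n.
have e0 n : 0 < e n by exact: harmonic_gt0.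
have ecvg : e @ \oo --> (0 : R) by exact: cvg_harmonic.
have locf : locally_integrable setT f.
  apply: open_integrable_locally; first exact: openT.
  apply/integrableP; split; first exact/measurable_EFinP.
  under eq_integral => x _ do rewrite /= ger0_norm//.
  by rewrite intf ltry.
have := lebesgue_differentiation locf.
apply: ae_imply => x /fine_cvgP[fin /cvgrPdist_le fx].
apply/cvgrPdist_le => d d0.
have d'0 : 0 < d * c / 2 by rewrite divr_gt0 ?mulr_gt0.
have := fx _ d'0; have : \forall r \near 0^'+, davg f x r \is a fin_num by exact: fin.
move=> H1 H2; have := filterI H1 H2 => H3.
have : \forall n \near \oo, 0 < e n -> davg f x (e n) \is a fin_num /\
    `|0 - fine (davg f x (e n))| <= d * c / 2.
  exact: (ecvg _ (H3 _)).
apply: filterS => n /(_ (e0 n))[finn]; rewrite sub0r normrN => dn.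
rewrite distrC -lee_fin; apply: le_trans (conv_tentk_dist c0 intc (e0 n) x mf f0 intf) _.
rewrite -(fineK finn) -EFinM lee_fin.
have : fine (davg f x (e n)) <= d * c / 2 by apply: le_trans dn; exact: ler_norm.
move=> h; have -> : d = 2 / c * (d * c / 2) by field; rewrite gt_eqF.
by rewrite ler_wpM2l// divr_ge0// ltW.
Qed.

Lemma regular_approximation (f : R -> R) :
  measurable_fun setT f -> (forall x, 0 <= f x) ->
  (\int[leb]_x (f x)%:E = 1)%E ->
  exists u : nat -> R -> R, [/\ forall n, continuous (u n),
    forall n x, 0 < u n x, forall n, (\int[leb]_x (u n x)%:E = 1)%E &
    {ae leb, forall x, u n x @[n --> \oo] --> f x}].
Proof.
move=> mf f0 intf; have [c c0 intc] := integral_tent R.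
pose e n : R := harmonic n.
have e0 n : 0 < e n by exact: harmonic_gt0.
have e1 n : e n <= 1 by rewrite /e/= invf_le1 ?ltr0n// ler1n.
have ecvg : e @ \oo --> (0 : R) by exact: cvg_harmonic.
pose v n := convolution f (tentk c (e n)).
have v0 n x : 0 <= v n x by apply: conv_ge0 => // t; exact: tentk_ge0.
have cv n : continuous (v n).
  apply: (continuous_conv mf f0 intf _ _ (tentk_le c0 (e0 n))).
  - exact: continuous_tentk.
  - by move=> t; exact: tentk_ge0.
have iv n : (\int[leb]_x (v n x)%:E = 1)%E.
  rewrite (integral_conv mf f0 intf _ _ (tentk_le c0 (e0 n))).
  - by rewrite integral_tentk// mule1.
  - exact: continuous_tentk.
  - by move=> t; exact: tentk_ge0.
have g0 x : 0 < g x by rewrite normal_pdf_gt0// oner_neq0.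
have cg : continuous g by apply: continuous_normal_pdf; rewrite oner_neq0.
(* The smoothed density can vanish because the tent has compact support. A Gaussian share of weight
   [e n], which tends to 0, restores positivity and keeps the mass equal to 1. *)
pose u n x := (1 - e n) * v n x + e n * g x.
exists u; split.
- by move=> n x; apply: cvgD; apply: cvgM; try exact: cvg_cst; [exact: cv|exact: cg].
- by move=> n x; rewrite ltr_wpDl ?mulr_gt0// mulr_ge0// subr_ge0.
- move=> n; have mv : measurable_fun setT (v n) by exact: continuous_measurable_fun.
  have mg : measurable_fun setT g by exact: continuous_measurable_fun.
  have en0 : 0 <= 1 - e n by rewrite subr_ge0.
  rewrite -(integral_line_add (u := fun x => (1 - e n) * v n x) (v := fun x => e n * g x)).
  + rewrite (integral_scale mv (v0 n) en0 (iv n)).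
    rewrite (integral_scale mg (fun x => ltW (g0 x)) (ltW (e0 n)) (integral_normal_pdf _ _)).
    by rewrite -EFinD !mulr1 subrK.
  + exact: measurable_funM.
  + exact: measurable_funM.
  + by move=> x; rewrite mulr_ge0.
  + by move=> x; rewrite mulr_ge0// ltW.
have := cvg_conv_tentk c0 intc mf f0 intf.
apply: ae_imply => x vcvg.
have -> : f x = (1 - 0) * f x + 0 * g x by ring.
apply: cvgD; apply: cvgM; try exact: cvg_cst; try exact: ecvg; try exact: vcvg.
by apply: cvgB; [exact: cvg_cst|exact: ecvg].
Qed.

Lemma cvg_powR (u : nat -> R) (a c : R) : 0 < c -> (forall n, 0 <= u n) ->
  u @ \oo --> a -> u n `^ c @[n --> \oo] --> a `^ c.
Proof.
move=> c0 u0 ua.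
have a0 : 0 <= a.
  rewrite -(cvg_lim (@Rhausdorff R) ua); apply: limr_ge; first exact: cvgP ua.
  exact: nearW.
have [a_gt0|] := ltP 0 a.
  apply: (@cvg_comp _ _ _ u (fun x : R => x `^ c) _ (nbhs a)) => //.
  have := is_derive1_powR c a_gt0 => -[/derivable1_diffP/differentiable_continuous + _].
  exact.
(* Powers need not be differentiable at 0, so this limit is checked directly with the threshold
   [d^(1/c)]. *)
move=> a_le0; have {a0 a_le0}az : a = 0 by apply/eqP; rewrite eq_le a_le0.
rewrite az powR0 ?gt_eqF//; apply/cvgrPdist_le => d d0.
have dc : 0 < d `^ c^-1 by exact: powR_gt0.
move: ua; rewrite az => /cvgrPdist_le/(_ _ dc); apply: filterS => n.
rewrite !sub0r !normrN ger0_norm// ger0_norm ?powR_ge0// => un.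
have -> : d = (d `^ c^-1) `^ c by rewrite -powRrM mulVf ?gt_eqF// powRr1// ltW.
by rewrite ge0_ler_powR ?nnegrE ?powR_ge0// ltW.
Qed.

End mollifier.

Section fatou_ae.
Local Open Scope ereal_scope.
Context d (T : measurableType d) (R : realType) (m : {measure set T -> \bar R}).

Lemma fatou_ae (F : nat -> T -> \bar R) (G : T -> \bar R) (C : \bar R) :
  (forall n, measurable_fun setT (F n)) -> measurable_fun setT G ->
  (forall n x, 0 <= F n x) -> (forall x, 0 <= G x) ->
  {ae m, forall x, F n x @[n --> \oo] --> G x} ->
  (forall n, \int[m]_x F n x <= C) -> \int[m]_x G x <= C.
Proof.
move=> mF mG F0 G0 [N [mN N0 NP]] FC.
have mD : measurable (setT `\` N) by exact: measurableD.
rewrite (ge0_negligible_integral mN)//.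
have -> : \int[m]_(x in setT `\` N) G x =
    \int[m]_(x in setT `\` N) limn_einf (F ^~ x).
  apply: eq_integral => x; rewrite inE => -[_ nNx].
  have Fx : F n x @[n --> \oo] --> G x by apply: contrapT => H; exact/nNx/NP.
  by have [-> _] := cvg_limn_einf_sup Fx.
apply: le_trans (fatou _ _ _ _) _ => //.
  by move=> n; exact: measurable_funTS.
rewrite limn_einf_lim; apply: lime_le; first exact: is_cvg_einfs.
apply: nearW => n; apply: le_trans (FC n).
rewrite [leRHS](ge0_negligible_integral mN)//.
by apply: ereal_inf_lbound; exists n => /=.
Qed.

End fatou_ae.

Section BL_inequality.
Context (R : realType) (D : BLdatum R).
Notation leb := (@lebesgue_measure R).
Notation r1 := (br1 D). Notation r2 := (br2 D). Notation r3 := (br3 D).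
Notation d1 := (bd1 D). Notation d2 := (bd2 D). Notation d3 := (bd3 D).

Let d1p : 0 < d1 ^+ 2. Proof. by rewrite exprn_gt0 ?bd1_gt0. Qed.
Let d2p : 0 < d2 ^+ 2. Proof. by rewrite exprn_gt0 ?bd2_gt0. Qed.
Let d3p : 0 < d3 ^+ 2. Proof. by rewrite exprn_gt0 ?bd3_gt0. Qed.

Lemma ae_BLu1 (Q : R -> Prop) : {ae leb, forall x, Q x} ->
  {ae (leb \x leb)%E, forall z : R * R, Q z.1}.
Proof. exact: ae_prod_fst. Qed.

Lemma ae_BLu2 (Q : R -> Prop) : {ae leb, forall x, Q x} ->
  {ae (leb \x leb)%E, forall z : R * R, Q (BLu2 D z)}.
Proof.
by apply: ae_prod_lin; rewrite mulf_neq0 ?invr_neq0 ?mulf_neq0// gt_eqF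
  ?br3_gt0 ?bd1_gt0 ?bd2_gt0.
Qed.

Lemma ae_BLu3 (Q : R -> Prop) : {ae leb, forall x, Q x} ->
  {ae (leb \x leb)%E, forall z : R * R, Q (BLu3 D z)}.
Proof.
by apply: ae_prod_lin; rewrite mulf_neq0 ?invr_neq0 ?mulf_neq0// gt_eqF
  ?br2_gt0 ?bd1_gt0 ?bd3_gt0.
Qed.

Lemma BLint_le1 (f1 f2 f3 : R -> R) :
  measurable_fun setT f1 -> measurable_fun setT f2 -> measurable_fun setT f3 ->
  (forall x, 0 <= f1 x) -> (forall x, 0 <= f2 x) -> (forall x, 0 <= f3 x) ->
  (\int[leb]_x (f1 x)%:E = 1)%E -> (\int[leb]_x (f2 x)%:E = 1)%E ->
  (\int[leb]_x (f3 x)%:E = 1)%E ->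
  (BLint D f1 f2 f3 <= 1)%E.
Proof.
move=> m1 m2 m3 f1_0 f2_0 f3_0 i1 i2 i3.
have [u1 [cu1 u1p iu1 au1]] := regular_approximation m1 f1_0 i1.
have [u2 [cu2 u2p iu2 au2]] := regular_approximation m2 f2_0 i2.
have [u3 [cu3 u3p iu3 au3]] := regular_approximation m3 f3_0 i3.
pose F n z := (BLprod D (u1 n) (u2 n) (u3 n) z)%:E.
have mF n : measurable_fun setT (F n).
  by apply/measurable_EFinP; apply: measurable_BLprod; exact: continuous_measurable_fun.
have F0 n z : (0 <= F n z)%E by rewrite lee_fin BLprod_ge0.
have Fcvg : {ae (leb \x leb)%E, forall z, F n z @[n --> \oo] --> (BLprod D f1 f2 f3 z)%:E}.
  move: (ae_conj (ae_conj (ae_BLu1 au1) (ae_BLu2 au2)) (ae_BLu3 au3)).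
  apply: ae_imply => z [[c1 c2] c3]; apply/fine_cvgP; split; first exact: nearW.
  apply: cvgM; first apply: cvgM.
  - by apply: cvg_powR => // n; exact: ltW.
  - by apply: cvg_powR => // n; exact: ltW.
  - by apply: cvg_powR => // n; exact: ltW.
apply: (@fatou_ae _ _ _ (leb \x leb)%E F (EFin \o BLprod D f1 f2 f3)) => //.
- by apply/measurable_EFinP; exact: measurable_BLprod.
- by move=> z; rewrite lee_fin BLprod_ge0.
- move=> n; have [+ _] := @BLint_regular R D (u1 n) (u2 n) (u3 n) (cu1 n) (cu2 n)
    (cu3 n) (u1p n) (u2p n) (u3p n) (iu1 n) (iu2 n) (iu3 n).
  exact.
Qed.

Lemma BLprod_scale (f1 f2 f3 : R -> R) (a1 a2 a3 : R) z :
  0 <= a1 -> 0 <= a2 -> 0 <= a3 ->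
  (forall x, 0 <= f1 x) -> (forall x, 0 <= f2 x) -> (forall x, 0 <= f3 x) ->
  BLprod D (fun x => a1 * f1 x) (fun x => a2 * f2 x) (fun x => a3 * f3 x) z =
  a1 `^ (d1 ^+ 2) * a2 `^ (d2 ^+ 2) * a3 `^ (d3 ^+ 2) * BLprod D f1 f2 f3 z.
Proof. by move=> *; rewrite /BLprod !powRM//; ring. Qed.

Lemma BLint_scale (f1 f2 f3 : R -> R) (a1 a2 a3 : R) :
  measurable_fun setT f1 -> measurable_fun setT f2 -> measurable_fun setT f3 ->
  0 <= a1 -> 0 <= a2 -> 0 <= a3 ->
  (forall x, 0 <= f1 x) -> (forall x, 0 <= f2 x) -> (forall x, 0 <= f3 x) ->
  (BLint D (fun x => a1 * f1 x)%R (fun x => a2 * f2 x)%R (fun x => a3 * f3 x)%R =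
   (a1 `^ (d1 ^+ 2) * a2 `^ (d2 ^+ 2) * a3 `^ (d3 ^+ 2))%:E * BLint D f1 f2 f3)%E.
Proof.
move=> m1 m2 m3 a1_0 a2_0 a3_0 f1_0 f2_0 f3_0; rewrite /BLint -integral_plane_scale.
- by apply: eq_integral => z _; rewrite BLprod_scale.
- exact: measurable_BLprod.
- by move=> z; exact: BLprod_ge0.
- by rewrite !mulr_ge0// powR_ge0.
Qed.

Lemma ae_zero (f : R -> R) : measurable_fun setT f -> (forall x, 0 <= f x) ->
  (\int[leb]_x (f x)%:E = 0)%E -> {ae leb, forall x, f x = 0}.
Proof.
move=> mf f0 If.
have mfE : measurable_fun setT (EFin \o f) by exact/measurable_EFinP.
have : (\int[leb]_x `|(EFin \o f) x| = 0)%E.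
  by rewrite -If; apply: eq_integral => x _; rewrite gee0_abs// lee_fin.
move=> /(ae_eq_integral_abs leb measurableT mfE).
by apply: ae_imply => x H; have [] := H I.
Qed.

Lemma BLint_le (f1 f2 f3 : R -> R) (a1 a2 a3 : R) :
  measurable_fun setT f1 -> measurable_fun setT f2 -> measurable_fun setT f3 ->
  (forall x, 0 <= f1 x) -> (forall x, 0 <= f2 x) -> (forall x, 0 <= f3 x) ->
  (\int[leb]_x (f1 x)%:E = a1%:E)%E -> (\int[leb]_x (f2 x)%:E = a2%:E)%E ->
  (\int[leb]_x (f3 x)%:E = a3%:E)%E ->
  (BLint D f1 f2 f3 <= (a1 `^ (d1 ^+ 2) * a2 `^ (d2 ^+ 2) * a3 `^ (d3 ^+ 2))%:E)%E.
Proof.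
move=> m1 m2 m3 f1_0 f2_0 f3_0 i1 i2 i3.
have a1_0 : 0 <= a1 by rewrite -lee_fin -i1; apply: integral_ge0 => x _; rewrite lee_fin.
have a2_0 : 0 <= a2 by rewrite -lee_fin -i2; apply: integral_ge0 => x _; rewrite lee_fin.
have a3_0 : 0 <= a3 by rewrite -lee_fin -i3; apply: integral_ge0 => x _; rewrite lee_fin.
have K0 : 0 <= a1 `^ (d1 ^+ 2) * a2 `^ (d2 ^+ 2) * a3 `^ (d3 ^+ 2).
  by rewrite !mulr_ge0// powR_ge0.
have mB : measurable_fun setT (EFin \o BLprod D f1 f2 f3).
  by apply/measurable_EFinP; exact: measurable_BLprod.
(* A factor of mass 0 cannot be normalized, but it vanishes almost everywhere, and so does the
   product because the exponents are positive. *)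
have zero : {ae (leb \x leb)%E, forall z, BLprod D f1 f2 f3 z = 0} ->
    (BLint D f1 f2 f3 <= (a1 `^ (d1 ^+ 2) * a2 `^ (d2 ^+ 2) * a3 `^ (d3 ^+ 2))%:E)%E.
  move=> ae0; have -> : BLint D f1 f2 f3 = (\int[leb \x leb]_z 0)%E.
    apply: ge0_ae_eq_integral => //.
    - by move=> z _; rewrite lee_fin BLprod_ge0.
    - by move: ae0; apply: ae_imply => z -> _.
  by rewrite integral0 lee_fin.
have [a1z|a1n] := eqVneq a1 0.
  apply: zero; rewrite a1z in i1; have := ae_BLu1 (ae_zero m1 f1_0 i1).
  by apply: ae_imply => z h; rewrite /BLprod h powR0 ?gt_eqF// !mul0r.
have [a2z|a2n] := eqVneq a2 0.
  apply: zero; rewrite a2z in i2; have := ae_BLu2 (ae_zero m2 f2_0 i2).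
  by apply: ae_imply => z h; rewrite /BLprod h powR0 ?gt_eqF// mulr0 mul0r.
have [a3z|a3n] := eqVneq a3 0.
  apply: zero; rewrite a3z in i3; have := ae_BLu3 (ae_zero m3 f3_0 i3).
  by apply: ae_imply => z h; rewrite /BLprod h powR0 ?gt_eqF// mulr0.
have pos (a : R) : 0 <= a -> a != 0 -> 0 < a by rewrite lt_neqAle eq_sym => -> ->.
have [n1 n1_0 J1] := normalize_mass m1 f1_0 (pos _ a1_0 a1n) i1.
have [n2 n2_0 J2] := normalize_mass m2 f2_0 (pos _ a2_0 a2n) i2.
have [n3 n3_0 J3] := normalize_mass m3 f3_0 (pos _ a3_0 a3n) i3.
have E (f : R -> R) (a : R) : a != 0 -> f = (fun x => a * (a^-1 * f x)).
  by move=> an; apply/funext => x; rewrite mulVKf.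
rewrite (E f1 a1 a1n) (E f2 a2 a2n) (E f3 a3 a3n) BLint_scale//.
rewrite -[leRHS]mule1 lee_wpmul2l ?lee_fin//.
exact: (BLint_le1 n1 n2 n3 n1_0 n2_0 n3_0 J1 J2 J3).
Qed.

End BL_inequality.

(** * Extremal densities *)

Section gaussian_densities.
Context (R : realType).
Notation leb := (@lebesgue_measure R).
Notation np := (@normal_pdf R).

Lemma normal_pdf_pos (a s x : R) : 0 < s -> np a s x =
  (Num.sqrt (pi *+ 2))^-1 / s * expR (- ((x - a) ^+ 2 / (s ^+ 2 *+ 2))).
Proof.
move=> s0; rewrite normal_pdfE ?gt_eqF// /normal_peak /normal_fun.
congr (_ * _); last by rewrite mulNr.
by rewrite -mulrnAr sqrtrM ?sqr_ge0// sqrtr_sqr gtr0_norm// invfM mulrC.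
Qed.

Lemma normal_pdf_center (s x y : R) : 0 < s -> np 0 s (x - y) = np y s x.
Proof. by move=> s0; rewrite !normal_pdf_pos// subr0. Qed.

(** Completing the square in [y]: the joint density of a summand and the sum is the density of the
    sum times the conditional density of the summand. Integrating out [y] leaves the convolution
    formula. *)
Lemma normal_pdf_mul (a b s t x y : R) : 0 < s -> 0 < t ->
  let w := Num.sqrt (s ^+ 2 + t ^+ 2) in
  np a s y * np b t (x - y) =
  np (a + b) w x * np ((a * t ^+ 2 + (x - b) * s ^+ 2) / w ^+ 2) (s * t / w) y.
Proof.
move=> s0 t0 w.
have st0 : 0 < s ^+ 2 + t ^+ 2 by rewrite addr_gt0// exprn_gt0.
have w0 : 0 < w by rewrite sqrtr_gt0.
have w2 : w ^+ 2 = s ^+ 2 + t ^+ 2 by rewrite sqr_sqrtr// ltW.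
have q0 : 0 < s * t / w by rewrite divr_gt0// mulr_gt0.
rewrite !normal_pdf_pos//; set K := _^-1.
rewrite mulrACA [RHS]mulrACA -!expRD; congr (_ * expR _).
  by field; rewrite !gt_eqF.
rewrite -!opprD; congr (- _).
rewrite [(s * t / w) ^+ 2]exprMn exprVn exprMn w2.
by field; rewrite !gt_eqF.
Qed.

Lemma conv_normal (a b s t x : R) : 0 < s -> 0 < t ->
  convolution (np a s) (np b t) x = np (a + b) (Num.sqrt (s ^+ 2 + t ^+ 2)) x.
Proof.
move=> s0 t0; rewrite /convolution.
under eq_Rintegral => y _ do rewrite normal_pdf_mul//.
rewrite RintegralZl//; last by exact: integrable_normal_pdf.
by rewrite /Rintegral integral_normal_pdf/= mulr1.
Qed.

Lemma normal_pdf_inj (a b s t : R) : 0 < s -> 0 < t -> np a s =1 np b t ->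
  a = b /\ s = t.
Proof.
move=> s0 t0 E.
have sn : s != 0 by rewrite gt_eqF. have tn : t != 0 by rewrite gt_eqF.
pose K : R := (Num.sqrt (pi *+ 2))^-1.
have K0 : 0 < K by rewrite invr_gt0 sqrtr_gt0 mulrn_wgt0// pi_gt0.
(* Evaluated at the centre of the first density, the identity compares its maximum with a value of
   the second, hence compares the inverse deviations; symmetry gives equality. *)
have le (a' b' s' t' : R) : 0 < s' -> 0 < t' -> np a' s' =1 np b' t' -> s'^-1 <= t'^-1.
  move=> s'0 t'0 E'; have := E' a'.
  rewrite !normal_pdf_pos// subrr expr0n/= mul0r oppr0 expR0 mulr1 => h.
  have Kt : 0 < K / t' by rewrite divr_gt0.
  rewrite -(ler_pM2l K0) h ger_pMr// expR_le1 oppr_le0.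
  by rewrite divr_ge0 ?sqr_ge0// mulrn_wge0// sqr_ge0.
have st : s = t.
  apply: invr_inj; apply/eqP; rewrite eq_le (le a b)//= (le b a)//.
split=> //; have := E a; rewrite st !normal_pdf_pos// subrr expr0n/= mul0r oppr0 expR0.
move=> /(mulfI _) H; have {}H : 1 = expR (- ((a - b) ^+ 2 / (t ^+ 2 *+ 2))).
  by apply: H; rewrite gt_eqF// divr_gt0.
apply/eqP; rewrite -subr_eq0 -sqrf_eq0; apply/eqP.
move: H; rewrite -expR0 => /expR_inj/eqP; rewrite eq_sym oppr_eq0 mulf_eq0 invr_eq0.
case/orP => [/eqP//|].
by rewrite mulrn_eq0/= sqrf_eq0 (gt_eqF t0).
Qed.

End gaussian_densities.

Section BL_superposition.
Context (R : realType) (D : BLdatum R).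
Notation leb := (@lebesgue_measure R).
Notation r1 := (br1 D). Notation r2 := (br2 D). Notation r3 := (br3 D).
Notation d1 := (bd1 D). Notation d2 := (bd2 D). Notation d3 := (bd3 D).
Notation np := (@normal_pdf R).

(** This is [sum c_i u_i u_i^T = Id] evaluated as a quadratic form. *)
Lemma BL_parseval (x y : R) :
  d1 ^+ 2 * x ^+ 2 + d2 ^+ 2 * BLu2 D (x, y) ^+ 2 + d3 ^+ 2 * BLu3 D (x, y) ^+ 2 =
  x ^+ 2 + y ^+ 2.
Proof.
have E1 := bd1E D; have E0 := br_sum D.
have d1n : d1 != 0 by rewrite gt_eqF ?bd1_gt0.
have d2n : d2 != 0 by rewrite gt_eqF ?bd2_gt0.
have d3n : d3 != 0 by rewrite gt_eqF ?bd3_gt0.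
have d1E' : d1 ^+ 2 = r2 ^+ 2 + r3 ^+ 2 by lra.
rewrite /BLu2 /BLu3/=.
transitivity ((d1 ^+ 2 + r1 ^+ 2 * ((r2 ^+ 2 + r3 ^+ 2) / d1 ^+ 2)) * x ^+ 2 +
   (r2 ^+ 2 + r3 ^+ 2) / d1 ^+ 2 * y ^+ 2); first by field; rewrite d1n d2n d3n.
rewrite -d1E' divff ?expf_neq0// mulr1 mul1r; congr (_ + _).
have -> : d1 ^+ 2 + r1 ^+ 2 = 1 by lra.
by rewrite mul1r.
Qed.

Lemma BLsum2 : d1 ^+ 2 + d2 ^+ 2 + d3 ^+ 2 = 2.
Proof. have := bd1E D; have := bd2E D; have := bd3E D; have := br_sum D; lra. Qed.

Lemma BLu2_lin (x y x' y' : R) :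
  BLu2 D (x - x', y - y') = BLu2 D (x, y) - BLu2 D (x', y').
Proof. by rewrite /BLu2/=; ring. Qed.

Lemma BLu3_lin (x y x' y' : R) :
  BLu3 D (x - x', y - y') = BLu3 D (x, y) - BLu3 D (x', y').
Proof. by rewrite /BLu3/=; ring. Qed.

(** The isotropic planar Gaussian factors along the three lines when the centres are the projections
    of a single point. This serves for the Gaussian reference weight, for the smoothing kernel and
    for the converse in the equality cases. *)
Lemma BLprod_normal (m1 m2 s : R) (z : R * R) : 0 < s ->
  BLprod D (np m1 s) (np (BLu2 D (m1, m2)) s) (np (BLu3 D (m1, m2)) s) z =
  np m1 s z.1 * np m2 s z.2.
Proof.
move=> s0; have sn : s != 0 by rewrite gt_eqF.
case: z => x y; rewrite /BLprod/= !normal_pdf_expR// -!expRM -!expRD; congr expR.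
set K := ln _; rewrite -BLu2_lin -BLu3_lin.
transitivity (K * (d1 ^+ 2 + d2 ^+ 2 + d3 ^+ 2) - (d1 ^+ 2 * (x - m1) ^+ 2 +
  d2 ^+ 2 * BLu2 D (x - m1, y - m2) ^+ 2 + d3 ^+ 2 * BLu3 D (x - m1, y - m2) ^+ 2)
   / (s ^+ 2 *+ 2)); first by field.
by rewrite BL_parseval BLsum2; field.
Qed.

Lemma BLprodM (f1 f2 f3 k1 k2 k3 : R -> R) (z : R * R) :
  (forall x, 0 <= f1 x) -> (forall x, 0 <= f2 x) -> (forall x, 0 <= f3 x) ->
  (forall x, 0 <= k1 x) -> (forall x, 0 <= k2 x) -> (forall x, 0 <= k3 x) ->
  BLprod D (fun x => f1 x * k1 x) (fun x => f2 x * k2 x) (fun x => f3 x * k3 x) z =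
  BLprod D f1 f2 f3 z * BLprod D k1 k2 k3 z.
Proof.
move=> f1_0 f2_0 f3_0 k1_0 k2_0 k3_0; rewrite /BLprod.
by rewrite (powRM _ (f1_0 _) (k1_0 _)) (powRM _ (f2_0 _) (k2_0 _))
  (powRM _ (f3_0 _) (k3_0 _)); ring.
Qed.

Lemma integral_prod_mul (a b : R -> R) :
  measurable_fun setT a -> measurable_fun setT b ->
  (forall x, 0 <= a x) -> (forall x, 0 <= b x) ->
  (\int[leb \x leb]_z (a z.1 * b z.2)%:E =
   (\int[leb]_x (a x)%:E) * (\int[leb]_x (b x)%:E))%E.
Proof.
move=> ma mb a0 b0.
have mF : measurable_fun setT (fun z : R * R => (a z.1 * b z.2)%:E).
  by apply/measurable_EFinP; apply: measurable_funM; exact: measurableT_comp.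
rewrite (tonelli1 mF); last by move=> z; rewrite lee_fin mulr_ge0.
rewrite -ge0_integralZr//; last 3 first.
- exact/measurable_EFinP.
- by move=> x _; rewrite lee_fin.
- by apply: integral_ge0 => x _; rewrite lee_fin.
apply: eq_integral => x _ /=; under eq_integral => y _ do rewrite EFinM.
rewrite ge0_integralZl//.
- exact/measurable_EFinP.
- by move=> y _; rewrite lee_fin.
- by rewrite lee_fin.
Qed.

(** The superposition argument exchanges two integrals over the plane, and Tonelli asks for the
    planar measure packaged as sigma-finite; squares of side [2 n] exhaust the plane. *)
Lemma sigma_finite_plane :
  exists M : {sigma_finite_measure set (measurableTypeR R * measurableTypeR R)%type -> \bar R},
    M = (leb \x leb)%E :> (set _ -> \bar R).
Proof.
have sf : sigma_finite setT (leb \x leb)%E.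
  pose B (n : nat) : set R := `](- n%:R)%R, n%:R]%classic.
  exists (fun n => B n `*` B n).
    apply/esym; rewrite -subTset => -[x y] _.
    have [n nxy] : exists n : nat, `|x| < n%:R /\ `|y| < n%:R.
      exists (Num.truncn `|x| + Num.truncn `|y|).+1; split.
      - apply: lt_le_trans (truncnS_gt _) _; rewrite ler_nat ltnS leq_addr//.
      - apply: lt_le_trans (truncnS_gt _) _; rewrite ler_nat ltnS leq_addl//.
    exists n => //; case: nxy; rewrite !ltr_norml => /andP[x1 x2] /andP[y1 y2].
    by split; rewrite /B/= in_itv/= ?x1 ?y1 ltW.
  move=> n; have mB : measurable (B n) by exact: measurable_itv.
  split; first exact: measurableX.
  rewrite product_measure1E//.
  have B0 : leb (B n) = (n%:R - - n%:R)%:E.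
    rewrite lebesgue_measure_itv/= lte_fin; case: ifPn => //.
    by rewrite -leNgt => h; congr _%:E; have := ler0n R n; lra.
  suff H : (leb (B n) * leb (B n) < +oo)%E by exact: H.
  by rewrite B0 -EFinM ltry.
pose H := @Measure_isSigmaFinite.Build _ _ _ (leb \x leb)%E sf.
pose M : {sigma_finite_measure set (measurableTypeR R * measurableTypeR R)%type -> \bar R} :=
  HB.pack (leb \x leb)%E (Measure.on (leb \x leb)%E) H.
by exists M.
Qed.

(* For fixed [z], [w |-> prod f_i^c_i (u_i.w) prod gamma^c_i (u_i.(z - w))]
   is itself a Brascamp-Lieb integrand. *)
Lemma BLint_convolution (f1 f2 f3 : R -> R) (s : R) : 0 < s ->
  measurable_fun setT f1 -> measurable_fun setT f2 -> measurable_fun setT f3 ->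
  (forall x, 0 <= f1 x) -> (forall x, 0 <= f2 x) -> (forall x, 0 <= f3 x) ->
  (\int[leb]_x (f1 x)%:E = 1)%E -> (\int[leb]_x (f2 x)%:E = 1)%E ->
  (\int[leb]_x (f3 x)%:E = 1)%E ->
  (BLint D f1 f2 f3 <= BLint D (convolution f1 (np 0%R s))
    (convolution f2 (np 0%R s)) (convolution f3 (np 0%R s)))%E.
Proof.
move=> s0 m1 m2 m3 f1_0 f2_0 f3_0 i1 i2 i3; have sn : s != 0 by rewrite gt_eqF.
pose k := np 0 s.
have k0 x : 0 <= k x by exact: normal_pdf_ge0.
have kC x : k x <= normal_peak s by exact: normal_pdf_ub.
have ck : continuous k by exact: continuous_normal_pdf.
have mk : measurable_fun setT k by exact: measurable_normal_pdf.
pose P := BLprod D f1 f2 f3.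
have mP : measurable_fun setT P by exact: measurable_BLprod.
have P0 z : 0 <= P z by exact: BLprod_ge0.
pose F (q : (R * R) * (R * R)) : \bar R :=
  ((P q.1)%:E * (k (q.2.1 - q.1.1) * k (q.2.2 - q.1.2))%:E)%E.
have mF : measurable_fun setT F.
  apply: emeasurable_funM; apply/measurable_EFinP; first exact: measurableT_comp.
  apply: measurable_funM; apply: (measurableT_comp mk); apply: measurable_funB;
    by do 2 apply: measurableT_comp => //.
have F0 q : (0 <= F q)%E by rewrite /F mule_ge0// lee_fin// mulr_ge0.
have -> : BLint D f1 f2 f3 = (\int[leb \x leb]_w \int[leb \x leb]_z F (w, z))%E.
  apply: eq_integral => w _; rewrite /F/= ge0_integralZl//; last 3 first.
  - apply/measurable_EFinP; apply: measurable_funM; apply: (measurableT_comp mk);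
      by apply: measurable_funB => //; exact: measurableT_comp.
  - by move=> z _; rewrite lee_fin mulr_ge0.
  - by rewrite lee_fin.
  rewrite (@integral_prod_mul (fun x => k (x - w.1)) (fun x => k (x - w.2)))//; last 2 first.
  - by apply: (measurableT_comp mk); exact: measurable_funB.
  - by apply: (measurableT_comp mk); exact: measurable_funB.
  have I a : (\int[leb]_x (k (x - a))%:E = 1)%E.
    rewrite -(integral_normal_pdf a s); apply: eq_integral => x _.
    by rewrite /k normal_pdf_center.
  by rewrite !I !mule1.
have [M ME] := sigma_finite_plane.
have fub : (\int[leb \x leb]_w \int[leb \x leb]_z F (w, z) =
            \int[leb \x leb]_z \int[leb \x leb]_w F (w, z))%E.
  rewrite -ME; exact: (@fubini_tonelli _ _ _ _ R M M F mF F0).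
rewrite fub; apply: ge0_le_integral; first exact: measurableT.
- by move=> z _; exact: integral_ge0.
- rewrite -ME; exact: (@measurable_fun_fubini_tonelli_G _ _ _ _ R M F mF F0).
- apply/measurable_EFinP; apply: measurable_BLprod; apply: continuous_measurable_fun.
  + exact: (continuous_conv m1 f1_0 i1 ck k0 kC).
  + exact: (continuous_conv m2 f2_0 i2 ck k0 kC).
  + exact: (continuous_conv m3 f3_0 i3 ck k0 kC).
- move=> [x y] _.
  have mkx a : measurable_fun setT (fun u : R => k (a - u)).
    by apply: (measurableT_comp mk); exact: measurable_funB.
  pose h1 u := f1 u * k (x - u).
  pose h2 u := f2 u * k (BLu2 D (x, y) - u).
  pose h3 u := f3 u * k (BLu3 D (x, y) - u).
  have -> : (\int[leb \x leb]_w F (w, (x, y)) = BLint D h1 h2 h3)%E.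
    apply: eq_integral => -[a b] _; rewrite /F/= -EFinM; congr _%:E.
    have := BLprod_normal 0 0 (x - a, y - b) s0.
    have -> : BLu2 D (0, 0) = 0 by rewrite /BLu2/= !mulr0 addr0.
    have -> : BLu3 D (0, 0) = 0 by rewrite /BLu3/= !mulr0 addr0.
    move=> E; apply/esym; apply: (etrans (@BLprodM f1 f2 f3 (fun u => k (x - u))
      (fun u => k (BLu2 D (x, y) - u)) (fun u => k (BLu3 D (x, y) - u)) (a, b)
      f1_0 f2_0 f3_0 (fun u => k0 _) (fun u => k0 _) (fun u => k0 _))).
    apply: (congr1 (fun q => P (a, b) * q)); apply: (etrans _ E).
    by rewrite /BLprod BLu2_lin BLu3_lin.
  (* The masses of [h1], [h2], [h3] are the values of the convolutions at the three projections of
     [(x, y)], so the bound is exactly the integrand on the right. *)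
  have := @BLint_le R D h1 h2 h3 (convolution f1 k x) (convolution f2 k (BLu2 D (x, y)))
    (convolution f3 k (BLu3 D (x, y))).
  apply.
  + exact: measurable_funM.
  + exact: measurable_funM.
  + exact: measurable_funM.
  + by move=> u; rewrite mulr_ge0.
  + by move=> u; rewrite mulr_ge0.
  + by move=> u; rewrite mulr_ge0.
  + by rewrite (convE m1 f1_0 i1 ck k0 kC).
  + by rewrite (convE m2 f2_0 i2 ck k0 kC).
  + by rewrite (convE m3 f3_0 i3 ck k0 kC).
Qed.

(** Superposition gives at least 1 for the smoothed triple and the regular case gives at most 1. The
    smoothed densities are continuous and positive, so the equality case of the regular theorem
    applies to them. *)
Lemma BLextremal_convolution (f1 f2 f3 : R -> R) (s : R) : 0 < s ->
  measurable_fun setT f1 -> measurable_fun setT f2 -> measurable_fun setT f3 ->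
  (forall x, 0 <= f1 x) -> (forall x, 0 <= f2 x) -> (forall x, 0 <= f3 x) ->
  (\int[leb]_x (f1 x)%:E = 1)%E -> (\int[leb]_x (f2 x)%:E = 1)%E ->
  (\int[leb]_x (f3 x)%:E = 1)%E -> BLint D f1 f2 f3 = 1%E ->
  exists a1 a2 a3 t, [/\ 0 < t,
    convolution f1 (np 0 s) =1 np a1 t, convolution f2 (np 0 s) =1 np a2 t &
    convolution f3 (np 0 s) =1 np a3 t].
Proof.
move=> s0 m1 m2 m3 f1_0 f2_0 f3_0 i1 i2 i3 BL1; have sn : s != 0 by rewrite gt_eqF.
pose k := np 0 s.
have kp x : 0 < k x by exact: normal_pdf_gt0.
have k0 x : 0 <= k x by exact: normal_pdf_ge0.
have kC x : k x <= normal_peak s by exact: normal_pdf_ub.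
have ck : continuous k by exact: continuous_normal_pdf.
have int (f : R -> R) (mf : measurable_fun setT f) (f0 : forall x, 0 <= f x)
    (If : (\int[leb]_x (f x)%:E = 1)%E) : (\int[leb]_x (convolution f k x)%:E = 1)%E.
  by rewrite (integral_conv mf f0 If ck k0 kC) integral_normal_pdf mule1.
have [le1 eq1] := @BLint_regular R D (convolution f1 k) (convolution f2 k) (convolution f3 k)
  (continuous_conv m1 f1_0 i1 ck k0 kC) (continuous_conv m2 f2_0 i2 ck k0 kC)
  (continuous_conv m3 f3_0 i3 ck k0 kC) (conv_gt0 m1 f1_0 i1 ck k0 kC kp ltr01)
  (conv_gt0 m2 f2_0 i2 ck k0 kC kp ltr01) (conv_gt0 m3 f3_0 i3 ck k0 kC kp ltr01)
  (int _ m1 f1_0 i1) (int _ m2 f2_0 i2) (int _ m3 f3_0 i3).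
apply: eq1; apply/eqP; rewrite eq_le le1/= -BL1.
exact: BLint_convolution.
Qed.

End BL_superposition.

Section ae_integral.
Context d (T : measurableType d) (R : realType) (m : {measure set T -> \bar R}).

Lemma ae_integral_eq (f g : T -> R) (A : set T) : measurable A ->
  measurable_fun setT f -> measurable_fun setT g -> {ae m, forall x, f x = g x} ->
  (\int[m]_(x in A) (f x)%:E = \int[m]_(x in A) (g x)%:E)%E.
Proof.
move=> mA mf mg fg; apply: ae_eq_integral => //.
- by apply/measurable_EFinP; exact: measurable_funTS.
- by apply/measurable_EFinP; exact: measurable_funTS.
- by apply: ae_imply fg => x -> _.
Qed.

End ae_integral.

(** * Removing the Gaussian smoothing *)

Section deconvolution.
Context (R : realType).
Notation leb := (@lebesgue_measure R).
Notation np := (@normal_pdf R).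

Lemma cvg_fin_of_EFin (u : nat -> \bar R) (v : nat -> R) (L : R) :
  (forall n, u n = (v n)%:E) -> u @ \oo --> L%:E -> v @ \oo --> L.
Proof.
move=> uv; have -> : u = EFin \o v by apply/funext.
by move/fine_cvg.
Qed.

Lemma cvg_integral_density (p : R -> R) (g_ : nat -> R -> R) (g : R -> R) (m C : R) :
  measurable_fun setT p -> (forall x, 0 <= p x) -> (\int[leb]_x (p x)%:E = m%:E)%E ->
  (forall n, measurable_fun setT (g_ n)) -> measurable_fun setT g ->
  (forall n x, 0 <= g_ n x) -> (forall n x, g_ n x <= C) ->
  (forall x, g_ n x @[n --> \oo] --> g x) ->
  (\int[leb]_x (p x * g_ n x)%:E)%E @[n --> \oo] --> (\int[leb]_x (p x * g x)%:E)%E.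
Proof.
move=> mp p0 ip mg_ mg g_0 g_C g_g.
have ig : leb.-integrable setT (fun x => (C * p x)%:E).
  have ip' : leb.-integrable setT (EFin \o p).
    apply/integrableP; split; first exact/measurable_EFinP.
    under eq_integral => x _ do rewrite /= ger0_norm//.
    by rewrite ip ltry.
  by have := integrableZl measurableT C ip'; apply: eq_integrable.
have mpg n : measurable_fun setT (fun x : R => (p x * g_ n x)%:E).
  by apply/measurable_EFinP; exact: measurable_funM.
have mpgl : measurable_fun setT (fun x : R => (p x * g x)%:E).
  by apply/measurable_EFinP; exact: measurable_funM.
have [] := @dominated_convergence _ (measurableTypeR R) R leb setT measurableT
  (fun n x => (p x * g_ n x)%:E) (fun x => (p x * g x)%:E) (fun x => (C * p x)%:E).
- exact: mpg.
- exact: mpgl.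
- apply: ae_all; first exact: measure0.
  move=> x _; apply/cvg_EFin; first exact: nearW.
  by apply: cvgM; [exact: cvg_cst|exact: g_g].
- exact: ig.
- apply: ae_all; first exact: measure0.
  move=> x n _; rewrite gee0_abs ?lee_fin ?mulr_ge0//.
  by rewrite mulrC ler_wpM2r.
by [].
Qed.

(** The substitution [y = s u + a] moves the deviation from the Gaussian into the argument of [k].
    The weight is then a fixed integrable function, so limits in [s] can be taken under the
    integral, including [s] tending to 0. *)
Lemma conv_normal_avg (k : R -> R) (C a s x : R) : continuous k -> (forall x, 0 <= k x) ->
  (forall x, k x <= C) -> 0 < s ->
  ((convolution (np a s) k x)%:E = \int[leb]_u (np 0%R 1%R u * k (x - a - s * u))%:E)%E.
Proof.
move=> ck k0 kC s0.
have mn : measurable_fun setT (np a s) by exact: measurable_normal_pdf.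
have n0 u : 0 <= np a s u by exact: normal_pdf_ge0.
rewrite (convE mn n0 (integral_normal_pdf a s) ck k0 kC).
have mk : measurable_fun setT k by exact: continuous_measurable_fun.
have mf : measurable_fun setT (fun y => np a s y * k (x - y)).
  by apply: measurable_funM => //; apply: (measurableT_comp mk); exact: measurable_funB.
rewrite (@ge0_integral_affine R s a (fun y => (np a s y * k (x - y))%:E)).
- rewrite gtr0_norm// -ge0_integralZl//.
  + apply: eq_integral => u _; rewrite -EFinM; congr _%:E.
    have sn : s != 0 by rewrite gt_eqF.
    rewrite mulrA -normal_pdf_scale// addrK [s * u]mulrC mulfK// [s * _]mulrC divfK//.
    by congr (_ * k _); ring.
  + apply/measurable_EFinP; apply: (measurableT_comp mf).
    by apply: measurable_funD => //; exact: measurable_funM.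
  + by move=> u _; rewrite lee_fin mulr_ge0.
  + by rewrite lee_fin ltW.
- by rewrite gt_eqF.
- exact/measurable_EFinP.
- by move=> u; rewrite lee_fin mulr_ge0.
Qed.

(** The limit [t0] may be 0, which covers the convergence of Gaussians to a Dirac mass; this is why
    the limit is given as an average and not as a convolution. *)
Lemma cvg_conv_normal (k : R -> R) (C a : R) (t : nat -> R) (t0 L x : R) :
  continuous k -> (forall x, 0 <= k x) -> (forall x, k x <= C) ->
  (forall n, 0 < t n) -> t @ \oo --> t0 ->
  (\int[leb]_u (np 0%R 1%R u * k (x - a - t0 * u))%:E = L%:E)%E ->
  convolution (np a (t n)) k x @[n --> \oo] --> L.
Proof.
move=> ck k0 kC tp tt0 HL.
have mk : measurable_fun setT k by exact: continuous_measurable_fun.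
have mks (c : R) : measurable_fun setT (fun u : R => k (x - a - c * u)).
  by apply: (measurableT_comp mk); apply: measurable_funB => //; exact: measurable_funM.
have n0 u : 0 <= np 0 1 u by exact: normal_pdf_ge0.
have := @cvg_integral_density (np 0 1) (fun n u => k (x - a - t n * u))
  (fun u => k (x - a - t0 * u)) 1 C (measurable_normal_pdf _ _) n0
  (integral_normal_pdf _ _) (fun n => mks (t n)) (mks t0)
  (fun n u => k0 _) (fun n u => kC _).
rewrite HL => H.
have {}H : (\int[leb]_u (np 0%R 1%R u * k (x - a - t n * u))%:E)%E @[n --> \oo] --> L%:E.
  apply: H => u; apply: (@continuous_cvg _ _ _ _ _ _ k); first exact: ck.
  by apply: cvgB; [exact: cvg_cst|apply: cvgM => //; exact: cvg_cst].
apply: cvg_fin_of_EFin H => n.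
by rewrite -(conv_normal_avg a x ck k0 kC (tp n)).
Qed.

Lemma conv_le (f k : R -> R) (m C x : R) : measurable_fun setT f ->
  (forall x, 0 <= f x) -> (\int[leb]_x (f x)%:E = m%:E)%E ->
  continuous k -> (forall x, 0 <= k x) -> (forall x, k x <= C) ->
  convolution f k x <= m * C.
Proof.
move=> mf f0 intf ck k0 kC; rewrite -lee_fin (convE mf f0 intf ck k0 kC) EFinM -intf.
have mk : measurable_fun setT k by exact: continuous_measurable_fun.
rewrite -ge0_integralZr//.
- apply: ge0_le_integral; first exact: measurableT.
  + by move=> y _; rewrite lee_fin mulr_ge0.
  + apply/measurable_EFinP; apply: measurable_funM => //.
    by apply: (measurableT_comp mk); exact: measurable_funB.
  + by apply/measurable_EFinP; apply: measurable_funM.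
  + by move=> y _; rewrite -EFinM lee_fin ler_wpM2l.
- exact/measurable_EFinP.
- by move=> y _; rewrite lee_fin.
- by rewrite lee_fin (le_trans (k0 0)).
Qed.

Lemma convA (f h k : R -> R) (x m1 m2 C1 C2 : R) :
  measurable_fun setT f -> (forall x, 0 <= f x) -> (\int[leb]_x (f x)%:E = m1%:E)%E ->
  continuous h -> (forall x, 0 <= h x) -> (forall x, h x <= C1) ->
  (\int[leb]_x (h x)%:E = m2%:E)%E ->
  continuous k -> (forall x, 0 <= k x) -> (forall x, k x <= C2) ->
  ((convolution (convolution f h) k x)%:E =
   \int[leb]_u (f u * convolution h k (x - u))%:E)%E.
Proof.
move=> mf f0 intf ch h0 hC inth ck k0 kC.
have mh : measurable_fun setT h by exact: continuous_measurable_fun.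
have mk : measurable_fun setT k by exact: continuous_measurable_fun.
have mc : measurable_fun setT (convolution f h).
  by apply: continuous_measurable_fun; exact: (continuous_conv mf f0 intf ch h0 hC).
have c0 y : 0 <= convolution f h y by exact: conv_ge0.
have ic := integral_conv mf f0 intf ch h0 hC.
rewrite inth -EFinM in ic.
rewrite (convE mc c0 ic ck k0 kC).
pose F (z : R * R) := ((f z.2)%:E * (h (z.1 - z.2) * k (x - z.1))%:E)%E.
have mF : measurable_fun setT F.
  apply: emeasurable_funM; apply/measurable_EFinP; first exact: measurableT_comp.
  apply: measurable_funM.
    by apply: (measurableT_comp mh); exact: measurable_funB.
  by apply: (measurableT_comp mk); exact: measurable_funB.
have F0 z : (0 <= F z)%E by rewrite mule_ge0// lee_fin// mulr_ge0.
transitivity (\int[leb]_y \int[leb]_u F (y, u))%E.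
  apply: eq_integral => y _; rewrite EFinM (convE mf f0 intf ch h0 hC) -ge0_integralZr//.
  - by apply: eq_integral => u _; rewrite /F/= -!EFinM mulrA.
  - apply/measurable_EFinP; apply: measurable_funM => //.
    by apply: (measurableT_comp mh); exact: measurable_funB.
  - by move=> u _; rewrite lee_fin mulr_ge0.
  - by rewrite lee_fin.
rewrite -(tonelli1 mF F0) (tonelli2 mF F0); apply: eq_integral => u _.
have mhk : measurable_fun setT (fun y : R => h (y - u) * k (x - y)).
  apply: measurable_funM.
    by apply: (measurableT_comp mh); exact: measurable_funB.
  by apply: (measurableT_comp mk); exact: measurable_funB.
rewrite /F/= ge0_integralZl//.
- rewrite EFinM (convE mh h0 inth ck k0 kC); congr (_ * _)%E.
  rewrite (@ge0_integral_affine R 1 u (fun y => (h (y - u) * k (x - y))%:E)) ?oner_eq0//.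
  + rewrite normr1 mul1e; apply: eq_integral => y _.
    by congr ((h _ * k _)%:E); ring.
  + exact/measurable_EFinP.
  + by move=> y; rewrite lee_fin mulr_ge0.
- exact/measurable_EFinP.
- by move=> y _; rewrite lee_fin mulr_ge0.
- by rewrite lee_fin.
Qed.

Lemma conv_conv_normal (f : R -> R) (s t x : R) :
  measurable_fun setT f -> (forall x, 0 <= f x) ->
  (\int[leb]_x (f x)%:E = 1)%E -> 0 < s -> 0 < t ->
  convolution (convolution f (np 0 s)) (np 0 t) x =
  convolution f (np 0 (Num.sqrt (s ^+ 2 + t ^+ 2))) x.
Proof.
move=> mf f0 intf s0 t0; set r := Num.sqrt _.
have r0 : 0 < r by rewrite sqrtr_gt0 addr_gt0// exprn_gt0.
have n0 (u y : R) : 0 <= np 0 u y by exact: normal_pdf_ge0.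
have ub (u y : R) : 0 < u -> np 0 u y <= normal_peak u.
  by move=> u0; rewrite normal_pdf_ub// gt_eqF.
have cn (u : R) : 0 < u -> continuous (np 0 u).
  by move=> u0; apply: continuous_normal_pdf; rewrite gt_eqF.
apply: EFin_inj; rewrite (convA x mf f0 intf (cn s s0) (n0 s) (fun y => ub s y s0)
  (integral_normal_pdf _ _) (cn t t0) (n0 t) (fun y => ub t y t0)).
rewrite (convE mf f0 intf (cn r r0) (n0 r) (fun y => ub r y r0)).
by apply: eq_integral => u _; rewrite conv_normal// addr0.
Qed.

Lemma cvg_conv_conv_normal (f k : R -> R) (t : nat -> R) (C x : R) :
  measurable_fun setT f -> (forall x, 0 <= f x) -> (\int[leb]_x (f x)%:E = 1)%E ->
  continuous k -> (forall x, 0 <= k x) -> (forall x, k x <= C) ->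
  (forall n, 0 < t n) -> t @ \oo --> 0 ->
  convolution (convolution f (np 0 (t n))) k x @[n --> \oo] --> convolution f k x.
Proof.
move=> mf f0 intf ck k0 kC t0 tt0.
have mk : measurable_fun setT k by exact: continuous_measurable_fun.
have mn (n : nat) : measurable_fun setT (np 0 (t n)) by exact: measurable_normal_pdf.
have n0 (n : nat) u : 0 <= np 0 (t n) u by exact: normal_pdf_ge0.
have in1 (n : nat) := integral_normal_pdf 0 (t n).
have mg (n : nat) : measurable_fun setT (fun u : R => convolution (np 0 (t n)) k (x - u)).
  have H : measurable_fun setT (convolution (np 0 (t n)) k).
    apply: continuous_measurable_fun.
    exact: (continuous_conv (mn n) (n0 n) (in1 n) ck k0 kC).
  by apply: (measurableT_comp H); exact: measurable_funB.
have g0 (n : nat) u : 0 <= convolution (np 0 (t n)) k (x - u) by exact: conv_ge0.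
have gC (n : nat) u : convolution (np 0 (t n)) k (x - u) <= C.
  by have := conv_le (x - u) (mn n) (n0 n) (in1 n) ck k0 kC; rewrite mul1r.
have mkx : measurable_fun setT (fun u : R => k (x - u)).
  by apply: (measurableT_comp mk); exact: measurable_funB.
have gk u : convolution (np 0 (t n)) k (x - u) @[n --> \oo] --> k (x - u).
  apply: (cvg_conv_normal ck k0 kC t0 tt0).
  transitivity (\int[leb]_v (np 0%R 1%R v * k (x - u))%:E)%E.
    by apply: eq_integral => v _; rewrite mul0r !subr0.
  under eq_integral => v _ do rewrite EFinM.
  rewrite ge0_integralZr//.
  - by rewrite integral_normal_pdf mul1e.
  - by apply/measurable_EFinP; exact: measurable_normal_pdf.
  - by move=> v _; rewrite lee_fin normal_pdf_ge0.
  - by rewrite lee_fin.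
have := @cvg_integral_density f _ _ 1 C mf f0 intf mg mkx g0 gC gk.
rewrite -(convE mf f0 intf ck k0 kC x); apply: cvg_fin_of_EFin => n.
have tn : t n != 0 by rewrite gt_eqF.
have cn : continuous (np 0 (t n)) by exact: continuous_normal_pdf.
have nC u : np 0 (t n) u <= normal_peak (t n) by exact: normal_pdf_ub.
by rewrite -(convA x mf f0 intf cn (n0 n) nC (in1 n) ck k0 kC).
Qed.

(* [f * N(0, s^2) = N(a, t^2 - 1 + s^2)] for [0 < s < 1], and [s] tends to [0];
   the Dirac limit [t = 1] is excluded because [f] is a density. *)
Lemma deconvolution (f : R -> R) (a t : R) :
  measurable_fun setT f -> (forall x, 0 <= f x) -> (\int[leb]_x (f x)%:E = 1)%E ->
  0 < t -> convolution f (np 0 1) =1 np a t ->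
  (forall s, 0 < s < 1 -> exists b u, 0 < u /\ convolution f (np 0 s) =1 np b u) ->
  0 < t ^+ 2 - 1 /\ {ae leb, forall x, f x = np a (Num.sqrt (t ^+ 2 - 1)) x}.
Proof.
move=> mf f0 intf t0 f1 fs.
have fsE s : 0 < s < 1 -> 0 < t ^+ 2 - 1 + s ^+ 2 /\
    convolution f (np 0 s) =1 np a (Num.sqrt (t ^+ 2 - 1 + s ^+ 2)).
  move=> /andP[s0 s1]; have [|b [u [u0 fsu]]] := fs s; first by rewrite s0.
  have w0 : 0 < 1 - s ^+ 2 by rewrite subr_gt0 expr_lt1// ltW.
  (* Smoothing further by [w] with [s^2 + w^2 = 1] gives, by the semigroup law, the known
     convolution with deviation 1. Comparing the two Gaussians gives [b = a] and
     [u^2 + w^2 = t^2]. *)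
  pose w := Num.sqrt (1 - s ^+ 2).
  have wp : 0 < w by rewrite sqrtr_gt0.
  have w2 : w ^+ 2 = 1 - s ^+ 2 by rewrite sqr_sqrtr// ltW.
  have uw : 0 < u ^+ 2 + w ^+ 2 by rewrite addr_gt0// exprn_gt0.
  have H x : np (b + 0) (Num.sqrt (u ^+ 2 + w ^+ 2)) x = np a t x.
    rewrite -conv_normal// -f1.
    have -> : 1 = Num.sqrt (s ^+ 2 + w ^+ 2) by rewrite w2 addrC subrK sqrtr1.
    rewrite -(conv_conv_normal x mf f0 intf s0 wp); congr (convolution _ _ x).
    by apply/funext => y; rewrite fsu.
  have [||ba ut] := normal_pdf_inj _ _ H; rewrite ?sqrtr_gt0//.
  have u2 : u ^+ 2 = t ^+ 2 - 1 + s ^+ 2.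
    by rewrite -ut sqr_sqrtr ?ltW// w2; ring.
  rewrite -u2 exprn_gt0// sqrtr_sqr gtr0_norm//; split => // x.
  by rewrite fsu -ba addr0.
set v := t ^+ 2 - 1 in fsE *.
(* Shifted by one because [harmonic 0] is 1, while [fsE] needs deviations strictly below 1. *)
pose s (n : nat) : R := harmonic n.+1.
have s01 n : 0 < s n < 1.
  rewrite harmonic_gt0/= /s/= /harmonic invf_lt1// ?ltr0n//.
  by rewrite ltr1n.
have s0 n : 0 < s n by case/andP: (s01 n).
have scvg : s @ \oo --> (0 : R).
  by have := @cvg_harmonic R; rewrite -(cvg_shiftS (@harmonic R)).
have v0 : 0 <= v.
  rewrite leNgt; apply/negP => v0.
  (* If [v < 0], this [e] lies in the range of [fsE] and satisfies [e^2 <= e <= - v], which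
     contradicts [0 < v + e^2]. *)
  pose e := Num.min (1 / 2) (- v).
  have e0 : 0 < e by rewrite lt_min oppr_gt0 v0 andbT; lra.
  have e1 : e <= 1 / 2 by rewrite ge_min lexx.
  have ev : e <= - v by rewrite ge_min lexx orbT.
  have [|+ _] := fsE e; first by apply/andP; split; lra.
  by have : e ^+ 2 <= e; [rewrite expr2 ger_pMr//; lra | lra].
have vs0 n : 0 < v + s n ^+ 2 by rewrite ltr_wpDl// exprn_gt0.
pose q n := Num.sqrt (v + s n ^+ 2).
have q0 n : 0 < q n by rewrite sqrtr_gt0.
have qcvg : q @ \oo --> Num.sqrt v.
  apply: (@continuous_cvg _ _ _ _ _ _ (@Num.sqrt R)); first exact: sqrt_continuous.
  rewrite -[X in _ --> X]addr0; apply: cvgD; first exact: cvg_cst.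
  rewrite -[X in _ --> X](mulr0 0); under eq_cvg do rewrite expr2.
  exact: cvgM.
(* Tested against [k], the density [f] acts as a Gaussian of variance [v], or as the Dirac mass at
   [a] if [v = 0]: both sides are limits of the same sequence of doubly smoothed values. *)
have key (k : R -> R) (C x L : R) : continuous k -> (forall x, 0 <= k x) -> (forall x, k x <= C) ->
    (\int[leb]_u (np 0%R 1%R u * k (x - a - Num.sqrt v * u))%:E = L%:E)%E ->
    convolution f k x = L.
  move=> ck k0 kC HL.
  have H1 := @cvg_conv_conv_normal f k s C x mf f0 intf ck k0 kC s0 scvg.
  have H2 := cvg_conv_normal ck k0 kC q0 qcvg HL.
  apply: (cvg_unique _ H1 _) => //.
  apply: cvg_trans H2; apply: near_eq_cvg; apply: nearW => n /=.
  congr (convolution _ _ x); apply/funext => y.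
  by have [_ ->] := fsE _ (s01 n).
have [c c0 intc] := integral_tent R.
have h0 n : 0 < @harmonic R n by exact: harmonic_gt0.
have ck n : continuous (tentk c (harmonic n)) by exact: continuous_tentk.
have k0 n := tentk_ge0 c0 (h0 n).
have kC n := tentk_le c0 (h0 n).
have fcvg := cvg_conv_tentk c0 intc mf f0 intf.
(* In the Dirac case the tent averages of [f] at [x] equal the kernel at [x - a], which is
   eventually 0 for [x] other than [a]; then [f] vanishes almost everywhere against its mass 1. *)
have [vE|vn] := eqVneq v 0.
  exfalso; have : {ae leb, forall x, x != a}.
    exists [set a]; split => //; first exact: lebesgue_measure_set1.
    by move=> x /=; case: eqVneq.
  move=> aea; have aef0 : {ae leb, forall x, f x = 0}.
    apply: ae_imply (ae_conj fcvg aea) => x [fx xa].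
    apply: (cvg_unique _ fx _) => //; apply: cvg_near_cst.
    have xa0 : 0 < `|x - a| by rewrite normr_gt0 subr_eq0.
    near=> n.
    have -> : convolution f (tentk c (harmonic n)) x = tentk c (harmonic n) (x - a).
      apply: (key _ _ x _ (ck n) (k0 n) (kC n)).
      transitivity (\int[leb]_v (np 0%R 1%R v * tentk c (harmonic n) (x - a))%:E)%E.
        by apply: eq_integral => u _; rewrite vE sqrtr0 mul0r !subr0.
      under eq_integral => u _ do rewrite EFinM.
      rewrite ge0_integralZr//.
      - by rewrite integral_normal_pdf mul1e.
      - by apply/measurable_EFinP; exact: measurable_normal_pdf.
      - by move=> u _; rewrite lee_fin normal_pdf_ge0.
      - by rewrite lee_fin.
    apply: (tentk_eq0 c (h0 n)); apply: ltW; near: n.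
    by apply: (cvgr_lt 0); [exact: cvg_harmonic|].
  suff : (\int[leb]_x (f x)%:E = 0)%E by rewrite intf => /eqP; rewrite eqe oner_eq0.
  have m0 : measurable_fun setT (fun _ : R => 0 : R) by exact: measurable_cst.
  by rewrite (ae_integral_eq (m := leb) measurableT mf m0 aef0) integral0.
have vp : 0 < v by rewrite lt_neqAle eq_sym vn.
have sv : 0 < Num.sqrt v by rewrite sqrtr_gt0.
split => //.
have mn : measurable_fun setT (np a (Num.sqrt v)) by exact: measurable_normal_pdf.
have n0 u : 0 <= np a (Num.sqrt v) u by exact: normal_pdf_ge0.
have ncvg := cvg_conv_tentk c0 intc mn n0 (integral_normal_pdf _ _).
apply: ae_imply (ae_conj fcvg ncvg) => x [fx nx].
apply: (cvg_unique _ fx _) => //.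
apply: cvg_trans nx; apply: near_eq_cvg; apply: nearW => n /=.
apply/esym; apply: (key _ _ x _ (ck n) (k0 n) (kC n)).
by rewrite -(conv_normal_avg a x (ck n) (k0 n) (kC n) sv).
Unshelve. all: by end_near. Qed.

(** Smoothing the three densities with [s = 1] produces one common [t], so the deconvolved Gaussians
    share the variance [t^2 - 1]. *)
Lemma BLint_eq1 (D : BLdatum R) (f1 f2 f3 : R -> R) :
  measurable_fun setT f1 -> measurable_fun setT f2 -> measurable_fun setT f3 ->
  (forall x, 0 <= f1 x) -> (forall x, 0 <= f2 x) -> (forall x, 0 <= f3 x) ->
  (\int[leb]_x (f1 x)%:E = 1)%E -> (\int[leb]_x (f2 x)%:E = 1)%E ->
  (\int[leb]_x (f3 x)%:E = 1)%E -> BLint D f1 f2 f3 = 1%E ->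
  exists a1 a2 a3 s, [/\ 0 < s, {ae leb, forall x, f1 x = np a1 s x},
    {ae leb, forall x, f2 x = np a2 s x} & {ae leb, forall x, f3 x = np a3 s x}].
Proof.
move=> m1 m2 m3 f1_0 f2_0 f3_0 i1 i2 i3 BL1.
have H s (s0 : 0 < s) := BLextremal_convolution s0 m1 m2 m3 f1_0 f2_0 f3_0 i1 i2 i3 BL1.
have [a1 [a2 [a3 [t [t0 e1 e2 e3]]]]] := H 1 ltr01.
have [||||||s0 E1] := @deconvolution f1 a1 t => //.
  by move=> s /andP[s0 _]; have [b [_ [_ [u [u0 ? _ _]]]]] := H s s0; exists b, u.
have [||||||_ E2] := @deconvolution f2 a2 t => //.
  by move=> s /andP[s0' _]; have [_ [b [_ [u [u0 _ ? _]]]]] := H s s0'; exists b, u.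
have [||||||_ E3] := @deconvolution f3 a3 t => //.
  by move=> s /andP[s0' _]; have [_ [_ [b [u [u0 _ _ ?]]]]] := H s s0'; exists b, u.
by exists a1, a2, a3, (Num.sqrt (t ^+ 2 - 1)); rewrite sqrtr_gt0.
Qed.

End deconvolution.

(** * Densities of random vectors and entropy *)

Section density_expectation.
Context d (T : measurableType d) (R : realType) (P : probability T R).
Context d' (U : measurableType d') (m : {measure set U -> \bar R}).
Variables (Z : T -> U) (mZ : measurable_fun setT Z).
Implicit Types (f : U -> R).

Lemma has_density_integral f : has_density P m Z f -> (\int[m]_u (f u)%:E = 1)%E.
Proof. by move=> [_ _ fE]; rewrite -fE// /pushforward preimage_setT probability_setT. Qed.

Lemma has_density_expectation f (g : U -> R) : has_density P m Z f ->
  measurable_fun setT g -> (forall u, 0 <= g u) ->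
  (\int[P]_t (g (Z t))%:E = \int[m]_u (g u * f u)%:E)%E.
Proof.
move=> [mf f0 fE] mg g0; have [n nE] := pushforward_measure P mZ.
have mgE : measurable_fun setT (fun u => (g u)%:E) by exact/measurable_EFinP.
transitivity (\int[n]_u (g u)%:E)%E.
  rewrite nE ge0_integral_pushforward//.
  by move=> u _; rewrite lee_fin.
rewrite (ge0_integral_density mf f0 (m := m) (n := n))//.
by move=> A mA; rewrite nE fE.
Qed.

Lemma has_density_integrable f : has_density P m Z f -> m.-integrable setT (EFin \o f).
Proof.
move=> fZ; have [mf f0 _] := fZ; apply/integrableP; split; first exact/measurable_EFinP.
under eq_integral => x _ do rewrite /= ger0_norm//.
by rewrite (has_density_integral fZ) ltry.
Qed.

Lemma has_density_unique f1 f2 : has_density P m Z f1 -> has_density P m Z f2 ->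
  {ae m, forall u, f1 u = f2 u}.
Proof.
move=> fZ1 fZ2; have [_ _ fE1] := fZ1; have [mf2 _ fE2] := fZ2.
have := integral_ae_eq measurableT (has_density_integrable fZ1) (g := EFin \o f2).
move=> H; have {}H := H _ _; have : ae_eq m setT (EFin \o f1) (EFin \o f2).
  by apply: H => [|A _ mA]; [exact/measurable_EFinP|rewrite -fE1// fE2].
by apply: ae_imply => u /(_ I) [].
Qed.

Lemma has_density_ae f (Q : U -> Prop) : has_density P m Z f ->
  {ae m, forall u, Q u} -> {ae P, forall t, Q (Z t)}.
Proof.
move=> [mf f0 fE] [N [mN N0 NQ]]; exists (Z @^-1` N); split.
- by rewrite -[_ @^-1` _]setTI; exact: mZ.
- have := fE _ mN; rewrite /pushforward => ->.
  apply: null_set_integral => //; apply/measurable_EFinP; exact: measurable_funTS.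
- by move=> t nQ; exact: NQ.
Qed.

Lemma has_density_gt0 f : has_density P m Z f -> {ae P, forall t, 0 < f (Z t)}.
Proof.
move=> [mf f0 fE]; exists (Z @^-1` [set u | f u = 0]).
have m0 : measurable [set u | f u = 0].
  by rewrite -[X in measurable X]setTI; exact: (mf measurableT [set 0]).
split.
- by rewrite -[_ @^-1` _]setTI; exact: mZ.
- have := fE _ m0; rewrite /pushforward => ->.
  by apply: integral0_eq => u ->.
- move=> t /= /negP; rewrite -leNgt => ft; apply/eqP.
  by rewrite eq_le ft f0.
Qed.

(** The expectation formula is available for nonnegative functions only; [ln] is therefore split
    into positive and negative parts, and multiplication by [f >= 0] commutes with that
    splitting. *)
Lemma has_density_expectation_ln f : has_density P m Z f ->
  m.-integrable setT (EFin \o flogf f) ->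
  P.-integrable setT (fun t => (ln (f (Z t)))%:E) /\
  (\int[P]_t (ln (f (Z t)))%:E = \int[m]_u (flogf f u)%:E)%E.
Proof.
move=> fZ ifl; have [mf f0 fE] := fZ.
have mlf : measurable_fun setT (fun u => ln (f u)).
  exact: (measurableT_comp (@measurable_ln R) mf).
have mlfE : measurable_fun setT (EFin \o (fun u => ln (f u))) by exact/measurable_EFinP.
have E (g : U -> R) := @has_density_expectation f g fZ.
split.
  apply/integrableP; split.
    by apply/measurable_EFinP; exact: (measurableT_comp mlf).
  under eq_integral => t _ do rewrite abse_EFin.
  rewrite (E (fun u => `|ln (f u)|))//; last exact: (measurableT_comp (@normr_measurable R setT) mlf).
  case/integrableP : ifl => _; congr (_ < _)%E; apply: eq_integral => u _.
  by rewrite /flogf/= normrM (ger0_norm (f0 _)) mulrC.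
rewrite (integralE P setT (fun t => (ln (f (Z t)))%:E)).
rewrite (integralE m setT (fun u => (flogf f u)%:E)); congr (_ - _)%E.
- transitivity (\int[P]_t (Num.max (ln (f (Z t))) 0)%:E)%E.
    by apply: eq_integral => t _; rewrite funeposE -EFin_max.
  rewrite (E (fun u => Num.max (ln (f u)) 0)).
  + apply: eq_integral => u _; rewrite funeposE/= -EFin_max /flogf; congr _%:E.
    by rewrite maxr_pMl// mul0r mulrC.
  + exact: measurable_maxr.
  + by move=> u; rewrite le_max lexx orbT.
- transitivity (\int[P]_t (Num.max (- ln (f (Z t))) 0)%:E)%E.
    by apply: eq_integral => t _; rewrite funenegE -EFinN -EFin_max.
  rewrite (E (fun u => Num.max (- ln (f u)) 0)).
  + apply: eq_integral => u _; rewrite funenegE/= -EFin_max /flogf; congr _%:E.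
    by rewrite maxr_pMl// mul0r mulNr mulrC.
  + by apply: measurable_maxr => //; exact: measurableT_comp.
  + by move=> u; rewrite le_max lexx orbT.
Qed.

(** [entropy] integrates a chosen density, while finiteness is known for some density. Almost
    everywhere uniqueness carries integrability over, and the entropy becomes an expectation of [ln]
    of the density. *)
Lemma finite_entropyP : finite_entropy P m Z ->
  exists f, [/\ has_density P m Z f, P.-integrable setT (fun t => (ln (f (Z t)))%:E) &
    entropy P m Z = \int[P]_t ln (f (Z t))].
Proof.
move=> [f1 f1Z i1]; rewrite /entropy.
set f := xget _ _; have fZ : has_density P m Z f by exact: (@xgetPex _ _ _ (ex_intro _ f1 f1Z)).
exists f; have [mf f0 _] := fZ; have [mf1 _ _] := f1Z.
have mfl (g : U -> R) : measurable_fun setT g -> measurable_fun setT (flogf g).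
  move=> mg; apply: measurable_funM => //.
  exact: (measurableT_comp (@measurable_ln R) mg).
have ifl : m.-integrable setT (EFin \o flogf f).
  apply/integrableP; split; first by apply/measurable_EFinP; exact: mfl.
  case/integrableP : i1 => _; congr (_ < _)%E.
  apply: (ae_integral_eq (f := fun u => `|flogf f1 u|) (g := fun u => `|flogf f u|)) => //.
  - apply: (measurableT_comp (@normr_measurable R setT)); exact: mfl.
  - apply: (measurableT_comp (@normr_measurable R setT)); exact: mfl.
  - by apply: ae_imply (has_density_unique f1Z fZ) => u; rewrite /flogf => ->.
have [il El] := has_density_expectation_ln fZ ifl.
by split => //; rewrite /Rintegral El.
Qed.

End density_expectation.

Section density_on_sets.
Context d (T : measurableType d) (R : realType).

Lemma integral_density_set (m n : {measure set T -> \bar R}) (w f : T -> R) (A : set T) :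
  measurable_fun setT w -> (forall x, 0 <= w x) ->
  (forall A, measurable A -> n A = \int[m]_(x in A) (w x)%:E)%E ->
  measurable_fun setT f -> (forall x, 0 <= f x) -> measurable A ->
  (\int[n]_(x in A) (f x)%:E = \int[m]_(x in A) (f x * w x)%:E)%E.
Proof.
move=> mw w0 nE mf f0 mA; rewrite integral_mkcond [RHS]integral_mkcond.
rewrite (ge0_integral_density mw w0 nE).
- by apply: eq_integral => x _; rewrite !patchE; case: ifPn => // _; rewrite mul0e.
- apply/(measurable_restrictT _ _).1 => //; apply: measurable_funTS.
  exact/measurable_EFinP.
- by move=> x; rewrite patchE; case: ifPn => // _; rewrite lee_fin.
Qed.

End density_on_sets.

Section product_density.
Context (R : realType).
Notation leb := (@lebesgue_measure R).
Variables (mu nu : {sigma_finite_measure set (measurableTypeR R) -> \bar R}) (w v : R -> R).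
Hypotheses (mw : measurable_fun setT w) (w_ge0 : forall x, 0 <= w x)
  (muE : forall A, measurable A -> (mu A = \int[leb]_(x in A) (w x)%:E)%E).
Hypotheses (mv : measurable_fun setT v) (v_ge0 : forall x, 0 <= v x)
  (nuE : forall A, measurable A -> (nu A = \int[leb]_(x in A) (v x)%:E)%E).

Lemma product_density (A : set (R * R)) : measurable A ->
  ((mu \x nu) A = \int[leb \x leb]_(z in A) (w z.1 * v z.2)%:E)%E.
Proof.
move=> mA; rewrite integral_mkcond.
pose F := (fun z : R * R => (w z.1 * v z.2)%:E) \_ A.
have mF : measurable_fun setT F.
  apply/(measurable_restrictT _ _).1 => //; apply: measurable_funTS.
  by apply/measurable_EFinP; apply: measurable_funM; exact: measurableT_comp.
have F0 z : (0 <= F z)%E.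
  by rewrite /F patchE; case: ifPn => // _; rewrite lee_fin mulr_ge0.
rewrite (tonelli1 mF F0).
have mx x : measurable (xsection A x : set (measurableTypeR R)).
  exact: measurable_xsection.
have IE x : (\int[leb]_y F (x, y) = nu (xsection A x) * (w x)%:E)%E.
  rewrite (nuE (mx x)) muleC -ge0_integralZl//.
  - rewrite [RHS]integral_mkcond; apply: eq_integral => y _.
    by rewrite /F !patchE -mem_xsection/= EFinM.
  - by apply/measurable_EFinP; exact: measurable_funTS.
  - by move=> y _; rewrite lee_fin.
  - by rewrite lee_fin.
under eq_integral => x _ do rewrite IE.
have ms : measurable_fun setT (fun x => nu (xsection A x)).
  exact: (@measurable_fun_xsection _ _ (measurableTypeR R) (measurableTypeR R) R nu A mA).
exact: (@ge0_integral_density _ (measurableTypeR R) R leb mu w mw w_ge0 muE _ ms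
  (fun x => measure_ge0 _ _)).
Qed.

End product_density.

Section reference_weight.
Context (R : realType).
Notation leb := (@lebesgue_measure R).

(** A strictly positive density makes the two measures have the same null sets. *)
Lemma ae_density_iff d (T : measurableType d) (m n : {measure set T -> \bar R})
    (w : T -> R) (Q : T -> Prop) :
  measurable_fun setT w -> (forall x, 0 < w x) ->
  (forall A, measurable A -> n A = \int[m]_(x in A) (w x)%:E)%E ->
  {ae n, forall x, Q x} <-> {ae m, forall x, Q x}.
Proof.
move=> mw w0 nE; split=> -[N [mN N0 NQ]]; exists N; split => //; last first.
  rewrite nE//; apply: null_set_integral => //.
  by apply/measurable_EFinP; exact: measurable_funTS.
have mwN : measurable_fun N (fun x => (w x)%:E).
  by apply/measurable_EFinP; exact: measurable_funTS.
move: N0; rewrite nE// => N0.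
have : (\int[m]_(x in N) `|(w x)%:E| = 0)%E.
  by rewrite -N0; apply: eq_integral => x _; rewrite gee0_abs// lee_fin ltW.
move/(ae_eq_integral_abs m mN mwN) => [B [mB B0 BN]].
apply: (subset_measure0 mN mB _ B0) => x Nx; apply: BN => /= /(_ Nx)[] /eqP.
by rewrite gt_eqF.
Qed.

Lemma reference_weight (mu : {sigma_finite_measure set (measurableTypeR R) -> \bar R}) :
  lebesgue_or_gaussian mu ->
  exists w : R -> R, [/\ measurable_fun setT w, forall x, 0 < w x,
    forall A, measurable A -> (mu A = \int[leb]_(x in A) (w x)%:E)%E &
    forall D z, BLprod D w w w z = w z.1 * w z.2].
Proof.
case=> ->.
  exists (fun _ => 1); split => //.
  - by move=> A mA; rewrite integral_cst// mul1e.
  - by move=> D z; rewrite /BLprod !powR1 !mulr1.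
exists (normal_pdf 0 1); split => //.
- exact: measurable_normal_pdf.
- by move=> x; exact: normal_pdf_gt0.
- move=> D z; have := BLprod_normal D 0 0 z ltr01.
  have -> : BLu2 D (0, 0) = 0 by rewrite /BLu2/= !mulr0 addr0.
  by have -> : BLu3 D (0, 0) = 0 by rewrite /BLu3/= !mulr0 addr0.
Qed.

Variables (mu : {sigma_finite_measure set (measurableTypeR R) -> \bar R}) (w : R -> R).
Hypotheses (mw : measurable_fun setT w) (w0 : forall x, 0 < w x)
  (muE : forall A, measurable A -> (mu A = \int[leb]_(x in A) (w x)%:E)%E).

Let w_ge0 x : 0 <= w x. Proof. exact: ltW. Qed.

Lemma weight_integral (h : R -> \bar R) : measurable_fun setT h ->
  (forall x, 0 <= h x)%E -> (\int[mu]_x h x = \int[leb]_x (h x * (w x)%:E))%E.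
Proof.
move=> mh h0.
exact: (@ge0_integral_density _ (measurableTypeR R) R leb mu w mw w_ge0 muE h mh h0).
Qed.

Lemma weight_ae (Q : R -> Prop) : {ae mu, forall x, Q x} <-> {ae leb, forall x, Q x}.
Proof. exact: (@ae_density_iff _ (measurableTypeR R) leb mu w Q mw w0 muE). Qed.

Lemma measurable_weight2 : measurable_fun setT (fun z : R * R => w z.1 * w z.2).
Proof. by apply: measurable_funM; exact: measurableT_comp. Qed.

End reference_weight.

Section ae_Rintegral.
Context d (T : measurableType d) (R : realType) (m : {measure set T -> \bar R}).

Lemma ae_ge0_Rintegral (N : T -> R) : m.-integrable setT (EFin \o N) ->
  {ae m, forall t, 0 <= N t} -> 0 <= \int[m]_t N t /\
  (\int[m]_t N t = 0 -> {ae m, forall t, N t = 0}).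
Proof.
move=> iN N0; have mNE : measurable_fun setT (EFin \o N) by exact: measurable_int iN.
have mN : measurable_fun setT N by exact/measurable_EFinP.
have mNn : measurable_fun setT (fun t => `|N t|).
  exact: (measurableT_comp (@normr_measurable R setT) mN).
have E : (\int[m]_t (N t)%:E = \int[m]_t `|(EFin \o N) t|)%E.
  apply: (ae_integral_eq (f := N) (g := fun t => `|N t|)) => //.
  by apply: ae_imply N0 => t /ger0_norm.
have Efin : \int[m]_t N t = fine (\int[m]_t (N t)%:E)%E by [].
split; first by rewrite Efin E fine_ge0// integral_ge0.
rewrite Efin => H0.
have : (\int[m]_t `|(EFin \o N) t| = 0)%E.
  rewrite -E -(fineK (x := (\int[m]_t (N t)%:E)%E)) ?H0//.
  exact: integrable_fin_num.
move/(ae_eq_integral_abs m measurableT mNE); apply: ae_imply => t /(_ I).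
by move=> -[].
Qed.

End ae_Rintegral.

Section lebesgue_densities.
Context (R : realType) d (T : measurableType d) (P : probability T R).
Notation leb := (@lebesgue_measure R).
Notation mR := (measurableTypeR R).

Definition pdf1 (X : T -> R) (F : R -> R) := @has_density _ _ T mR R P leb X F.
Definition pdf2 (Z : T -> R * R) (F : R * R -> R) :=
  @has_density _ _ T (mR * mR)%type R P (leb \x leb)%E Z F.

Section line.
Variables (X : T -> R) (mX : measurable_fun setT X).

Lemma pdf1_integral F : pdf1 X F -> (\int[leb]_x (F x)%:E = 1)%E.
Proof. exact: (@has_density_integral _ T R P _ mR leb X F). Qed.

Lemma pdf1_gt0 F : pdf1 X F -> {ae P, forall t, 0 < F (X t)}.
Proof. exact: (@has_density_gt0 _ T R P _ mR leb X mX F). Qed.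

Lemma pdf1_unique F1 F2 : pdf1 X F1 -> pdf1 X F2 -> {ae leb, forall x, F1 x = F2 x}.
Proof. exact: (@has_density_unique _ T R P _ mR leb X F1 F2). Qed.

End line.

Section plane.
Variables (Z : T -> R * R) (mZ : measurable_fun setT Z).

Lemma pdf2_expectation F (g : R * R -> R) : pdf2 Z F -> measurable_fun setT g ->
  (forall z, 0 <= g z) ->
  (\int[P]_t (g (Z t))%:E = \int[leb \x leb]_z (g z * F z)%:E)%E.
Proof. exact: (@has_density_expectation _ T R P _ (mR * mR)%type (leb \x leb)%E Z mZ F g). Qed.

Lemma pdf2_gt0 F : pdf2 Z F -> {ae P, forall t, 0 < F (Z t)}.
Proof. exact: (@has_density_gt0 _ T R P _ (mR * mR)%type (leb \x leb)%E Z mZ F). Qed.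

Lemma pdf2_unique F1 F2 : pdf2 Z F1 -> pdf2 Z F2 ->
  {ae (leb \x leb)%E, forall z, F1 z = F2 z}.
Proof. exact: (@has_density_unique _ T R P _ (mR * mR)%type (leb \x leb)%E Z F1 F2). Qed.

Lemma pdf2_ae F (Q : R * R -> Prop) : pdf2 Z F ->
  {ae (leb \x leb)%E, forall z, Q z} -> {ae P, forall t, Q (Z t)}.
Proof. exact: (@has_density_ae _ T R P _ (mR * mR)%type (leb \x leb)%E Z mZ F Q). Qed.

End plane.

End lebesgue_densities.

(** * The entropy deficit as a relative entropy *)

Section relative_entropy.
Context (R : realType) (D : BLdatum R) d (T : measurableType d) (P : probability T R).
Notation leb := (@lebesgue_measure R).
Notation d1 := (bd1 D). Notation d2 := (bd2 D). Notation d3 := (bd3 D).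
Variables (X Y : T -> R) (mX : measurable_fun setT X) (mY : measurable_fun setT Y).
Let Z t := (X t, Y t).
Let X2 t := BLu2 D (Z t).
Let X3 t := BLu3 D (Z t).

Lemma measurable_rv2 : measurable_fun setT Z.
Proof. exact: measurable_fun_pair. Qed.

Lemma measurable_rvu2 : measurable_fun setT X2.
Proof. by apply: (measurableT_comp (measurable_lin2 _ _)); exact: measurable_rv2. Qed.

Lemma measurable_rvu3 : measurable_fun setT X3.
Proof. by apply: (measurableT_comp (measurable_lin2 _ _)); exact: measurable_rv2. Qed.

Variables (w f1 f2 f3 : R -> R) (f : R * R -> R).
Hypotheses (mw : measurable_fun setT w) (w0 : forall x, 0 < w x)
  (wD : forall z, BLprod D w w w z = w z.1 * w z.2).
Hypotheses (m1 : measurable_fun setT f1) (m2 : measurable_fun setT f2)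
  (m3 : measurable_fun setT f3) (mf : measurable_fun setT f).
Hypotheses (f1_0 : forall x, 0 <= f1 x) (f2_0 : forall x, 0 <= f2 x)
  (f3_0 : forall x, 0 <= f3 x) (f_0 : forall z, 0 <= f z).
Let F1 x := f1 x * w x.
Let F2 x := f2 x * w x.
Let F3 x := f3 x * w x.
Let w2 (z : R * R) := w z.1 * w z.2.
Let F z := f z * w2 z.
Hypotheses (h1 : pdf1 P X F1) (h2 : pdf1 P X2 F2) (h3 : pdf1 P X3 F3) (h : pdf2 P Z F).
Hypotheses (i1 : P.-integrable setT (fun t => (ln (f1 (X t)))%:E))
  (i2 : P.-integrable setT (fun t => (ln (f2 (X2 t)))%:E))
  (i3 : P.-integrable setT (fun t => (ln (f3 (X3 t)))%:E))
  (i : P.-integrable setT (fun t => (ln (f (Z t)))%:E)).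

Let G := BLprod D f1 f2 f3.
Let w2_gt0 z : 0 < w2 z. Proof. exact: mulr_gt0. Qed.
Let G0 z : 0 <= G z. Proof. exact: BLprod_ge0. Qed.
Let mG : measurable_fun setT G. Proof. exact: measurable_BLprod. Qed.
Let mw2 : measurable_fun setT w2. Proof. exact: measurable_weight2. Qed.
Let w_ge0 x : 0 <= w x. Proof. exact: ltW. Qed.

Let GE z : BLprod D F1 F2 F3 z =
  G z * w2 z.
Proof. by rewrite /F1 /F2 /F3 BLprodM// wD. Qed.

Definition entropy_deficit := \int[P]_t ln (f (Z t)) - (d1 ^+ 2 * \int[P]_t ln (f1 (X t)) +
  d2 ^+ 2 * \int[P]_t ln (f2 (X2 t)) + d3 ^+ 2 * \int[P]_t ln (f3 (X3 t))).

Let L t := ln (f (Z t)) - (d1 ^+ 2 * ln (f1 (X t)) +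
  d2 ^+ 2 * ln (f2 (X2 t)) + d3 ^+ 2 * ln (f3 (X3 t))).

Let iZ (c : R) (g : T -> R) : P.-integrable setT (fun t => (g t)%:E) ->
  P.-integrable setT (EFin \o (fun t => c * g t)).
Proof. by move=> ig; have := integrableZl measurableT c ig; apply: eq_integrable. Qed.

Let iD (g1 g2 : T -> R) : P.-integrable setT (EFin \o g1) ->
  P.-integrable setT (EFin \o g2) -> P.-integrable setT (EFin \o (fun t => g1 t + g2 t)).
Proof. by move=> ig1 ig2; have := integrableD measurableT ig1 ig2; apply: eq_integrable. Qed.

Let iB (g1 g2 : T -> R) : P.-integrable setT (EFin \o g1) ->
  P.-integrable setT (EFin \o g2) -> P.-integrable setT (EFin \o (fun t => g1 t - g2 t)).
Proof. by move=> ig1 ig2; have := integrableB measurableT ig1 ig2; apply: eq_integrable. Qed.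

Let iL : P.-integrable setT (EFin \o L).
Proof. by apply: iB; [exact: i|apply: iD; [apply: iD|]; exact: iZ]. Qed.

Let LE : \int[P]_t L t = entropy_deficit.
Proof.
rewrite RintegralB//; last by apply: iD; [apply: iD|]; exact: iZ.
rewrite RintegralD//; [|by apply: iD; exact: iZ|exact: iZ].
by rewrite RintegralD//; [|exact: iZ|exact: iZ]; rewrite !RintegralZl.
Qed.

(** The quotient [G / f], with value 0 where [f] vanishes; the power form is the one with a
    measurability lemma. *)
Let g z := G z * f z `^ (-1).
Let H t := g (Z t).

Let mg : measurable_fun setT g.
Proof.
by apply: measurable_funM => //; exact: (measurableT_comp (measurable_powR (-1)) mf).
Qed.

Let g0 z : 0 <= g z. Proof. by rewrite mulr_ge0// powR_ge0. Qed.

Let HE : (\int[P]_t (H t)%:E = \int[leb \x leb]_z (g z * F z)%:E)%E.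
Proof. exact: (pdf2_expectation measurable_rv2 h mg g0). Qed.

Let gG z : g z * F z <= G z * w2 z.
Proof.
rewrite /F mulrA ler_wpM2r ?(ltW (w2_gt0 z))// /g powR_inv1// -mulrA ler_piMr//.
have [->|fn] := eqVneq (f z) 0; first by rewrite mulr0.
by rewrite mulVf// mulr1.
Qed.

Let intG : (\int[leb \x leb]_z (G z * w2 z)%:E <= 1)%E.
Proof.
have -> : (\int[leb \x leb]_z (G z * w2 z)%:E =
    BLint D F1 F2 F3)%E.
  by apply: eq_integral => z _; rewrite -GE.
apply: BLint_le1.
- exact: measurable_funM.
- exact: measurable_funM.
- exact: measurable_funM.
- by move=> x; rewrite mulr_ge0.
- by move=> x; rewrite mulr_ge0.
- by move=> x; rewrite mulr_ge0.
- exact: (pdf1_integral h1).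
- exact: (pdf1_integral h2).
- exact: (pdf1_integral h3).
Qed.

Let mGw : measurable_fun setT (fun z => (G z * w2 z)%:E).
Proof. by apply/measurable_EFinP; exact: measurable_funM. Qed.

Let mF : measurable_fun setT F. Proof. exact: measurable_funM. Qed.

Let F0 z : 0 <= F z. Proof. by rewrite mulr_ge0// ltW. Qed.

Let mgw : measurable_fun setT (fun z => (g z * F z)%:E).
Proof. by apply/measurable_EFinP; exact: measurable_funM. Qed.

Let gw_ge0 z : 0 <= g z * F z.
Proof. by rewrite mulr_ge0. Qed.

Let intH : (\int[P]_t (H t)%:E <= \int[leb \x leb]_z (G z * w2 z)%:E)%E.
Proof.
rewrite HE; apply: ge0_le_integral; first exact: measurableT.
- by move=> z _; rewrite lee_fin.
- exact: mgw.
- exact: mGw.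
- by move=> z _; rewrite lee_fin.
Qed.

Let iH : P.-integrable setT (EFin \o H).
Proof.
apply/integrableP; split.
  by apply/measurable_EFinP; exact: (measurableT_comp mg measurable_rv2).
under eq_integral => t _ do rewrite /= ger0_norm ?/H//.
by apply: (le_lt_trans intH); apply: (le_lt_trans intG); rewrite ltry.
Qed.

Let RH1 : \int[P]_t H t <= 1.
Proof.
rewrite -lee_fin /Rintegral fineK; last exact: integrable_fin_num.
exact: le_trans intH intG.
Qed.

(** Pointwise defect of [- ln x >= 1 - x] at [x = H t]. Its expectation is the deficit minus
    [1 - E H], and [E H <= 1] by the Brascamp-Lieb inequality, so a zero deficit forces both defects
    to vanish. *)
Let N t := L t - (1 - H t).

Let i1B : P.-integrable setT (EFin \o (fun t => 1 - H t)).
Proof. by apply: iB => //; exact: finite_measure_integrable_cst. Qed.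

Let NE : \int[P]_t N t = entropy_deficit - (1 - \int[P]_t H t).
Proof.
rewrite RintegralB// LE RintegralB//; last exact: finite_measure_integrable_cst.
have -> : \int[P]_(t in setT) (1 : R) = 1; last by [].
by rewrite Rintegral_cst// mul1r; exact: (congr1 fine (probability_setT P)).
Qed.

Let Hln : {ae P, forall t, 0 < H t /\ L t = - ln (H t)}.
Proof.
have a1 := pdf1_gt0 mX h1.
have a2 := pdf1_gt0 measurable_rvu2 h2.
have a3 := pdf1_gt0 measurable_rvu3 h3.
have a0 := pdf2_gt0 measurable_rv2 h.
apply: ae_imply (ae_conj (ae_conj a1 a2) (ae_conj a3 a0)) => t [[p1 p2] [p3 p]].
have pos (a b : R) : 0 < b -> 0 < a * b -> 0 < a by move=> b0; rewrite pmulr_lgt0.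
have {}p1 := pos _ _ (w0 _) p1. have {}p2 := pos _ _ (w0 _) p2.
have {}p3 := pos _ _ (w0 _) p3. have {}p := pos _ _ (w2_gt0 _) p.
have q1 : 0 < f1 (X t) `^ (d1 ^+ 2) by rewrite powR_gt0.
have q2 : 0 < f2 (X2 t) `^ (d2 ^+ 2) by rewrite powR_gt0.
have q3 : 0 < f3 (X3 t) `^ (d3 ^+ 2) by rewrite powR_gt0.
have q : 0 < f (Z t) `^ (-1) by rewrite powR_gt0.
have HtE : H t = f1 (X t) `^ (d1 ^+ 2) * f2 (X2 t) `^ (d2 ^+ 2) * f3 (X3 t) `^ (d3 ^+ 2) *
    f (Z t) `^ (-1) by [].
rewrite HtE; split; first by rewrite !mulr_gt0.
rewrite !lnM ?posrE ?mulr_gt0// !ln_powR /L; ring.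
Qed.

Let N0 : {ae P, forall t, 0 <= N t}.
Proof.
apply: ae_imply Hln => t [Ht Lt]; rewrite /N Lt.
have := expR_ge1Dx (ln (H t)); rewrite lnK ?posrE//; lra.
Qed.

Let iN : P.-integrable setT (EFin \o N). Proof. exact: iB. Qed.

Lemma entropy_deficit_ge0 : 0 <= entropy_deficit.
Proof.
have [H1 _] := ae_ge0_Rintegral iN N0.
by move: H1; rewrite NE; have := RH1; lra.
Qed.

Lemma entropy_deficit_eq0 : entropy_deficit = 0 ->
  {ae (leb \x leb)%E, forall z, F z =
    BLprod D F1 F2 F3 z} /\
  (BLint D F1 F2 F3 = 1)%E.
Proof.
move=> E0; have [N1 N2] := ae_ge0_Rintegral iN N0.
have RH : \int[P]_t H t = 1 by move: N1; rewrite NE E0; have := RH1; lra.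
have {}N2 : {ae P, forall t, N t = 0} by apply: N2; rewrite NE E0 RH; lra.
have H1 : {ae P, forall t, H t = 1}.
  apply: ae_imply (ae_conj N2 Hln) => t [Nt [Ht Lt]].
  have [l0|ln0] := eqVneq (ln (H t)) 0.
    by apply/eqP; rewrite -ln_eq0// l0.
  have := expR_gt1Dx ln0; rewrite lnK ?posrE//.
  by move: Nt; rewrite /N Lt; lra.
have IH : (\int[P]_t (H t)%:E = 1)%E.
  by rewrite -(fineK (integrable_fin_num _ iH))//; congr _%:E.
have IG : (\int[leb \x leb]_z (G z * w2 z)%:E = 1)%E.
  by apply/eqP; rewrite eq_le intG/= -IH intH.
split; last first.
  by rewrite -IG; apply: eq_integral => z _; rewrite -GE.
(* This handles the points where [f] vanishes, which the law of [Z] does not see: two ordered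
   functions with the same integral 1 agree almost everywhere, so [G] vanishes there too. *)
have aeg : {ae (leb \x leb)%E, forall z, g z * F z = G z * w2 z}.
  pose K z := G z * w2 z - g z * F z.
  have K0 z : 0 <= K z by rewrite subr_ge0.
  have mK : measurable_fun setT K.
    by apply: measurable_funB; exact/measurable_EFinP.
  have mKE : measurable_fun setT (EFin \o K) by exact/measurable_EFinP.
  have : (\int[leb \x leb]_z `|(EFin \o K) z| = 0)%E.
    transitivity (\int[leb \x leb]_z (K z)%:E)%E.
      by apply: eq_integral => z _; rewrite gee0_abs// lee_fin.
    have e : (\int[leb \x leb]_z (G z * w2 z)%:E = \int[leb \x leb]_z (K z)%:E +
        \int[leb \x leb]_z (g z * F z)%:E)%E.
      rewrite -ge0_integralD//.
      - by apply: eq_integral => z _; rewrite -EFinD /K subrK.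
      - by move=> z _; rewrite lee_fin.
      - by move=> z _; rewrite lee_fin.
    move: e; rewrite IG -HE IH; case: (\int[leb \x leb]_z (K z)%:E)%E => //= r.
    by rewrite -EFinD => -[] e; congr _%:E; lra.
  move/(ae_eq_integral_abs (leb \x leb)%E measurableT mKE); apply: ae_imply => z /(_ I)[].
  by rewrite /K => /eqP; rewrite subr_eq0 eq_sym => /eqP.
(* The identity [H = 1] holds almost surely; on the plane it is only meaningful where [F] is
   nonzero, hence the factor [F]. *)
have aeH : {ae (leb \x leb)%E, forall z, `|g z - 1| * F z = 0}.
  pose k z := `|g z - 1|.
  have mk : measurable_fun setT k.
    by apply: (measurableT_comp (@normr_measurable R setT)); exact: measurable_funB.
  have k0 z : 0 <= k z by exact: normr_ge0.
  have e := pdf2_expectation measurable_rv2 h mk k0.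
  pose K z := k z * F z.
  have mK : measurable_fun setT K by exact: measurable_funM.
  have mKE : measurable_fun setT (EFin \o K) by exact/measurable_EFinP.
  have : (\int[leb \x leb]_z `|(EFin \o K) z| = 0)%E.
    transitivity (\int[leb \x leb]_z (k z * F z)%:E)%E.
      by apply: eq_integral => z _; rewrite gee0_abs// lee_fin mulr_ge0.
    rewrite -e (ae_integral_eq (m := P) (g := cst 0) measurableT)//.
    - exact: integral0.
    - by apply: (measurableT_comp mk); exact: measurable_rv2.
    - by apply: ae_imply H1 => t; rewrite /k /H => ->; rewrite subrr normr0.
  move/(ae_eq_integral_abs (leb \x leb)%E measurableT mKE); apply: ae_imply => z /(_ I)[].
  by [].
apply: ae_imply (ae_conj aeg aeH) => z [E1 E2].
rewrite GE -E1.
have [fz0|fzn] := eqVneq (f z) 0; first by rewrite /F fz0 mul0r mulr0.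
have Fn : F z != 0 by rewrite mulf_neq0// gt_eqF.
move/eqP: E2; rewrite mulf_eq0 (negbTE Fn) orbF normr_eq0.
by rewrite subr_eq0 => /eqP ->; rewrite mul1r.
Qed.

Lemma entropy_deficit_zero :
  {ae (leb \x leb)%E, forall z, F z =
    BLprod D F1 F2 F3 z} ->
  entropy_deficit = 0.
Proof.
move=> E; have {}E : {ae P, forall t, f (Z t) = G (Z t)}.
  apply: (pdf2_ae measurable_rv2 (Q := fun z => f z = G z) h); apply: ae_imply E => z.
  by rewrite GE /F => /mulIf; apply; rewrite gt_eqF.
rewrite -LE.
suff L0 : {ae P, forall t, L t = 0}.
  rewrite /Rintegral (ae_integral_eq (m := P) (g := cst 0) measurableT)//.
    by rewrite integral0.
  by have := measurable_int _ iL => /measurable_EFinP.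
apply: ae_imply (ae_conj E Hln) => t [ft [Ht ->]].
have fp : 0 < f (Z t).
  rewrite lt_neqAle f_0 andbT eq_sym; apply/eqP => f00.
  by move: Ht; rewrite /H /g -ft f00 mul0r ltxx.
have -> : H t = 1 by rewrite /H /g -ft powR_inv1// mulfV// gt_eqF.
by rewrite ln1 oppr0.
Qed.

End relative_entropy.

Section gaussian_laws.
Context (R : realType) d (T : measurableType d) (P : probability T R).
Notation leb := (@lebesgue_measure R).
Notation mR := (measurableTypeR R).
Notation np := (@normal_pdf R).

Lemma normal_prob_product (a b s : R) (A : set (R * R)) : measurable A ->
  ((normal_prob a s \x normal_prob b s) A =
   \int[leb \x leb]_(z in A) (np a s z.1 * np b s z.2)%:E)%E.
Proof.
move=> mA.
have mn c : measurable_fun setT (np c s) by exact: measurable_normal_pdf.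
exact: (@product_density R (normal_prob a s) (normal_prob b s) (np a s) (np b s)
  (mn a) (normal_pdf_ge0 _ _) (fun _ _ => erefl) (mn b) (normal_pdf_ge0 _ _)
  (fun _ _ => erefl) A mA).
Qed.

Variables (X Y : T -> R) (mX : measurable_fun setT X) (mY : measurable_fun setT Y).
Let Z t := (X t, Y t).

Let mZ : measurable_fun setT Z. Proof. exact: measurable_fun_pair. Qed.

(** Everything is decided on rectangles: a full side recovers the marginals, and conversely a
    measure with the product values on rectangles is the product measure. *)
Lemma pdf2_normal_independent (a b s : R) :
  pdf2 P Z (fun z => np a s z.1 * np b s z.2) <->
  @independent _ T R P X Y /\ @gaussian _ T R P X a s /\ @gaussian _ T R P Y b s.
Proof.
have mn c : measurable_fun setT (np c s) by exact: measurable_normal_pdf.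
have rect (A B : set mR) : Z @^-1` (A `*` B) = X @^-1` A `&` Y @^-1` B.
  by apply/seteqP; split => t.
have prodE (A B : set mR) : measurable A -> measurable B ->
    ((normal_prob a s \x normal_prob b s) (A `*` B) = normal_prob a s A * normal_prob b s B)%E.
  by move=> mA mB; rewrite product_measure1E.
split=> [[_ _ fE]|[ind [gX gY]]].
  have law (A B : set mR) : measurable A -> measurable B ->
      (P (X @^-1` A `&` Y @^-1` B) = normal_prob a s A * normal_prob b s B)%E.
    move=> mA mB; rewrite -rect -prodE// normal_prob_product; last exact: measurableX.
    by apply: fE; exact: measurableX.
  have gX : @gaussian _ T R P X a s.
    move=> A mA; have := law A setT mA measurableT.
    by rewrite preimage_setT setIT probability_setT mule1.
  have gY : @gaussian _ T R P Y b s.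
    move=> A mA; have := law setT A measurableT mA.
    by rewrite preimage_setT setTI probability_setT mul1e.
  by split => // A B mA mB; rewrite law// -(gX A mA) -(gY B mB).
have [n nE] := @pushforward_measure _ _ R _ (mR * mR)%type P Z mZ.
split.
- by apply: measurable_funM; exact: measurableT_comp.
- by move=> z; rewrite mulr_ge0// normal_pdf_ge0.
- have rectE (B C : set mR) : measurable B -> measurable C ->
      (n (B `*` C) = normal_prob a s B * normal_prob b s C)%E.
    move=> mB mC; rewrite nE /pushforward rect; apply: (etrans (ind B C mB mC)).
    by rewrite -(gX B mB) -(gY C mC).
  move=> A mA; apply: (etrans _ (@normal_prob_product a b s A mA)).
  have := @product_measure_unique _ _ mR mR R (normal_prob a s) (normal_prob b s) n rectE A mA.
  by rewrite nE => <-.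
Qed.

Lemma normal_pdf_rescale (b c s x : R) : c != 0 -> 0 < s ->
  `|c^-1| * np b s (c^-1 * x) = np (c * b) (`|c| * s) x.
Proof.
move=> c0 s0; rewrite !normal_pdf_pos ?mulr_gt0 ?normr_gt0//.
rewrite mulrCA mulrA; congr (_ * expR _).
  by rewrite normfV invfM mulrA mulrAC.
congr (- _); rewrite exprMn real_normK ?num_real//.
by field; rewrite c0 gt_eqF.
Qed.

(** For fixed [u = al x + be y] the remaining integral is the convolution of two rescaled Gaussians.
    The unit length of [(al, be)] keeps the deviation equal to [s]. *)
Lemma pdf1_normal_lin (a b s al be : R) : 0 < s -> al != 0 -> be != 0 ->
  al ^+ 2 + be ^+ 2 = 1 ->
  pdf2 P Z (fun z => np a s z.1 * np b s z.2) ->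
  pdf1 P (fun t => al * X t + be * Y t) (np (al * a + be * b) s).
Proof.
move=> s0 al0 be0 albe1 [_ _ ZE]; have mn c r : measurable_fun setT (np c r).
  exact: measurable_normal_pdf.
split; [exact: mn|by move=> x; exact: normal_pdf_ge0|move=> A mA; rewrite /pushforward].
pose B := (fun z : R * R => al * z.1 + be * z.2) @^-1` A.
have mB : measurable B by rewrite -[B]setTI; exact: measurable_lin2.
have -> : (fun t => al * X t + be * Y t) @^-1` A = Z @^-1` B by [].
apply: (etrans (ZE B mB)); rewrite integral_mkcond [RHS]integral_mkcond.
pose h (u x y : R) : \bar R := ((\1_A u)%:E * (np a s x * np b s y)%:E)%E.
have h0 u x y : (0 <= h u x y)%E.
  by rewrite mule_ge0// lee_fin// mulr_ge0// normal_pdf_ge0.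
pose F (z : R * R) := h (al * z.1 + be * z.2) z.1 z.2.
have mF : measurable_fun setT F.
  apply: emeasurable_funM; apply/measurable_EFinP.
    by apply: (measurableT_comp (measurable_indic _)) => //; exact: measurable_lin2.
  by apply: measurable_funM; exact: measurableT_comp.
have F0 z : (0 <= F z)%E by exact: h0.
transitivity (\int[leb \x leb]_z F z)%E.
  apply: eq_integral => z _; rewrite /F /h patchE indicE.
  have -> : (z \in B) = (al * z.1 + be * z.2 \in A) by [].
  by case: ifPn => _; rewrite ?mul1e ?mul0e.
have ben : be^-1 != 0 by rewrite invr_neq0.
have aln : al^-1 != 0 by rewrite invr_neq0.
rewrite (@ge0_integral_shear2 R (- (al / be)) be^-1 F ben mF F0).
pose K (z : R * R) : \bar R :=
  ((\1_A z.2)%:E * (np a s z.1 * np (be * b) (`|be| * s) (z.2 - al * z.1))%:E)%E.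
have mK : measurable_fun setT K.
  apply: emeasurable_funM; apply/measurable_EFinP; first exact: measurableT_comp.
  apply: measurable_funM; first exact: measurableT_comp.
  apply: (measurableT_comp (mn _ _)); apply: measurable_funB => //.
  exact: measurable_funM.
have K0 z : (0 <= K z)%E by rewrite mule_ge0// lee_fin// mulr_ge0// normal_pdf_ge0.
have mF' : measurable_fun setT (fun z : R * R => F (z.1, (- (al / be) * z.1 + be^-1 * z.2)%R)).
  apply: measurableT_comp => //; apply: measurable_fun_pair => //.
  exact: measurable_lin2.
rewrite -ge0_integralZl//.
transitivity (\int[leb \x leb]_z K z)%E.
  apply: eq_integral => z _; rewrite /F /K /h/= muleCA -EFinM; congr ((\1_A _)%:E * _%:E)%E.
    by field.
  rewrite mulrCA; congr (_ * _).
  have -> : - (al / be) * z.1 + be^-1 * z.2 = be^-1 * (z.2 - al * z.1) by field.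
  exact: normal_pdf_rescale.
rewrite (tonelli2 mK K0); apply: eq_integral => u _.
rewrite /K/= patchE indicE.
have mk : measurable_fun setT (fun x : R => np a s x * np (be * b) (`|be| * s) (u - al * x)).
  apply: measurable_funM => //; apply: (measurableT_comp (mn _ _)).
  by apply: measurable_funB => //; exact: measurable_funM.
have k0 x : 0 <= np a s x * np (be * b) (`|be| * s) (u - al * x).
  by rewrite mulr_ge0// normal_pdf_ge0.
case: ifPn => _; last by under eq_integral => x _ do rewrite mul0e; rewrite integral0.
under eq_integral => x _ do rewrite mul1e.
have mkE : measurable_fun setT (fun x : R => (np a s x * np (be * b) (`|be| * s) (u - al * x))%:E).
  exact/measurable_EFinP.
rewrite (@ge0_integral_affine R al^-1 0 _ aln mkE (fun x => k0 x)).
have as0 : 0 < `|al| * s by rewrite mulr_gt0 ?normr_gt0.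
have bs0 : 0 < `|be| * s by rewrite mulr_gt0 ?normr_gt0.
have -> : np (al * a + be * b) s u =
    convolution (np (al * a) (`|al| * s)) (np (be * b) (`|be| * s)) u.
  rewrite conv_normal//; congr (np _ _ _).
  rewrite !exprMn !real_normK ?num_real// -mulrDl albe1 mul1r sqrtr_sqr.
  by rewrite gtr0_norm.
have bsn : `|be| * s != 0 by rewrite gt_eqF.
have cn : continuous (np (be * b) (`|be| * s)) by exact: continuous_normal_pdf.
have nC y : np (be * b) (`|be| * s) y <= normal_peak (`|be| * s) by exact: normal_pdf_ub.
rewrite (convE (mn _ _) (normal_pdf_ge0 _ _) (integral_normal_pdf _ _)
  cn (normal_pdf_ge0 _ _) nC) -ge0_integralZl//.
- apply: eq_integral => v _; rewrite -EFinM addr0 mulVKf// mulrA.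
  by congr (_ * _)%:E; exact: normal_pdf_rescale.
- apply/measurable_EFinP; apply: (measurableT_comp mk).
  by apply: measurable_funD => //; exact: measurable_funM.
- by move=> v _; exact: k0.
Qed.

End gaussian_laws.

Section entropy_theorem.
Context (R : realType) (D : BLdatum R).
Notation leb := (@lebesgue_measure R).
Notation mR := (measurableTypeR R).
Notation np := (@normal_pdf R).
Notation r1 := (br1 D). Notation r2 := (br2 D). Notation r3 := (br3 D).
Notation d1 := (bd1 D). Notation d2 := (bd2 D). Notation d3 := (bd3 D).

(** Completing the square: [(m1, m2)] is [sum c_i a_i u_i], and [k] is what remains of the weighted
    squares of the centres. [C] is left abstract, since normalization fixes it later. *)
Lemma BLprod_gaussians (a1 a2 a3 s : R) : 0 < s -> exists m1 m2 C : R, forall z,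
  BLprod D (np a1 s) (np a2 s) (np a3 s) z = C * (np m1 s z.1 * np m2 s z.2).
Proof.
move=> s0; have sn : s != 0 by rewrite gt_eqF.
pose al2 := r1 * r2 / (d1 * d2); pose be2 := r3 / (d1 * d2).
pose al3 := - (r1 * r3 / (d1 * d3)); pose be3 := r2 / (d1 * d3).
pose m1 := d1 ^+ 2 * a1 + d2 ^+ 2 * al2 * a2 + d3 ^+ 2 * al3 * a3.
pose m2 := d2 ^+ 2 * be2 * a2 + d3 ^+ 2 * be3 * a3.
pose k := d1 ^+ 2 * a1 ^+ 2 + d2 ^+ 2 * a2 ^+ 2 + d3 ^+ 2 * a3 ^+ 2 - m1 ^+ 2 - m2 ^+ 2.
exists m1, m2, (expR (- (k / (s ^+ 2 *+ 2)))) => -[x y].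
rewrite /BLprod/= !normal_pdf_expR// -!expRM -!expRD; congr expR.
set K := ln _.
have E : d1 ^+ 2 * (x - a1) ^+ 2 + d2 ^+ 2 * (BLu2 D (x, y) - a2) ^+ 2 +
    d3 ^+ 2 * (BLu3 D (x, y) - a3) ^+ 2 = (x - m1) ^+ 2 + (y - m2) ^+ 2 + k.
  transitivity (d1 ^+ 2 * x ^+ 2 + d2 ^+ 2 * BLu2 D (x, y) ^+ 2 + d3 ^+ 2 * BLu3 D (x, y) ^+ 2
    - (d1 ^+ 2 * x * a1 + d2 ^+ 2 * BLu2 D (x, y) * a2 + d3 ^+ 2 * BLu3 D (x, y) * a3) *+ 2
    + (d1 ^+ 2 * a1 ^+ 2 + d2 ^+ 2 * a2 ^+ 2 + d3 ^+ 2 * a3 ^+ 2)); first by ring.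
  by rewrite BL_parseval /k /m1 /m2 /BLu2 /BLu3/= -/al2 -/be2 -/al3 -/be3; ring.
transitivity (K * (d1 ^+ 2 + d2 ^+ 2 + d3 ^+ 2) - (d1 ^+ 2 * (x - a1) ^+ 2 +
  d2 ^+ 2 * (BLu2 D (x, y) - a2) ^+ 2 + d3 ^+ 2 * (BLu3 D (x, y) - a3) ^+ 2)
   / (s ^+ 2 *+ 2)); first by field.
by rewrite E BLsum2; field.
Qed.

Lemma BLu2_unit : (r1 * r2 / (d1 * d2)) ^+ 2 + (r3 / (d1 * d2)) ^+ 2 = 1.
Proof.
have E0 := br_sum D; have D1 := bd1E D; have D2 := bd2E D.
have d1p := bd1_gt0 D; have d2p := bd2_gt0 D.
have r1p := br1_gt0 D; have r2p := br2_gt0 D; have r3p := br3_gt0 D.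
have E : d1 ^+ 2 * d2 ^+ 2 = r1 ^+ 2 * r2 ^+ 2 + r3 ^+ 2.
  by rewrite D1 D2 (_ : r3 ^+ 2 = 1 - r1 ^+ 2 - r2 ^+ 2); [ring|lra].
transitivity ((r1 ^+ 2 * r2 ^+ 2 + r3 ^+ 2) / (d1 ^+ 2 * d2 ^+ 2)).
  by field; rewrite !gt_eqF.
by rewrite E mulfV// gt_eqF// addr_gt0 ?mulr_gt0 ?exprn_gt0.
Qed.

Lemma BLu3_unit : (- (r1 * r3 / (d1 * d3))) ^+ 2 + (r2 / (d1 * d3)) ^+ 2 = 1.
Proof.
have E0 := br_sum D; have D1 := bd1E D; have D3 := bd3E D.
have d1p := bd1_gt0 D; have d3p := bd3_gt0 D.
have r1p := br1_gt0 D; have r2p := br2_gt0 D; have r3p := br3_gt0 D.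
have E : d1 ^+ 2 * d3 ^+ 2 = r1 ^+ 2 * r3 ^+ 2 + r2 ^+ 2.
  by rewrite D1 D3 (_ : r2 ^+ 2 = 1 - r1 ^+ 2 - r3 ^+ 2); [ring|lra].
transitivity ((r1 ^+ 2 * r3 ^+ 2 + r2 ^+ 2) / (d1 ^+ 2 * d3 ^+ 2)).
  by field; rewrite !gt_eqF.
by rewrite E mulfV// gt_eqF// addr_gt0 ?mulr_gt0 ?exprn_gt0.
Qed.

Lemma weight_pdf1 (mu : {measure set mR -> \bar R}) (w f : R -> R)
    d (T : measurableType d) (P : probability T R) (X : T -> R) :
  measurable_fun setT w -> (forall x, 0 <= w x) ->
  (forall A, measurable A -> mu A = \int[leb]_(x in A) (w x)%:E)%E ->
  @has_density _ _ T mR R P mu X f -> pdf1 P X (fun x => f x * w x).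
Proof.
move=> mw w0 muE [mf f0 fE]; split.
- exact: measurable_funM.
- by move=> x; rewrite mulr_ge0.
- move=> A mA; rewrite fE//.
  exact: (@integral_density_set _ mR R leb mu w f A mw w0 muE mf f0 mA).
Qed.

Lemma weight_pdf2 (mu : {sigma_finite_measure set mR -> \bar R}) (w : R -> R) (f : R * R -> R)
    d (T : measurableType d) (P : probability T R) (Z : T -> R * R) :
  measurable_fun setT w -> (forall x, 0 <= w x) ->
  (forall A, measurable A -> mu A = \int[leb]_(x in A) (w x)%:E)%E ->
  @has_density _ _ T (mR * mR)%type R P (mu \x mu)%E Z f ->
  pdf2 P Z (fun z => f z * (w z.1 * w z.2)).
Proof.
move=> mw w0 muE [mf f0 fE].
have mw2 : measurable_fun setT (fun z : R * R => w z.1 * w z.2) by exact: measurable_weight2.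
have w20 (z : R * R) : 0 <= w z.1 * w z.2 by rewrite mulr_ge0.
split.
- exact: measurable_funM.
- by move=> z; rewrite mulr_ge0.
- move=> A mA; rewrite fE//.
  exact: (@integral_density_set _ (mR * mR)%type R (leb \x leb)%E (mu \x mu)%E _ f A mw2 w20
    (product_density mw w0 muE mw w0 muE) mf f0 mA).
Qed.

Theorem entropy_BL (mu : {sigma_finite_measure set mR -> \bar R})
    d (T : measurableType d) (P : probability T R) (X Y : T -> mR) :
  lebesgue_or_gaussian mu -> measurable_fun setT X -> measurable_fun setT Y ->
  let X2 : T -> mR := fun t => BLu2 D (X t, Y t) in
  let X3 : T -> mR := fun t => BLu3 D (X t, Y t) in
  let XY : T -> mR * mR := fun t => (X t, Y t) in
  finite_entropy P mu X -> finite_entropy P mu X2 -> finite_entropy P mu X3 ->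
  finite_entropy P (mu \x mu)%E XY ->
  let lhs := d1 ^+ 2 * entropy P mu X + d2 ^+ 2 * entropy P mu X2 + d3 ^+ 2 * entropy P mu X3 in
  let rhs := entropy P (mu \x mu)%E XY in
  lhs <= rhs /\ (lhs = rhs <-> independent_gaussians_same_variance P X Y).
Proof.
move=> hmu mX mY X2 X3 XY e1 e2 e3 e lhs rhs.
have [w [mw w0 muE wD]] := reference_weight hmu.
have w_ge0 x : 0 <= w x by exact: ltW.
have mX2 : measurable_fun setT X2 := measurable_rvu2 D mX mY.
have mX3 : measurable_fun setT X3 := measurable_rvu3 D mX mY.
have mXY : measurable_fun setT XY := measurable_rv2 mX mY.
have [f1 [h1 i1 E1]] := finite_entropyP mX e1.
have [f2 [h2 i2 E2]] := finite_entropyP mX2 e2.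
have [f3 [h3 i3 E3]] := finite_entropyP mX3 e3.
have [f [h i E]] := finite_entropyP mXY e.
have [m1 f1_0 _] := h1. have [m2 f2_0 _] := h2. have [m3 f3_0 _] := h3.
have [mf f_0 _] := h.
have p1 := weight_pdf1 mw w_ge0 muE h1.
have p2 := weight_pdf1 mw w_ge0 muE h2.
have p3 := weight_pdf1 mw w_ge0 muE h3.
have p := weight_pdf2 mw w_ge0 muE h.
have DE : rhs - lhs = entropy_deficit D P X Y f1 f2 f3 f.
  by rewrite /rhs /lhs E E1 E2 E3.
have D0 := entropy_deficit_ge0 mX mY mw w0 (wD D) m1 m2 m3 mf f1_0 f2_0 f3_0 f_0 p1 p2 p3 p i1 i2 i3 i.
split; first by rewrite -subr_ge0 DE.
split.
  move=> lr.
  have [] := entropy_deficit_eq0 mX mY mw w0 (wD D) m1 m2 m3 mf f1_0 f2_0 f3_0 f_0 p1 p2 p3 p i1 i2 i3 i.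
    by rewrite -DE lr subrr.
  set F1 := fun x => f1 x * w x; set F2 := fun x => f2 x * w x.
  set F3 := fun x => f3 x * w x; set F := fun z => f z * (w z.1 * w z.2).
  move=> aeF BL1.
  have pos (g : R -> R) : (forall x, 0 <= g x) -> forall x, 0 <= g x * w x.
    by move=> g0 x; rewrite mulr_ge0.
  have [a1 [a2 [a3 [s [s0 A1 A2 A3]]]]] := BLint_eq1 (measurable_funM m1 mw)
    (measurable_funM m2 mw) (measurable_funM m3 mw) (pos _ f1_0) (pos _ f2_0) (pos _ f3_0)
    (pdf1_integral p1) (pdf1_integral p2) (pdf1_integral p3) BL1.
  have [c1 [c2 [C CE]]] := BLprod_gaussians a1 a2 a3 s0.
  have mn c : measurable_fun setT (np c s) by exact: measurable_normal_pdf.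
  pose q (z : R * R) := np c1 s z.1 * np c2 s z.2.
  have mq : measurable_fun setT q by apply: measurable_funM; exact: measurableT_comp.
  have q0 z : 0 <= q z by rewrite mulr_ge0// normal_pdf_ge0.
  have aeq : {ae (leb \x leb)%E, forall z, F z = C * q z}.
    apply: ae_imply (ae_conj aeF (ae_conj (ae_BLu1 A1) (ae_conj (ae_BLu2 D A2) (ae_BLu3 D A3)))).
    by move=> z [Fz [B1 [B2 B3]]]; apply: (etrans Fz); rewrite -CE /BLprod -B1 -B2 -B3.
  have [mF F0 FE] := p.
  have FC (A : set (mR * mR)) : measurable A ->
      (\int[leb \x leb]_(z in A) (F z)%:E = \int[leb \x leb]_(z in A) (C * q z)%:E)%E.
    move=> mA; apply: (@ae_integral_eq _ (mR * mR)%type R (leb \x leb)%E F _ A mA mF _ aeq).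
    exact: measurable_funM.
  have C0 : 0 <= C.
    have := BLprod_ge0 D (np a1 s) (np a2 s) (np a3 s) (0, 0).
    by rewrite CE pmulr_lge0// mulr_gt0 ?normal_pdf_gt0 ?gt_eqF//.
  (* Both [F] and [q] have mass 1. *)
  have C1 : C = 1.
    have := FC setT measurableT.
    have -> : (\int[leb \x leb]_z (F z)%:E = 1)%E.
      exact: (@has_density_integral _ T R P _ (mR * mR)%type (leb \x leb)%E XY F p).
    under eq_integral => z _ do rewrite EFinM.
    rewrite ge0_integralZl//.
    - rewrite (@integral_prod_mul R (np c1 s) (np c2 s)) ?integral_normal_pdf ?mule1//.
      + by move=> [].
      + by move=> x; exact: normal_pdf_ge0.
      + by move=> x; exact: normal_pdf_ge0.
    - exact/measurable_EFinP.
    - by move=> z _; rewrite lee_fin.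
  have pq : pdf2 P XY q.
    split => // A mA; rewrite FE// FC//; apply: eq_integral => z _.
    by rewrite C1 mul1r.
  have [ind [gX gY]] := (pdf2_normal_independent P mX mY c1 c2 s).1 pq.
  by split => //; exists c1, c2, s.
move=> [ind [a [b [s [s0 gX gY]]]]].
have pq : pdf2 P XY (fun z => np a s z.1 * np b s z.2).
  by apply/(pdf2_normal_independent P mX mY); split.
have mn c : measurable_fun setT (np c s) by exact: measurable_normal_pdf.
have pX : pdf1 P X (np a s).
  by split; [exact: mn|move=> x; exact: normal_pdf_ge0|exact: gX].
have d1p := bd1_gt0 D; have d2p := bd2_gt0 D; have d3p := bd3_gt0 D.
have r1p := br1_gt0 D; have r2p := br2_gt0 D; have r3p := br3_gt0 D.
have al2 : r1 * r2 / (d1 * d2) != 0 by rewrite gt_eqF// divr_gt0 ?mulr_gt0.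
have be2 : r3 / (d1 * d2) != 0 by rewrite gt_eqF// divr_gt0 ?mulr_gt0.
have al3 : - (r1 * r3 / (d1 * d3)) != 0.
  by rewrite oppr_eq0 gt_eqF// divr_gt0 ?mulr_gt0.
have be3 : r2 / (d1 * d3) != 0 by rewrite gt_eqF// divr_gt0 ?mulr_gt0.
have pX2 : pdf1 P X2 (np (BLu2 D (a, b)) s) :=
  pdf1_normal_lin s0 al2 be2 BLu2_unit pq.
have pX3 : pdf1 P X3 (np (BLu3 D (a, b)) s) :=
  pdf1_normal_lin s0 al3 be3 BLu3_unit pq.
apply/eqP; rewrite eq_sym -subr_eq0; apply/eqP; rewrite DE.
apply: (entropy_deficit_zero mX mY w0 (wD D) f1_0 f2_0 f3_0 f_0 p1 p2 p3 p i1 i2 i3 i).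
have A1 := pdf1_unique p1 pX. have A2 := pdf1_unique p2 pX2.
have A3 := pdf1_unique p3 pX3. have A := pdf2_unique p pq.
apply: ae_imply (ae_conj A (ae_conj (ae_BLu1 A1) (ae_conj (ae_BLu2 D A2) (ae_BLu3 D A3)))).
move=> z [-> [B1 [B2 B3]]]; rewrite -(BLprod_normal D a b z s0).
by rewrite /BLprod B1 B2 B3.
Qed.

End entropy_theorem.

(** * Young's inequality *)

Section BL_extremal.
Context (R : realType) (D : BLdatum R).
Notation leb := (@lebesgue_measure R).
Notation mR := (measurableTypeR R).
Notation d1 := (bd1 D). Notation d2 := (bd2 D). Notation d3 := (bd3 D).

Lemma BLint_normalize (f1 f2 f3 : R -> R) (a1 a2 a3 : R) :
  measurable_fun setT f1 -> measurable_fun setT f2 -> measurable_fun setT f3 ->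
  (forall x, 0 <= f1 x) -> (forall x, 0 <= f2 x) -> (forall x, 0 <= f3 x) ->
  0 < a1 -> 0 < a2 -> 0 < a3 ->
  BLint D f1 f2 f3 = (a1 `^ (d1 ^+ 2) * a2 `^ (d2 ^+ 2) * a3 `^ (d3 ^+ 2))%:E ->
  BLint D (fun x => a1^-1 * f1 x) (fun x => a2^-1 * f2 x) (fun x => a3^-1 * f3 x) = 1%E.
Proof.
move=> m1 m2 m3 f1_0 f2_0 f3_0 a1p a2p a3p E.
have i0 (a : R) : 0 < a -> 0 <= a^-1 by move=> ?; rewrite invr_ge0 ltW.
rewrite BLint_scale ?i0// E -EFinM; congr _%:E.
have q (a c : R) : 0 < a -> a^-1 `^ c * a `^ c = 1.
  move=> a0; rewrite -powRM ?i0 ?(ltW a0)// mulVf ?powR1//.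
  by rewrite gt_eqF.
transitivity ((a1^-1 `^ (d1 ^+ 2) * a1 `^ (d1 ^+ 2)) *
  (a2^-1 `^ (d2 ^+ 2) * a2 `^ (d2 ^+ 2)) * (a3^-1 `^ (d3 ^+ 2) * a3 `^ (d3 ^+ 2))).
  by ring.
by rewrite !q// !mulr1.
Qed.

Lemma BLint_extremal (f1 f2 f3 : R -> R) (a1 a2 a3 : R) :
  measurable_fun setT f1 -> measurable_fun setT f2 -> measurable_fun setT f3 ->
  (forall x, 0 <= f1 x) -> (forall x, 0 <= f2 x) -> (forall x, 0 <= f3 x) ->
  0 < a1 -> 0 < a2 -> 0 < a3 ->
  (\int[leb]_x (f1 x)%:E = a1%:E)%E -> (\int[leb]_x (f2 x)%:E = a2%:E)%E ->
  (\int[leb]_x (f3 x)%:E = a3%:E)%E ->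
  BLint D f1 f2 f3 = (a1 `^ (d1 ^+ 2) * a2 `^ (d2 ^+ 2) * a3 `^ (d3 ^+ 2))%:E ->
  exists m1 m2 m3 s, [/\ 0 < s, {ae leb, forall x, f1 x = a1 * normal_pdf m1 s x},
    {ae leb, forall x, f2 x = a2 * normal_pdf m2 s x} &
    {ae leb, forall x, f3 x = a3 * normal_pdf m3 s x}].
Proof.
move=> mf1 mf2 mf3 f1_0 f2_0 f3_0 a1p a2p a3p I1 I2 I3 E.
have N1 := BLint_normalize mf1 mf2 mf3 f1_0 f2_0 f3_0 a1p a2p a3p E.
have [n1 n1_0 J1] := normalize_mass mf1 f1_0 a1p I1.
have [n2 n2_0 J2] := normalize_mass mf2 f2_0 a2p I2.
have [n3 n3_0 J3] := normalize_mass mf3 f3_0 a3p I3.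
have [b1 [b2 [b3 [v [v0 A1 A2 A3]]]]] := BLint_eq1 n1 n2 n3 n1_0 n2_0 n3_0 J1 J2 J3 N1.
have sc (a b : R) (f : R -> R) : 0 < a -> {ae leb, forall x, a^-1 * f x = normal_pdf b v x} ->
    {ae leb, forall x, f x = a * normal_pdf b v x}.
  by move=> a0; apply: ae_imply => x <-; rewrite mulVKf// gt_eqF.
by exists b1, b2, b3, v; split => //; exact: sc.
Qed.

End BL_extremal.

Section BL_sign.
Context (R : realType) (D : BLdatum R).
Notation leb := (@lebesgue_measure R).
Notation r1 := (br1 D). Notation r2 := (br2 D). Notation r3 := (br3 D).
Notation d1 := (bd1 D). Notation d2 := (bd2 D). Notation d3 := (bd3 D).

Let dE : [/\ d1 ^+ 2 = r2 ^+ 2 + r3 ^+ 2, d2 ^+ 2 = r1 ^+ 2 + r3 ^+ 2 &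
  d3 ^+ 2 = r1 ^+ 2 + r2 ^+ 2].
Proof.
by have E := br_sum D; rewrite (bd1E D) (bd2E D) (bd3E D); split; lra.
Qed.

(** The product is [(p q)^(r1^2) (e q)^(r2^2) (e p)^(r3^2)], because [d_i^2 = r_j^2 + r_k^2]. The
    bound is bilinear in pairs of masses, so it can be summed over the pieces of a partition. *)
Lemma BLmass_amgm (e p q : R) : 0 <= e -> 0 <= p -> 0 <= q ->
  e `^ (d1 ^+ 2) * p `^ (d2 ^+ 2) * q `^ (d3 ^+ 2) <=
  r1 ^+ 2 * (p * q) + r2 ^+ 2 * (e * q) + r3 ^+ 2 * (e * p).
Proof.
move=> e0 p0 q0; have [E1 E2 E3] := dE.
have R1 : 0 < r1 ^+ 2 by rewrite exprn_gt0 ?br1_gt0.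
have R2 : 0 < r2 ^+ 2 by rewrite exprn_gt0 ?br2_gt0.
have R3 : 0 < r3 ^+ 2 by rewrite exprn_gt0 ?br3_gt0.
have PD (a u v : R) : 0 < u -> 0 < v -> a `^ (u + v) = a `^ u * a `^ v.
  by move=> u0 v0; rewrite powRD// gt_eqF ?addr_gt0.
rewrite E1 E2 E3 !PD//.
have := amgm3 (mulr_ge0 p0 q0) (mulr_ge0 e0 q0) (mulr_ge0 e0 p0) R1 R2 R3 (br_sum D).
rewrite !powRM//; apply: le_trans; rewrite le_eqVlt; apply/orP; left; apply/eqP; ring.
Qed.

Lemma sum4_eq (a b c d a' b' c' d' : R) : a <= a' -> b <= b' -> c <= c' -> d <= d' ->
  a + b + (c + d) = 1 -> a' + b' + (c' + d') <= 1 -> [/\ a = a', b = b', c = c' & d = d'].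
Proof. by move=> *; split; lra. Qed.

Lemma sum4_neq1 (a b c d : R) : a <= 0 -> b <= 0 -> c <= 0 -> d <= 0 ->
  a + b + (c + d) = 1 -> False.
Proof. by move=> *; lra. Qed.

Variables (f1 f2 f3 : R -> R).
Hypotheses (m1 : measurable_fun setT f1) (m2 : measurable_fun setT f2)
  (m3 : measurable_fun setT f3).
Hypotheses (f1_0 : forall x, 0 <= f1 x) (f2_0 : forall x, 0 <= f2 x)
  (f3_0 : forall x, 0 <= f3 x).
Hypotheses (i1 : (\int[leb]_x (f1 x)%:E = 1)%E) (i2 : (\int[leb]_x (f2 x)%:E = 1)%E)
  (i3 : (\int[leb]_x (f3 x)%:E = 1)%E) (BL1 : BLint D f1 f2 f3 = 1%E).

Definition cut (f : R -> R) (b : R -> bool) (s : bool) (x : R) : R :=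
  f x * (b x == s)%:R.

Lemma measurable_cut (f : R -> R) (A : set R) s : measurable_fun setT f -> measurable A ->
  measurable_fun setT (cut f (fun x => x \in A) s).
Proof.
move=> mf mA; apply: measurable_funM => //.
have -> : (fun x : R => ((x \in A) == s)%:R) = \1_(if s then A else ~` A) :> (R -> R).
  apply/funext => x; rewrite indicE; case: s; first by case: (x \in A).
  by rewrite in_setC; case: (x \in A).
by apply: measurable_indic; case: s => //; exact: measurableC.
Qed.

Lemma cut_ge0 f b s x : 0 <= f x -> 0 <= cut f b s x.
Proof. by move=> f0; rewrite mulr_ge0// ler0n. Qed.

Lemma cut_mass (f : R -> R) (A : set R) : measurable_fun setT f -> (forall x, 0 <= f x) ->
  measurable A -> (\int[leb]_x (f x)%:E = 1)%E ->
  exists m : bool -> R, [/\ forall s, 0 <= m s, m true + m false = 1 &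
    forall s, (\int[leb]_x (cut f (fun x => x \in A) s x)%:E = (m s)%:E)%E].
Proof.
move=> mf f0 mA If; pose c s := cut f (fun x => x \in A) s.
have mc s : measurable_fun setT (fun x : R => (c s x)%:E).
  by apply/measurable_EFinP; exact: measurable_cut.
have c0 s x : (0 <= (c s x)%:E)%E by rewrite lee_fin cut_ge0.
have E : (\int[leb]_x (c true x)%:E + \int[leb]_x (c false x)%:E = 1)%E.
  rewrite (integral_line_add (u := c true) (v := c false)).
  - rewrite -[RHS]If; apply: eq_integral => x _; congr _%:E.
    by rewrite /c /cut -mulrDr; case: (x \in A); rewrite /= ?addr0 ?add0r mulr1.
  - exact: measurable_cut.
  - exact: measurable_cut.
  - by move=> x; exact: cut_ge0.
  - by move=> x; exact: cut_ge0.
have fin s : (\int[leb]_x (c s x)%:E)%E \is a fin_num.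
  rewrite ge0_fin_numE; last exact: integral_ge0.
  apply: (@le_lt_trans _ _ 1%E); last exact: ltry.
  by rewrite -E; case: s; [rewrite leeDl|rewrite leeDr]; rewrite ?integral_ge0.
exists (fun s => fine (\int[leb]_x (c s x)%:E)%E); split.
- by move=> s; rewrite fine_ge0// integral_ge0.
- by apply: EFin_inj; rewrite EFinD !fineK.
- by move=> s; rewrite fineK.
Qed.

Variables (E A B : set R).
Hypotheses (mE : measurable E) (mA : measurable A) (mB : measurable B).
Hypothesis sgn : {ae (leb \x leb)%E, forall z : R * R,
  (z.1 \in E) = ((BLu2 D z \in A) == (BLu3 D z \in B))}.

Let cE := cut f1 (fun x => x \in E).
Let cA := cut f2 (fun x => x \in A).
Let cB := cut f3 (fun x => x \in B).

Lemma BLprod_cut s t u z : BLprod D (cE s) (cA t) (cB u) z =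
  BLprod D f1 f2 f3 z *
  [&& (z.1 \in E) == s, (BLu2 D z \in A) == t & (BLu3 D z \in B) == u]%:R.
Proof.
have P (a : R) (b : bool) c : 0 <= a -> 0 < c -> (a * b%:R) `^ c = a `^ c * b%:R.
  by move=> a0 c0; case: b; rewrite ?mulr1// !mulr0 powR0// gt_eqF.
have dp (d : R) : 0 < d -> 0 < d ^+ 2 by move=> ?; rewrite exprn_gt0.
rewrite /BLprod !P// ?dp ?bd1_gt0 ?bd2_gt0 ?bd3_gt0//.
by do 3 case: (_ == _); rewrite /= ?mulr1 ?mulr0 ?mul0r ?mulr0.
Qed.

Lemma BLint_cut_sum :
  (BLint D f1 f2 f3 = BLint D (cE true) (cA true) (cB true) +
   BLint D (cE true) (cA false) (cB false) +
   (BLint D (cE false) (cA true) (cB false) + BLint D (cE false) (cA false) (cB true)))%E.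
Proof.
pose G s t u := BLprod D (cE s) (cA t) (cB u).
have mG s t u : measurable_fun setT (G s t u).
  by apply: measurable_BLprod; exact: measurable_cut.
have G0 s t u z : 0 <= G s t u z by exact: BLprod_ge0.
have S1 := integral_plane_add (mG true true true) (mG true false false)
  (G0 true true true) (G0 true false false).
have S2 := integral_plane_add (mG false true false) (mG false false true)
  (G0 false true false) (G0 false false true).
have S3 := integral_plane_add
  (measurable_funD (mG true true true) (mG true false false))
  (measurable_funD (mG false true false) (mG false false true))
  (fun z => addr_ge0 (G0 true true true z) (G0 true false false z))
  (fun z => addr_ge0 (G0 false true false z) (G0 false false true z)).
transitivity (\int[leb \x leb]_z (G true true true z + G true false false z +
    (G false true false z + G false false true z))%:E)%E; last first.
  by apply: (etrans (esym S3)); rewrite -S1 -S2.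
have mS : measurable_fun setT (fun z => G true true true z + G true false false z +
    (G false true false z + G false false true z)).
  by apply: measurable_funD; exact: measurable_funD.
have aeS : {ae (leb \x leb)%E, forall z, BLprod D f1 f2 f3 z =
    G true true true z + G true false false z + (G false true false z + G false false true z)}.
  apply: ae_imply sgn => z Ez; rewrite /G !BLprod_cut -!mulrDr Ez.
  by case: (_ \in A); case: (_ \in B); rewrite /= ?addr0 ?add0r mulr1.
have T2 := @ae_integral_eq _ (measurableTypeR R * measurableTypeR R)%type R (leb \x leb)%E
  _ _ setT measurableT (measurable_BLprod D m1 m2 m3) mS aeS.
by rewrite /BLint T2.
Qed.

(* [sgn] leaves only four of the eight products of cut functions. Their
   integrals add up to [1] and are at most [K], whose four values add up to at
   most [1] by [BLmass_amgm]; so a piece with [0 < K] is extremal, hence made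
   of Gaussians, and the complementary cuts vanish. *)
Lemma BLextremal_sign :
  ({ae leb, forall x, x \in A} \/ {ae leb, forall x, x \notin A}) /\
  ({ae leb, forall x, x \in B} \/ {ae leb, forall x, x \notin B}).
Proof.
have [me [e0 eS eI]] := cut_mass m1 f1_0 mE i1.
have [mp [p0 pS pI]] := cut_mass m2 f2_0 mA i2.
have [mq [q0 qS qI]] := cut_mass m3 f3_0 mB i3.
pose K s t u := me s `^ (d1 ^+ 2) * mp t `^ (d2 ^+ 2) * mq u `^ (d3 ^+ 2).
have mcE s : measurable_fun setT (cE s) by exact: measurable_cut.
have mcA s : measurable_fun setT (cA s) by exact: measurable_cut.
have mcB s : measurable_fun setT (cB s) by exact: measurable_cut.
have cE0 s x : 0 <= cE s x by exact: cut_ge0.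
have cA0 s x : 0 <= cA s x by exact: cut_ge0.
have cB0 s x : 0 <= cB s x by exact: cut_ge0.
have le s t u : (BLint D (cE s) (cA t) (cB u) <= (K s t u)%:E)%E.
  by apply: BLint_le => //.
have fin s t u : BLint D (cE s) (cA t) (cB u) \is a fin_num.
  rewrite ge0_fin_numE; first by apply: le_lt_trans (le s t u) _; exact: ltry.
  by apply: integral_ge0 => z _; rewrite lee_fin BLprod_ge0.
pose I s t u := fine (BLint D (cE s) (cA t) (cB u)).
have IE s t u : (I s t u)%:E = BLint D (cE s) (cA t) (cB u) by rewrite fineK.
have IK s t u : I s t u <= K s t u by rewrite -lee_fin IE.
have IS : I true true true + I true false false + (I false true false + I false false true) = 1.
  have := BLint_cut_sum; rewrite BL1 -(IE true true true) -(IE true false false).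
  by rewrite -(IE false true false) -(IE false false true) -!EFinD => -[<-].
have Kle s t u : K s t u <= r1 ^+ 2 * (mp t * mq u) + r2 ^+ 2 * (me s * mq u) +
    r3 ^+ 2 * (me s * mp t) by exact: BLmass_amgm.
(* Under the sign rule any two of the three indices run through all four combinations. Each pair of
   masses thus sums to a product of totals equal to 1, and the weights [r_i^2] add up to 1. *)
have KS : K true true true + K true false false + (K false true false + K false false true) <= 1.
  have := lerD (lerD (Kle true true true) (Kle true false false))
    (lerD (Kle false true false) (Kle false false true)).
  move/le_trans; apply; rewrite le_eqVlt; apply/orP; left; apply/eqP.
  have <- := br_sum D; have -> : me false = 1 - me true by rewrite -eS addrAC subrr add0r.
  have -> : mp false = 1 - mp true by rewrite -pS addrAC subrr add0r.
  have -> : mq false = 1 - mq true by rewrite -qS addrAC subrr add0r.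
  ring.
have IKE s t u : s = (t == u) -> I s t u = K s t u.
  have [E1 E2 E3 E4] := sum4_eq (IK true true true) (IK true false false)
    (IK false true false) (IK false false true) IS KS.
  by case: t; case: u => ->.
have ext s t u : s = (t == u) -> 0 < me s -> 0 < mp t -> 0 < mq u ->
    {ae leb, forall x, 0 < cA t x} /\ {ae leb, forall x, 0 < cB u x}.
  move=> stu ep pp qp.
  have [a1 [a2 [a3 [v [v0 _ A2 A3]]]]] := BLint_extremal (mcE s) (mcA t) (mcB u)
    (cE0 s) (cA0 t) (cB0 u) ep pp qp (eI s) (pI t) (qI u)
    (etrans (esym (IE s t u)) (congr1 EFin (IKE s t u stu))).
  have pos (a b : R) (f : R -> R) : 0 < a -> {ae leb, forall x, f x = a * normal_pdf b v x} ->
      {ae leb, forall x, 0 < f x}.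
    by move=> a0; apply: ae_imply => x ->; rewrite mulr_gt0// normal_pdf_gt0// gt_eqF.
  by split; [exact: pos A2|exact: pos A3].
have cutP (C : set R) (f : R -> R) s : {ae leb, forall x, 0 < cut f (fun x => x \in C) s x} ->
    {ae leb, forall x, x \in C} \/ {ae leb, forall x, x \notin C}.
  case: s => H; [left|right]; apply: ae_imply H => x; rewrite /cut;
    by case: (x \in C); rewrite // mulr0 ltxx.
(* If no bound [K] were positive, the four integrals below them could not add up to 1. *)
have [t [u Ktu]] : exists t u, 0 < K (t == u) t u.
  apply: contrapT => /forallNP H.
  have {}H t u : K (t == u) t u <= 0.
    by rewrite leNgt; apply/negP => Kp; apply: (H t); exists u.
  have IH t u : I (t == u) t u <= 0 by apply: le_trans (IK _ _ _) (H t u).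
  exact: (sum4_neq1 (IH true true) (IH false false) (IH true false) (IH false true) IS).
have dn (d : R) : 0 < d -> d ^+ 2 != 0 by move=> ?; rewrite gt_eqF// exprn_gt0.
have mpos (x : R) : 0 <= x -> x != 0 -> 0 < x by rewrite lt_neqAle eq_sym => -> ->.
have [] := ext (t == u) t u erefl.
- apply: mpos => //; apply: contraTN Ktu => /eqP ms; rewrite /K ms powR0 ?dn ?bd1_gt0//.
  by rewrite !mul0r ltxx.
- apply: mpos => //; apply: contraTN Ktu => /eqP ms; rewrite /K ms (powR0 (dn _ (bd2_gt0 D))).
  by rewrite mulr0 mul0r ltxx.
- apply: mpos => //; apply: contraTN Ktu => /eqP ms; rewrite /K ms (powR0 (dn _ (bd3_gt0 D))).
  by rewrite mulr0 ltxx.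
by move=> /cutP ? /cutP.
Qed.

End BL_sign.

Section ae_eq_of_le.
Context d (T : measurableType d) (R : realType) (m : {measure set T -> \bar R}).
Local Open Scope ereal_scope.

Lemma ae_eq_of_le (f1 f2 : T -> \bar R) : measurable_fun setT f1 -> measurable_fun setT f2 ->
  (forall x, 0 <= f1 x) -> (forall x, f1 x <= f2 x) ->
  \int[m]_x f2 x < +oo -> \int[m]_x f1 x = \int[m]_x f2 x ->
  {ae m, forall x, f2 x \is a fin_num /\ f1 x = f2 x}.
Proof.
move=> m1 m2 f1_0 f12 f2oo E; have f2_0 x : 0 <= f2 x by exact: le_trans (f12 x).
have i2 : m.-integrable setT f2.
  apply/integrableP; split => //.
  by under eq_integral => x _ do rewrite gee0_abs//.
have i1 : m.-integrable setT f1.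
  apply/integrableP; split => //.
  by under eq_integral => x _ do rewrite gee0_abs//; rewrite E.
have md : measurable_fun setT (f2 \- f1) by exact: emeasurable_funB.
have fin := ae_conj (integrable_ae measurableT i1) (integrable_ae measurableT i2).
have : \int[m]_x `|(f2 \- f1) x| = 0.
  transitivity (\int[m]_x (f2 \- f1) x).
    apply: ae_eq_integral => //; first exact: measurableT_comp.
    apply: ae_imply fin => x [/(_ I) F1 /(_ I) F2] _.
    by rewrite gee0_abs// sube_ge0 ?F1 ?F2// f12.
  rewrite integralB// E subee// ge0_fin_numE//.
  exact: integral_ge0.
move/(ae_eq_integral_abs m measurableT md) => H.
apply: ae_imply (ae_conj H fin) => x [/(_ I) /= e [/(_ I) F1 /(_ I) F2]]; split => //.
by move: e; rewrite -(fineK F1) -(fineK F2) -EFinB => -[] /eqP; rewrite subr_eq0 => /eqP ->.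
Qed.

End ae_eq_of_le.

Section young.
Context (R : realType) (D : BLdatum R).
Notation leb := (@lebesgue_measure R).
Notation mR := (measurableTypeR R).
Notation np := (@normal_pdf R).
Notation r1 := (br1 D). Notation r2 := (br2 D). Notation r3 := (br3 D).
Notation d1 := (bd1 D). Notation d2 := (bd2 D). Notation d3 := (bd3 D).
Variables (p2 p3 : R) (p2_gt0 : 0 < p2) (p3_gt0 : 0 < p3)
  (p2E : p2^-1 = d2 ^+ 2) (p3E : p3^-1 = d3 ^+ 2).
Variables (mu : {sigma_finite_measure set mR -> \bar R}) (w : R -> R).
Hypotheses (mw : measurable_fun setT w) (w0 : forall x, 0 < w x)
  (muE : forall A, measurable A -> (mu A = \int[leb]_(x in A) (w x)%:E)%E)
  (wD : forall z, BLprod D w w w z = w z.1 * w z.2).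
Variables (g h : R -> R) (mg : measurable_fun setT g) (mh : measurable_fun setT h).
Variables (b c : R).

(** The Lebesgue density of the measure [|g|^p dmu], the form in which [g] and [h] enter the
    Brascamp-Lieb inequality. *)
Definition wpow (g : R -> R) (p : R) (x : R) := `|g x| `^ p * w x.

Hypotheses (intg : (\int[leb]_x (wpow g p2 x)%:E = b%:E)%E)
  (inth : (\int[leb]_x (wpow h p3 x)%:E = c%:E)%E).

Definition BLgh (z : R * R) := `|g (BLu2 D z)| * `|h (BLu3 D z)|.

Definition BLmarginal (x : R) : \bar R := (\int[mu]_y (BLgh (x, y))%:E)%E.

Let F := BLmarginal.
(** [q] is the exponent conjugate to [1 / d1^2 = p1], and [M] below is the product of the norms of
    [g] and [h], as [d2^2 = 1/p2] and [d3^2 = 1/p3]. *)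
Let q := (1 - d1 ^+ 2)^-1.
Let M := b `^ (d2 ^+ 2) * c `^ (d3 ^+ 2).

Lemma measurable_wpow (u : R -> R) p : measurable_fun setT u -> measurable_fun setT (wpow u p).
Proof.
move=> mu'; apply: measurable_funM => //.
apply: (measurableT_comp (measurable_powR p)).
exact: (measurableT_comp (@normr_measurable R setT) mu').
Qed.

Lemma wpow_ge0 (u : R -> R) p x : 0 <= wpow u p x.
Proof. by rewrite mulr_ge0 ?powR_ge0 ?ltW. Qed.

Lemma measurable_BLgh : measurable_fun setT BLgh.
Proof.
by apply: measurable_funM; apply: (measurableT_comp (@normr_measurable R setT));
  apply: measurableT_comp => //; exact: measurable_lin2.
Qed.

Lemma BLgh_ge0 z : 0 <= BLgh z. Proof. by rewrite mulr_ge0. Qed.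

Let mghxr x : measurable_fun setT (fun y : R => BLgh (x, y)).
Proof. by apply: (measurableT_comp measurable_BLgh); exact: measurable_fun_pair. Qed.

Let mghx x : measurable_fun setT (fun y : R => (BLgh (x, y))%:E).
Proof. exact/measurable_EFinP. Qed.

Lemma BLmarginalE x : (F x = \int[leb]_y (BLgh (x, y) * w y)%:E)%E.
Proof.
rewrite /F /BLmarginal (weight_integral mw w0 muE (mghx x)).
  by apply: eq_integral => y _; rewrite EFinM.
by move=> y; rewrite lee_fin BLgh_ge0.
Qed.

Lemma measurable_marginal (k : R * R -> R) : measurable_fun setT k -> (forall z, 0 <= k z) ->
  measurable_fun setT (fun x => \int[mu]_y (k (x, y))%:E)%E.
Proof.
move=> mk k0.
have mkx x : measurable_fun setT (fun y : R => (k (x, y))%:E).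
  by apply/measurable_EFinP; apply: (measurableT_comp mk); exact: measurable_fun_pair.
have -> : (fun x => \int[mu]_y (k (x, y))%:E)%E = (fun x => \int[leb]_y (k (x, y) * w y)%:E)%E.
  apply/funext => x; rewrite (weight_integral mw w0 muE (mkx x)).
    by apply: eq_integral => y _; rewrite EFinM.
  by move=> y; rewrite lee_fin.
apply: (@measurable_tonelli1 R (fun z => (k z * w z.2)%:E)).
  by apply/measurable_EFinP; apply: measurable_funM => //; exact: measurableT_comp.
by move=> z; rewrite lee_fin mulr_ge0// ltW.
Qed.

Lemma measurable_BLmarginal : measurable_fun setT F.
Proof. exact: (measurable_marginal measurable_BLgh BLgh_ge0). Qed.

Lemma BLmarginal_ge0 x : (0 <= F x)%E.
Proof. by apply: integral_ge0 => y _; rewrite lee_fin BLgh_ge0. Qed.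

Lemma BLprod_wpow (k : R -> R) z : (forall x, 0 <= k x) ->
  BLprod D (fun x => k x * w x) (wpow g p2) (wpow h p3) z =
  k z.1 `^ (d1 ^+ 2) * BLgh z * (w z.1 * w z.2).
Proof.
move=> k0; have wg x : 0 <= w x by exact: ltW.
rewrite BLprodM//; try by move=> x; exact: powR_ge0.
rewrite wD; congr (_ * _); rewrite /BLprod /BLgh -mulrA; congr (_ * _).
rewrite -!powRrM -p2E -p3E !mulfV ?gt_eqF// !powRr1//.
Qed.

(** Raising [wpow g p2] and [wpow h p3] to the powers [1/p2] and [1/p3] returns [|g|] and [|h|], and
    the remaining powers of [w] combine through [wD] into the density of the product measure;
    Tonelli does the rest. *)
Lemma BLdual (k : R -> R) : measurable_fun setT k -> (forall x, 0 <= k x) ->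
  (\int[mu]_x ((k x `^ (d1 ^+ 2))%:E * F x) =
   BLint D (fun x => k x * w x)%R (wpow g p2) (wpow h p3))%E.
Proof.
move=> mk k0; have wg x : 0 <= w x by exact: ltW.
have mkp : measurable_fun setT (fun x => k x `^ (d1 ^+ 2)).
  exact: (measurableT_comp (measurable_powR _) mk).
have mkF : measurable_fun setT (fun x => (k x `^ (d1 ^+ 2))%:E * F x)%E.
  by apply: emeasurable_funM; [exact/measurable_EFinP|exact: measurable_BLmarginal].
rewrite (weight_integral mw w0 muE mkF) => [|x]; last first.
  by rewrite mule_ge0 ?lee_fin ?powR_ge0 ?BLmarginal_ge0.
pose G z := (k z.1 `^ (d1 ^+ 2) * BLgh z * (w z.1 * w z.2))%:E.
have mG : measurable_fun setT G.
  apply/measurable_EFinP; apply: measurable_funM; last exact: measurable_weight2.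
  apply: measurable_funM; last exact: measurable_BLgh.
  exact: (measurableT_comp mkp).
have G0 z : (0 <= G z)%E by rewrite lee_fin !mulr_ge0 ?powR_ge0.
transitivity (\int[leb \x leb]_z G z)%E; last first.
  by apply: eq_integral => z _; rewrite /G -BLprod_wpow.
rewrite (tonelli1 mG G0); apply: eq_integral => x _.
rewrite BLmarginalE muleAC -EFinM -ge0_integralZl//.
- apply: eq_integral => y _; rewrite /G/= -EFinM; congr _%:E; ring.
- by apply/measurable_EFinP; exact: (measurable_funM (mghxr x) mw).
- by move=> y _; rewrite lee_fin mulr_ge0 ?BLgh_ge0.
- by rewrite lee_fin mulr_ge0 ?powR_ge0.
Qed.

Let d1_01 : 0 < 1 - d1 ^+ 2 < 1.
Proof.
have r1p := br1_gt0 D; have d1p := bd1_gt0 D; have E := bd1E D.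
have : 0 < br1 D ^+ 2 by rewrite exprn_gt0.
have : 0 < d1 ^+ 2 by rewrite exprn_gt0.
by rewrite E => ? ?; apply/andP; split; lra.
Qed.

Let q_gt1 : 1 < q.
Proof. by case/andP: d1_01 => ? ?; rewrite /q invf_gt1. Qed.

Let q_gt0 : 0 < q. Proof. exact: lt_trans q_gt1. Qed.

Let qE : q = q * d1 ^+ 2 + 1.
Proof.
have q0 : 1 - d1 ^+ 2 != 0 by case/andP: d1_01 => ? ?; rewrite gt_eqF.
by rewrite /q; field.
Qed.

Let qn : q != 0. Proof. by rewrite gt_eqF. Qed.

Let M0 : 0 <= M. Proof. by rewrite mulr_ge0 ?powR_ge0. Qed.

Lemma BLdual_le (k : R -> R) (a : R) : measurable_fun setT k -> (forall x, 0 <= k x) ->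
  (\int[mu]_x (k x)%:E = a%:E)%E ->
  (\int[mu]_x ((k x `^ (d1 ^+ 2))%:E * F x) <= (a `^ (d1 ^+ 2) * M)%:E)%E.
Proof.
move=> mk k0 Ik; have wg x : 0 <= w x by exact: ltW.
rewrite BLdual// mulrA; apply: BLint_le.
- exact: measurable_funM.
- exact: measurable_wpow.
- exact: measurable_wpow.
- by move=> x; rewrite mulr_ge0.
- by move=> x; exact: wpow_ge0.
- by move=> x; exact: wpow_ge0.
- rewrite -Ik (weight_integral mw w0 muE)//; first exact/measurable_EFinP.
- exact: intg.
- exact: inth.
Qed.

(* Duality with bounded truncations [k] of [F `^ q], for which
   [k <= k `^ (d1 ^+ 2) * F]: finiteness of [\int k] allows to divide. *)
Lemma BLmarginal_norm_le : (\int[mu]_x (F x `^ q) <= (M `^ q)%:E)%E.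
Proof.
have /sigma_finiteP[S [TS ndS Soo]] := sigma_finiteT mu.
have mF := measurable_BLmarginal.
pose m (n : nat) x := fine (Order.min (F x) n%:R%:E).
have mE n x : ((m n x)%:E = Order.min (F x) n%:R%:E)%E.
  rewrite /m fineK// ge0_fin_numE; last by rewrite le_min BLmarginal_ge0 lee_fin ler0n.
  by rewrite gt_min ltry orbT.
have m0 n x : 0 <= m n x by rewrite -lee_fin mE le_min BLmarginal_ge0 lee_fin ler0n.
have mF' n x : ((m n x)%:E <= F x)%E by rewrite mE ge_min lexx.
have mn n x : m n x <= n%:R by rewrite -lee_fin mE ge_min lexx orbT.
have mm n : measurable_fun setT (m n).
  apply/measurable_EFinP; have -> : EFin \o m n = (fun x => Order.min (F x) n%:R%:E).
    by apply/funext => x /=; rewrite mE.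
  by apply: measurable_mine.
have mS n : measurable (S n) by case: (Soo n).
have mI n : measurable_fun setT (\1_(S n) : mR -> R) by exact: measurable_indic.
pose k n x := m n x `^ q * \1_(S n) x.
have k0 n x : 0 <= k n x by rewrite mulr_ge0 ?powR_ge0.
have mk n : measurable_fun setT (k n).
  apply: measurable_funM; first exact: (measurableT_comp (measurable_powR q) (mm n)).
  exact: mI.
have mkE n : measurable_fun setT (fun x : R => (k n x)%:E) by exact/measurable_EFinP.
have mIE n : measurable_fun setT (fun x : mR => (\1_(S n) x)%:E : \bar R).
  exact/measurable_EFinP.
have kfin n : (\int[mu]_x (k n x)%:E \is a fin_num)%E.
  rewrite ge0_fin_numE; last by apply: integral_ge0 => x _; rewrite lee_fin.
  apply: (@le_lt_trans _ _ (\int[mu]_x ((n%:R `^ q)%:E * (\1_(S n) x)%:E))%E).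
    apply: ge0_le_integral; first exact: measurableT.
    - by move=> x _; rewrite lee_fin.
    - exact: mkE.
    - by apply: emeasurable_funM => //; exact: mIE.
    - move=> x _; rewrite -EFinM lee_fin ler_wpM2r// ge0_ler_powR// ?nnegrE//.
      exact: ltW.
  rewrite ge0_integralZl//.
  - rewrite integral_indic// setIT lte_mul_pinfty ?lee_fin ?powR_ge0//.
    by case: (Soo n).
have kle n : (\int[mu]_x (k n x)%:E <= (M `^ q)%:E)%E.
  set I := (\int[mu]_x (k n x)%:E)%E; pose a := fine I.
  have aI : a%:E = I by rewrite fineK// kfin.
  have a0 : 0 <= a by rewrite fine_ge0// integral_ge0// => x _; rewrite lee_fin.
  have := BLdual_le (mk n) (k0 n) (esym aI).
  have le1 : (I <= \int[mu]_x ((k n x `^ (d1 ^+ 2))%:E * F x))%E.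
    apply: ge0_le_integral; first exact: measurableT.
    - by move=> x _; rewrite lee_fin.
    - exact: mkE.
    - apply: emeasurable_funM => //.
      have mkp : measurable_fun setT (fun x : R => (k n x `^ (d1 ^+ 2))%:E).
        by apply/measurable_EFinP; exact: (measurableT_comp (measurable_powR _) (mk n)).
      exact: mkp.
    - move=> x _; rewrite /k indicE; have [_|_] := boolP (x \in S n); last first.
        by rewrite mulr0 mule_ge0 ?lee_fin ?powR_ge0 ?BLmarginal_ge0.
      rewrite !mulr1 -powRrM; have := m0 n x; rewrite le_eqVlt => /orP[/eqP <-|mp].
        by rewrite powR0 ?gt_eqF// mule_ge0 ?lee_fin ?powR_ge0 ?BLmarginal_ge0.
      rewrite [in X in (X <= _)%E]qE powRD ?(gt_eqF mp) ?implybT// powRr1// EFinM.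
      by rewrite lee_wpmul2l ?lee_fin ?powR_ge0// mF'.
  move=> le2; have := le_trans le1 le2; rewrite -aI !lee_fin.
  have := a0; rewrite le_eqVlt => /orP[/eqP <- _|ap]; first exact: powR_ge0.
  have c1p : 0 < a `^ (d1 ^+ 2) by rewrite powR_gt0.
  have aE : a = a `^ (d1 ^+ 2) * a `^ (1 - d1 ^+ 2).
    by rewrite -powRD ?(gt_eqF ap) ?implybT// addrC subrK powRr1.
  (* The duality bound reads [a <= a^(d1^2) M]; dividing is legitimate since [a] is finite and
     positive. *)
  move=> le3; have {}le3 : a `^ (1 - d1 ^+ 2) <= M by rewrite -(ler_pM2l c1p) -aE.
  have -> : a = (a `^ (1 - d1 ^+ 2)) `^ q.
    by rewrite -powRrM /q mulfV ?powRr1// gt_eqF//; case/andP: d1_01.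
  by rewrite ge0_ler_powR ?nnegrE ?powR_ge0// ltW.
apply: (@fatou_ae _ mR R mu (fun n x => (k n x)%:E) (fun x => F x `^ q)%E) => //.
- have mFq : measurable_fun setT (fun x : R => F x `^ q)%E.
    exact: (measurableT_comp (measurable_poweR _) mF).
  exact: mFq.
- by move=> x; exact: poweR_ge0.
- apply: ae_all; first exact: measure0.
  move=> x; have [N _ Sx] : (\bigcup_n S n) x by rewrite -TS.
  have kE n : (N <= n)%N -> k n x = m n x `^ q.
    move=> Nn; rewrite /k indicE mem_set ?mulr1//.
    by have /subsetPset := ndS _ _ Nn; apply.
  case Fx: (F x) (BLmarginal_ge0 x) => [r| |] // r0.
    apply/cvg_EFin; first exact: nearW.
    apply: cvg_near_cst; near=> n => /=.
    rewrite kE; last by near: n; exact: nbhs_infty_ge.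
    congr (_ `^ q); apply: EFin_inj; rewrite mE Fx; apply/min_idPl.
    by rewrite lee_fin; near: n; exact: nbhs_infty_ger.
  rewrite poweRyr ?gt_eqF//; apply/cvgeyPge => A; near=> n.
  rewrite kE; last by near: n; exact: nbhs_infty_ge.
  have -> : m n x = n%:R by apply: EFin_inj; rewrite mE Fx; apply/min_idPr; exact: leey.
  rewrite lee_fin; apply: (@le_trans _ _ n%:R); first by near: n; exact: nbhs_infty_ger.
  have n1 : 1 <= n%:R :> R by rewrite ler1n; near: n; exact: nbhs_infty_gt.
  by rewrite -[leLHS]powRr1// ler_powR// ltW.
Unshelve. all: by end_near. Qed.

Let phi (z : R * R) := g (BLu2 D z) * h (BLu3 D z).

Definition BLconv (x : R) : \bar R := (\int[mu]_y (phi (x, y))%:E)%E.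

(** [Fp] and [Fm] are the positive and negative contributions on the line over [x]: the signed
    integral is their difference and [F] is their sum. Where [|BLconv| = F] is finite, one of the
    two vanishes. *)
Let Fp x := (\int[mu]_y (Num.max (phi (x, y)) 0)%:E)%E.
Let Fm x := (\int[mu]_y (Num.max (- phi (x, y)) 0)%:E)%E.

Let mphi : measurable_fun setT phi.
Proof.
by apply: measurable_funM; apply: measurableT_comp => //; exact: measurable_lin2.
Qed.

Let mphix x : measurable_fun setT (fun y : R => phi (x, y)).
Proof. by apply: (measurableT_comp mphi); exact: measurable_fun_pair. Qed.

Let max0 (a : R) : 0 <= Num.max a 0. Proof. by rewrite le_max lexx orbT. Qed.

Let mp : measurable_fun setT (fun z => Num.max (phi z) 0).
Proof. exact: measurable_maxr. Qed.

Let mm : measurable_fun setT (fun z => Num.max (- phi z) 0).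
Proof. by apply: measurable_maxr => //; exact: measurableT_comp. Qed.

Let mFp : measurable_fun setT Fp.
Proof. exact: (measurable_marginal mp (fun z => max0 (phi z))). Qed.

Let mFm : measurable_fun setT Fm.
Proof. exact: (measurable_marginal mm (fun z => max0 (- phi z))). Qed.

Let Fp0 x : (0 <= Fp x)%E. Proof. by apply: integral_ge0 => y _; rewrite lee_fin. Qed.
Let Fm0 x : (0 <= Fm x)%E. Proof. by apply: integral_ge0 => y _; rewrite lee_fin. Qed.

Let PhiE x : BLconv x = (Fp x - Fm x)%E.
Proof.
rewrite /BLconv (integralE mu setT (fun y => (phi (x, y))%:E)); congr (_ - _)%E.
  by apply: eq_integral => y _; rewrite funeposE -EFin_max.
by apply: eq_integral => y _; rewrite funenegE -EFin_max.
Qed.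

Let mpx x : measurable_fun setT (fun y : mR => (Num.max (phi (x, y)) 0)%:E).
Proof.
have H : measurable_fun setT (fun y : R => (Num.max (phi (x, y)) 0)%:E).
  by apply/measurable_EFinP; exact: measurable_maxr.
exact: H.
Qed.

Let mmx x : measurable_fun setT (fun y : mR => (Num.max (- phi (x, y)) 0)%:E).
Proof.
have H : measurable_fun setT (fun y : R => (Num.max (- phi (x, y)) 0)%:E).
  by apply/measurable_EFinP; apply: measurable_maxr => //; exact: measurableT_comp.
exact: H.
Qed.

Let FE x : F x = (Fp x + Fm x)%E.
Proof.
rewrite /F /BLmarginal /Fp /Fm -ge0_integralD//.
- apply: eq_integral => y _; rewrite -EFinD; congr _%:E.
  rewrite /BLgh -normrM -/(phi (x, y)).
  have [p0|p0] := leP 0 (phi (x, y)).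
    by rewrite ger0_norm// max_r ?oppr_le0// addr0.
  by rewrite ltr0_norm// max_l ?oppr_ge0 ?ltW// add0r.
- by move=> y _; rewrite lee_fin.
- by move=> y _; rewrite lee_fin.
Qed.

Let mPhi : measurable_fun setT BLconv.
Proof.
have -> : BLconv = (fun x => Fp x - Fm x)%E by apply/funext => x; rewrite PhiE.
exact: emeasurable_funB.
Qed.

Let PhiF x : (`|BLconv x| <= F x)%E.
Proof.
rewrite PhiE FE; apply: le_trans (lee_abs_sub _ _) _.
by rewrite !gee0_abs.
Qed.

Let mFq : measurable_fun setT (fun x : mR => F x `^ q)%E.
Proof.
have H : measurable_fun setT (fun x : R => F x `^ q)%E.
  exact: (measurableT_comp (measurable_poweR _) measurable_BLmarginal).
exact: H.
Qed.

Let mPhiq : measurable_fun setT (fun x : mR => `|BLconv x| `^ q)%E.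
Proof.
have H : measurable_fun setT (fun x : R => `|BLconv x| `^ q)%E.
  by apply: (measurableT_comp (measurable_poweR _)); exact: measurableT_comp.
exact: H.
Qed.

Let PhiFq x : (`|BLconv x| `^ q <= F x `^ q)%E.
Proof.
apply: gt0_ler_poweR; first exact: ltW.
- by rewrite in_itv/= abse_ge0 leey.
- by rewrite in_itv/= BLmarginal_ge0 leey.
- exact: PhiF.
Qed.

Let PhiFint : (\int[mu]_x (`|BLconv x| `^ q) <= \int[mu]_x (F x `^ q))%E.
Proof.
apply: ge0_le_integral; first exact: measurableT.
- by move=> x _; exact: poweR_ge0.
- exact: mPhiq.
- exact: mFq.
- by move=> x _; exact: PhiFq.
Qed.

Let MqK : ((M `^ q)%:E `^ q^-1 = M%:E)%E.
Proof. by rewrite poweR_EFin -powRrM mulfV// powRr1. Qed.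

Lemma young_le : ('N[mu]_q%:E [BLconv] <= M%:E)%E.
Proof.
rewrite unlock -MqK; apply: gt0_ler_poweR.
- by rewrite invr_ge0 ltW.
- rewrite in_itv/= leey andbT; apply: integral_ge0 => x _; exact: poweR_ge0.
- by rewrite in_itv/= leey andbT lee_fin powR_ge0.
- exact: le_trans PhiFint BLmarginal_norm_le.
Qed.

Let abs_cases x : F x \is a fin_num -> `|BLconv x|%E = F x -> Fm x = 0%E \/ Fp x = 0%E.
Proof.
rewrite PhiE FE fin_numD => /andP[].
case: (Fp x) (Fp0 x) => // p p0 _; case: (Fm x) (Fm0 x) => // m m0 _.
rewrite -EFinB -EFinD /= => -[]; rewrite !lee_fin in p0 m0.
have [pm|pm] := leP 0 (p - m).
  by rewrite ger0_norm// => E; left; congr _%:E; lra.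
by rewrite ltr0_norm// => E; right; congr _%:E; lra.
Qed.

Let ae_zero_max (u : R -> R) : measurable_fun setT u ->
  (\int[mu]_y (Num.max (u y) 0)%:E = 0)%E -> {ae leb, forall y, u y <= 0}.
Proof.
move=> mu'; have mM : measurable_fun setT (fun y : R => Num.max (u y) 0).
  exact: measurable_maxr.
have mME : measurable_fun setT (fun y : R => (Num.max (u y) 0)%:E) by exact/measurable_EFinP.
rewrite (weight_integral mw w0 muE mME); last by move=> y; rewrite lee_fin.
move=> I0.
have := @ae_zero R (fun y => Num.max (u y) 0 * w y) _ _ _.
have mMw : measurable_fun setT (fun y : R => Num.max (u y) 0 * w y).
  exact: measurable_funM.
move=> /(_ mMw _ I0) => H.
have {}H := H (fun y => mulr_ge0 (max0 (u y)) (ltW (w0 y))).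
apply: ae_imply H => y /eqP; rewrite mulf_eq0 (gt_eqF (w0 y)) orbF => /eqP e.
by rewrite -e le_max lexx.
Qed.

(** The norm of [BLconv] is at most that of [F], itself at most [M], so equality makes
    [|BLconv| = F] almost everywhere and [F] extremal. Positivity of both masses allows
    normalization to an extremal triple of probability densities. *)
Lemma young_eq : 0 < b -> 0 < c -> ('N[mu]_q%:E [BLconv] = M%:E)%E ->
  [/\ {ae leb, forall x, 0 <= g x} \/ {ae leb, forall x, g x <= 0},
      {ae leb, forall x, 0 <= h x} \/ {ae leb, forall x, h x <= 0} &
      exists a2 a3 s, [/\ 0 < s, {ae leb, forall x, wpow g p2 x = b * np a2 s x} &
        {ae leb, forall x, wpow h p3 x = c * np a3 s x}]].
Proof.
move=> bp cp NE.
have X : (\int[mu]_x (`|BLconv x| `^ q) = (M `^ q)%:E)%E.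
  by rewrite -(poweR_Lnorm mu BLconv qn) NE poweR_EFin.
have Y : (\int[mu]_x (F x `^ q) = (M `^ q)%:E)%E.
  by apply/eqP; rewrite eq_le BLmarginal_norm_le/= -X PhiFint.
have aeF : {ae leb, forall x, F x \is a fin_num /\ `|BLconv x|%E = F x}.
  apply/(weight_ae mw w0 muE).
  have := @ae_eq_of_le _ mR R mu (fun x => `|BLconv x| `^ q)%E (fun x => F x `^ q)%E
    mPhiq mFq (fun x => poweR_ge0 _ _) PhiFq.
  rewrite X Y ltry => /(_ erefl erefl); apply: ae_imply => x [fin e].
  split.
    rewrite ge0_fin_numE ?BLmarginal_ge0//; apply: (@lty_poweRy _ _ q) => //.
    by rewrite -ge0_fin_numE ?poweR_ge0.
  have K (a : \bar R) : (0 <= a)%E -> ((a `^ q) `^ q^-1 = a)%E.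
    by move=> a0; rewrite -poweRrM mulfV// poweRe1.
  by rewrite -[LHS]K ?abse_ge0// -[RHS]K ?BLmarginal_ge0// e.
(* The extremal test function in the duality: [k^(d1^2) F = F^q] wherever [F] is finite, since
   [q d1^2 + 1 = q]. *)
pose k x := fine (F x) `^ q.
have k0 x : 0 <= k x by exact: powR_ge0.
have mk : measurable_fun setT k.
  by apply: (measurableT_comp (measurable_powR q)); exact: (measurableT_comp _ measurable_BLmarginal).
pose a := M `^ q.
have Mp : 0 < M by rewrite mulr_gt0// powR_gt0.
have ap : 0 < a by rewrite powR_gt0.
have aeFmu : {ae mu, forall x, F x \is a fin_num}.
  by apply/(weight_ae mw w0 muE); apply: ae_imply aeF => x [].
have mkE : measurable_fun setT (fun x : mR => (k x)%:E) by exact/measurable_EFinP.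
have Ik : (\int[mu]_x (k x)%:E = a%:E)%E.
  rewrite -Y; apply: ge0_ae_eq_integral => //.
  - by move=> x _; rewrite lee_fin.
  - by move=> x _; exact: poweR_ge0.
  - apply: ae_imply aeFmu => x fin _.
    by rewrite /k -poweR_EFin fineK.
pose f1 x := k x * w x.
have wg x : 0 <= w x by exact: ltW.
have mf1 : measurable_fun setT f1 by exact: measurable_funM.
have f1_0 x : 0 <= f1 x by rewrite mulr_ge0.
have f2_0 := wpow_ge0 g p2. have f3_0 := wpow_ge0 h p3.
have mf2 := measurable_wpow p2 mg. have mf3 := measurable_wpow p3 mh.
have I1 : (\int[leb]_x (f1 x)%:E = a%:E)%E.
  by rewrite -Ik (weight_integral mw w0 muE mkE)// => x; rewrite lee_fin.
have powq (t : R) : 0 <= t -> (t `^ q) `^ (d1 ^+ 2) * t = t `^ q.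
  move=> t0; rewrite -powRrM -[X in _ * X](powRr1 t0) -powRD -?qE//.
  by rewrite (negbTE qn).
have BL : BLint D f1 (wpow g p2) (wpow h p3) =
    (a `^ (d1 ^+ 2) * b `^ (d2 ^+ 2) * c `^ (d3 ^+ 2))%:E.
  rewrite -mulrA -/M /a powq// -/a -Y.
  rewrite -(BLdual mk k0).
  apply: ge0_ae_eq_integral => //.
  - have mkp : measurable_fun setT (fun x : R => (k x `^ (d1 ^+ 2))%:E).
      by apply/measurable_EFinP; exact: (measurableT_comp (measurable_powR _) mk).
    have mFR : measurable_fun setT (fun x : mR => F x) by exact: measurable_BLmarginal.
    by apply: emeasurable_funM; [exact: mkp|exact: mFR].
  - by move=> x _; rewrite mule_ge0 ?lee_fin ?powR_ge0 ?BLmarginal_ge0.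
  - by move=> x _; exact: poweR_ge0.
  - apply: ae_imply aeFmu => x fin _.
    rewrite -/F -{1 2}(fineK fin) -EFinM poweR_EFin; congr _%:E.
    by apply: powq; rewrite fine_ge0 ?BLmarginal_ge0.
have [m1 [m2 [m3 [s [s0 A1 A2 A3]]]]] := BLint_extremal mf1 mf2 mf3 f1_0 f2_0 f3_0
  ap bp cp I1 intg inth BL.
have BLn := BLint_normalize mf1 mf2 mf3 f1_0 f2_0 f3_0 ap bp cp BL.
have [n1 n1_0 In1] := normalize_mass mf1 f1_0 ap I1.
have [n2 n2_0 In2] := normalize_mass mf2 f2_0 bp intg.
have [n3 n3_0 In3] := normalize_mass mf3 f3_0 cp inth.
have nz (u : R -> R) p e m : p != 0 -> 0 < e -> {ae leb, forall x, wpow u p x = e * np m s x} ->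
    {ae leb, forall x, u x != 0}.
  move=> pn e0; apply: ae_imply => x; apply: contra_eqN => /eqP ux.
  rewrite /wpow ux normr0 powR0// mul0r lt_eqF// mulr_gt0// normal_pdf_gt0//.
  by rewrite gt_eqF.
have p2n : p2 != 0 by rewrite gt_eqF.
have p3n : p3 != 0 by rewrite gt_eqF.
have g_nz := nz g p2 b m2 p2n bp A2.
have h_nz := nz h p3 c m3 p3n cp A3.
(* The vertical lines on which the integrand is almost everywhere nonnegative; on almost every other
   line [Fp] vanishes and the integrand is nonpositive. *)
pose E := [set x | Fm x = 0%E].
pose A := [set x : R | 0 <= g x].
pose B := [set x : R | 0 <= h x].
have mge (u : R -> R) : measurable_fun setT u -> measurable [set x : R | 0 <= u x].
  move=> mu'; have := @measurable_fun_le _ mR R setT (cst 0) u measurableT.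
  by rewrite setTI; apply => //.
have mE : measurable (E : set R).
  by have := mFm measurableT (emeasurable_set1 0%E); rewrite setTI.
have sgn : {ae (leb \x leb)%E, forall z : R * R, (z.1 \in E -> 0 <= phi z) /\
    (z.1 \notin E -> phi z <= 0)}.
  pose A0 := ((fst @^-1` E) `&` [set z | phi z < 0]) `|`
    ((fst @^-1` (~` E)) `&` [set z | 0 < phi z]).
  have mfst (C : set R) : measurable C -> measurable ((fst : R * R -> R) @^-1` C).
    move=> mC; rewrite -[_ @^-1` _]setTI.
    by have : measurable_fun setT (fst : R * R -> R) by []; apply.
  have mlt (u : R * R -> R) : measurable_fun setT u -> measurable [set z | u z < 0].
    move=> mu'; have -> : [set z | u z < 0] = ~` [set z | 0 <= u z].
      by apply/seteqP; split => z /=; rewrite ltNge => /negP.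
    apply: measurableC; have := @measurable_fun_le _ _ R setT (cst 0) u measurableT.
    by rewrite setTI; apply => //.
  have mgt : measurable [set z | 0 < phi z].
    have -> : [set z | 0 < phi z] = [set z | - phi z < 0].
      by apply/seteqP; split => z /=; rewrite oppr_lt0.
    by apply: mlt; exact: measurableT_comp.
  have {}mlt := mlt _ mphi.
  have mA0 : measurable A0.
    by apply: measurableU; apply: measurableI => //; apply: mfst => //; exact: measurableC.
  apply: (ae_prod mA0) => [z nQ|].
    have [zE|zE] := boolP (z.1 \in E); [left|right].
      split; first by move: zE; rewrite inE.
      rewrite /= ltNge; apply/negP => p; apply: nQ; split => //.
      by rewrite zE.
    split; first by move: zE; rewrite notin_setE.
    rewrite /= ltNge; apply/negP => p; apply: nQ; split => //.
    by rewrite (negbTE zE).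
  apply: ae_imply aeF => x [fin ex].
  have mNphi : measurable_fun setT (fun y : R => - phi (x, y)) by exact: measurableT_comp.
  have [Fmx|Fmx] := eqVneq (Fm x) 0%E.
    apply: ae_imply (ae_zero_max mNphi Fmx) => y; rewrite oppr_le0 => p [[_ /=]|[/= nE _]].
      by rewrite ltNge p.
    exact: nE.
  have [/eqP|Fpx] := abs_cases fin ex; first by rewrite (negbTE Fmx).
  apply: ae_imply (ae_zero_max (mphix x) Fpx) => y p [[/= /eqP]|[_ /=]].
    by rewrite (negbTE Fmx).
  by rewrite ltNge p.
(* Both functions are nonzero almost everywhere, being powers of Gaussians up to sign, so weak
   inequalities on the product determine whether the signs agree. *)
have sgn' : {ae (leb \x leb)%E, forall z : R * R,
    (z.1 \in E) = ((BLu2 D z \in A) == (BLu3 D z \in B))}.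
  apply: ae_imply (ae_conj sgn (ae_conj (ae_BLu2 D g_nz) (ae_BLu3 D h_nz))).
  move=> z [[s1 s2] [gz hz]]; have inA : (BLu2 D z \in A) = (0 <= g (BLu2 D z)).
    by apply/idP/idP; rewrite inE.
  have inB : (BLu3 D z \in B) = (0 <= h (BLu3 D z)) by apply/idP/idP; rewrite inE.
  rewrite inA inB; case: (boolP (z.1 \in E)) => [/s1|/s2]; rewrite /phi.
    case: (leP 0 (g (BLu2 D z))) => g0; case: (leP 0 (h (BLu3 D z))) => h0 //.
      by rewrite leNgt nmulr_llt0// lt_neqAle eq_sym gz g0.
    by rewrite leNgt nmulr_rlt0// lt_neqAle eq_sym hz h0.
  case: (leP 0 (g (BLu2 D z))) => g0; case: (leP 0 (h (BLu3 D z))) => h0 //.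
    have gp : 0 < g (BLu2 D z) by rewrite lt_neqAle eq_sym gz.
    have hp : 0 < h (BLu3 D z) by rewrite lt_neqAle eq_sym hz.
    by rewrite leNgt mulr_gt0.
  by rewrite leNgt nmulr_lgt0// g0.
have [sA sB] := BLextremal_sign n1 n2 n3 n1_0 n2_0 n3_0 In1 In2 In3 BLn mE (mge _ mg) (mge _ mh) sgn'.
have cs (u : R -> R) : {ae leb, forall x, x \in [set x : R | 0 <= u x]} \/
    {ae leb, forall x, x \notin [set x : R | 0 <= u x]} ->
    {ae leb, forall x, 0 <= u x} \/ {ae leb, forall x, u x <= 0}.
  case=> H; [left|right]; apply: ae_imply H => x; first by rewrite inE.
  by rewrite notin_setE/= => /negP; rewrite -ltNge => /ltW.
split; [exact: cs sA|exact: cs sB|].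
by exists m2, m3, s.
Qed.

Let abs_of_sign x : {ae leb, forall y, 0 <= phi (x, y)} \/ {ae leb, forall y, phi (x, y) <= 0} ->
  `|BLconv x|%E = F x.
Proof.
have zero (u : R -> R) : measurable_fun setT u -> {ae leb, forall y, u y <= 0} ->
    (\int[mu]_y (Num.max (u y) 0)%:E = 0)%E.
  move=> mu' H; have mM : measurable_fun setT (fun y : mR => Num.max (u y) 0).
    have mMR : measurable_fun setT (fun y : R => Num.max (u y) 0) by exact: measurable_maxr.
    exact: mMR.
  have Hmu : {ae mu, forall y, Num.max (u y) 0 = cst 0 y}.
    by apply/(weight_ae mw w0 muE); apply: ae_imply H => y u0; rewrite max_r.
  have m0 : measurable_fun setT (cst 0 : mR -> R) by exact: measurable_cst.
  by rewrite (ae_integral_eq (m := mu) measurableT mM m0 Hmu) integral0.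
case=> H.
  have Fmx : Fm x = 0%E.
    apply: zero; first exact: measurableT_comp.
    by apply: ae_imply H => y; rewrite oppr_le0.
  by rewrite PhiE FE Fmx sube0 adde0 gee0_abs.
have Fpx : Fp x = 0%E by exact: zero.
by rewrite PhiE FE Fpx sub0e add0e abseN gee0_abs.
Qed.

Let ae_section2 (Q : R -> Prop) x : {ae leb, forall t, Q t} -> {ae leb, forall y, Q (BLu2 D (x, y))}.
Proof.
have e : r3 / (d1 * d2) != 0.
  by rewrite gt_eqF// divr_gt0 ?mulr_gt0 ?br3_gt0 ?bd1_gt0 ?bd2_gt0.
move=> /(ae_affine (r1 * r2 / (d1 * d2) * x) e); apply: ae_imply => y.
by rewrite /BLu2/= addrC.
Qed.

Let ae_section3 (Q : R -> Prop) x : {ae leb, forall t, Q t} -> {ae leb, forall y, Q (BLu3 D (x, y))}.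
Proof.
have e : r2 / (d1 * d3) != 0.
  by rewrite gt_eqF// divr_gt0 ?mulr_gt0 ?br2_gt0 ?bd1_gt0 ?bd3_gt0.
move=> /(ae_affine (- (r1 * r3 / (d1 * d3)) * x) e); apply: ae_imply => y.
by rewrite /BLu3/= addrC.
Qed.

(** The explicit inverse of [(u2, u3)]: the first coordinate comes from the linear relation behind
    [BLX], the second from [r2 d3] and [r3 d2] as elimination weights. *)
Lemma BLu_onto (a2 a3 : R) : exists m1 m2, BLu2 D (m1, m2) = a2 /\ BLu3 D (m1, m2) = a3.
Proof.
have E0 := br_sum D; have E1 := bd1E D.
have d1n : d1 != 0 by rewrite gt_eqF ?bd1_gt0.
have d2n : d2 != 0 by rewrite gt_eqF ?bd2_gt0.
have d3n : d3 != 0 by rewrite gt_eqF ?bd3_gt0.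
have r1n : r1 != 0 by rewrite gt_eqF ?br1_gt0.
have S : (r2 ^+ 2 + r3 ^+ 2) / d1 ^+ 2 = 1.
  by rewrite (_ : r2 ^+ 2 + r3 ^+ 2 = d1 ^+ 2) ?mulfV ?expf_neq0//; lra.
exists ((a2 * r2 * d2 - a3 * r3 * d3) / (r1 * d1)), ((r2 * d3 * a3 + r3 * d2 * a2) / d1).
split; rewrite /BLu2 /BLu3/=.
- by rewrite -[RHS]mulr1 -S; field; rewrite ?d1n ?d2n ?d3n ?r1n.
- by rewrite -[RHS]mulr1 -S; field; rewrite ?d1n ?d2n ?d3n ?r1n.
Qed.

Lemma young_conv (a2 a3 s : R) : 0 <= b -> 0 <= c -> 0 < s ->
  {ae leb, forall x, 0 <= g x} \/ {ae leb, forall x, g x <= 0} ->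
  {ae leb, forall x, 0 <= h x} \/ {ae leb, forall x, h x <= 0} ->
  {ae leb, forall x, wpow g p2 x = b * np a2 s x} ->
  {ae leb, forall x, wpow h p3 x = c * np a3 s x} ->
  ('N[mu]_q%:E [BLconv] = M%:E)%E.
Proof.
move=> b0 c0 s0 sg sh Gg Gh.
have PhiFE x : `|BLconv x|%E = F x.
  apply: abs_of_sign; case: sg => Sg; case: sh => Sh.
  - left; apply: ae_imply (ae_conj (ae_section2 x Sg) (ae_section3 x Sh)) => y [? ?].
    exact: mulr_ge0.
  - right; apply: ae_imply (ae_conj (ae_section2 x Sg) (ae_section3 x Sh)) => y [? ?].
    exact: mulr_ge0_le0.
  - right; apply: ae_imply (ae_conj (ae_section2 x Sg) (ae_section3 x Sh)) => y [? ?].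
    exact: mulr_le0_ge0.
  - left; apply: ae_imply (ae_conj (ae_section2 x Sg) (ae_section3 x Sh)) => y [? ?].
    exact: mulr_le0.
have [m1 [m2 [E2 E3]]] := BLu_onto a2 a3.
have sn : s != 0 by rewrite gt_eqF.
have np0 a x : 0 < np a s x by exact: normal_pdf_gt0.
have mn a : measurable_fun setT (np a s) by exact: measurable_normal_pdf.
have wg x : 0 <= w x by exact: ltW.
(* With this choice the three Gaussians are centred at the projections of the single point
   [(m1, m2)], so the Brascamp-Lieb product separates in [x] and [y]. Integrating [y] out leaves
   [F = M k^(1 - d1^2)], and [k] has mass 1 for [mu]. *)
pose k x := np m1 s x / w x.
have k0 x : 0 < k x by rewrite divr_gt0.
have kw x : k x * w x = np m1 s x by rewrite divfK// gt_eqF.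
have FkE x : F x = (M * k x `^ (1 - d1 ^+ 2))%:E.
  rewrite BLmarginalE.
  have kp : 0 < k x `^ (d1 ^+ 2) * w x by rewrite mulr_gt0// powR_gt0.
  have aey : {ae leb, forall y, BLgh (x, y) * w y =
      (k x `^ (d1 ^+ 2) * w x)^-1 * (M * np m1 s x) * np m2 s y}.
    apply: ae_imply (ae_conj (ae_section2 x Gg) (ae_section3 x Gh)) => y [G2 G3].
    have H1 := BLprod_wpow (x, y) (fun x => ltW (k0 x)).
    have H2 : BLprod D (fun x => k x * w x) (wpow g p2) (wpow h p3) (x, y) =
        M * (np m1 s x * np m2 s y).
      have one : 0 <= 1 :> R := ler01.
      have nn a t : 0 <= np a s t by exact: ltW.
      transitivity (BLprod D (fun t => 1 * np m1 s t) (fun t => b * np a2 s t)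
        (fun t => c * np a3 s t) (x, y)).
        by rewrite /BLprod/= kw mul1r G2 G3.
      rewrite (BLprod_scale D (x, y) one b0 c0 (nn m1) (nn a2) (nn a3)) powR1 mul1r.
      by rewrite -E2 -E3 BLprod_normal.
    apply: (mulfI (lt0r_neq0 kp)).
    rewrite [RHS]mulrA [X in _ = X * _]mulrA mulfV ?gt_eqF// mul1r.
    transitivity (k x `^ (d1 ^+ 2) * BLgh (x, y) * (w x * w y)); first by ring.
    by rewrite -/(BLgh (x, y)) -[LHS]H1 H2 mulrA.
  set C := (k x `^ (d1 ^+ 2) * w x)^-1 * (M * np m1 s x) in aey.
  have C0 : 0 <= C.
    by rewrite mulr_ge0 ?invr_ge0 ?(ltW kp)// mulr_ge0// ltW.
  have mgw : measurable_fun setT (fun y : R => BLgh (x, y) * w y) by exact: measurable_funM.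
  have mCn : measurable_fun setT (fun y : R => C * np m2 s y) by exact: measurable_funM.
  have := @ae_integral_eq _ mR R leb _ _ setT measurableT mgw mCn aey.
  rewrite (integral_scale (mn m2) (fun t => ltW (np0 m2 t)) C0 (integral_normal_pdf m2 s)).
  move=> ->; congr _%:E; rewrite mulr1 /C.
  have kE : k x = k x `^ (d1 ^+ 2) * k x `^ (1 - d1 ^+ 2).
    by rewrite -powRD ?(gt_eqF (k0 x)) ?implybT// addrC subrK powRr1// ltW.
  have -> : M * np m1 s x = (k x `^ (d1 ^+ 2) * w x) * (M * k x `^ (1 - d1 ^+ 2)).
    by rewrite -kw [X in _ * (X * _) = _]kE; ring.
  by rewrite mulKf// gt_eqF.
rewrite unlock.
have -> : (\int[mu]_x (`|BLconv x| `^ q) = (M `^ q)%:E)%E.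
  transitivity (\int[mu]_x (M `^ q * k x)%:E)%E.
    apply: eq_integral => x _; rewrite PhiFE FkE poweR_EFin; congr _%:E.
    rewrite powRM ?powR_ge0// -powRrM mulfV ?powRr1//; first exact: ltW.
    by case/andP: d1_01 => ? _; rewrite gt_eqF.
  have mk : measurable_fun setT (fun x : R => (M `^ q * k x)%:E).
    apply/measurable_EFinP; apply: measurable_funM => //.
    apply: measurable_funM => //.
    have -> : (fun x : R => (w x)^-1) = (fun x => w x `^ (-1)).
      by apply/funext => x; rewrite powR_inv1.
    exact: (measurableT_comp (measurable_powR (-1)) mw).
  rewrite (weight_integral mw w0 muE mk); last first.
    by move=> x; rewrite lee_fin mulr_ge0 ?powR_ge0// ltW.
  rewrite -[RHS]mule1 -(integral_normal_pdf m1 s) -ge0_integralZl//.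
  - by apply: eq_integral => x _; rewrite -!EFinM -mulrA kw.
  - have mnE : measurable_fun setT (fun x : R => (np m1 s x)%:E) by exact/measurable_EFinP.
    exact: mnE.
  - by move=> x _; rewrite lee_fin ltW.
  - by rewrite lee_fin powR_ge0.
exact: MqK.
Qed.

End young.

(** * Exponents, Gaussian powers and the final statement *)

Section theorem_data.
Context (R : realType).
Notation leb := (@lebesgue_measure R).
Notation mR := (measurableTypeR R).
Notation np := (@normal_pdf R).

(** Take [d_i] and [r_i] as the square roots of [1/p_i] and [1 - 1/p_i]. The condition on the
    exponents becomes [r1^2 + r2^2 + r3^2 = 3 - 2 = 1]. *)
Lemma BLdatum_of_exponents (p1 p2 p3 : R) : 1 < p1 -> 1 < p2 -> 1 < p3 ->
  p1^-1 + p2^-1 + p3^-1 = 2 ->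
  exists D : BLdatum R, [/\ bd1 D ^+ 2 = p1^-1, bd2 D ^+ 2 = p2^-1 & bd3 D ^+ 2 = p3^-1] /\
  forall t2 t3 : R,
    cos t2 = Num.sqrt ((p1 - 1) * (p2 - 1)) ->
    sin t2 = Num.sqrt (p1 * p2 * (p3 - 1) / p3) ->
    cos t3 = - Num.sqrt ((p1 - 1) * (p3 - 1)) ->
    sin t3 = Num.sqrt (p1 * p3 * (p2 - 1) / p2) ->
    forall x y, BLu2 D (x, y) = cos t2 * x + sin t2 * y /\
      BLu3 D (x, y) = cos t3 * x + sin t3 * y.
Proof.
move=> hp1 hp2 hp3 hp.
have pos (p : R) : 1 < p -> [/\ 0 < p, 0 < p^-1 & 0 < 1 - p^-1].
  move=> p1'; have p0 : 0 < p by lra.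
  by split; rewrite ?invr_gt0 ?subr_gt0 ?invf_lt1.
have [p1p i1 j1] := pos _ hp1; have [p2p i2 j2] := pos _ hp2.
have [p3p i3 j3] := pos _ hp3.
pose r (p : R) := Num.sqrt (1 - p^-1); pose e (p : R) := Num.sqrt p^-1.
have r2 (p : R) : 1 < p -> r p ^+ 2 = 1 - p^-1 by move=> /pos[_ _ ?]; rewrite sqr_sqrtr// ltW.
have e2 (p : R) : 1 < p -> e p ^+ 2 = p^-1 by move=> /pos[_ ? _]; rewrite sqr_sqrtr// ltW.
have r0 (p : R) : 1 < p -> 0 < r p by move=> /pos[_ _ ?]; rewrite sqrtr_gt0.
have e0 (p : R) : 1 < p -> 0 < e p by move=> /pos[_ ? _]; rewrite sqrtr_gt0.
have er (p : R) : 1 < p -> e p ^+ 2 = 1 - r p ^+ 2.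
  by move=> h; rewrite e2// r2// opprB addrC subrK.
have rsum : r p1 ^+ 2 + r p2 ^+ 2 + r p3 ^+ 2 = 1 by rewrite !r2//; lra.
pose D := MkBLdatum (r0 _ hp1) (r0 _ hp2) (r0 _ hp3) (e0 _ hp1) (e0 _ hp2) (e0 _ hp3)
  rsum (er _ hp1) (er _ hp2) (er _ hp3).
have sq (X y : R) : 0 <= y -> X = y ^+ 2 -> Num.sqrt X = y.
  by move=> y0 ->; rewrite sqrtr_sqr ger0_norm.
have ge (a b c : R) : 1 < a -> 1 < b -> 1 < c -> 0 <= r a * r c / (e a * e b).
  by move=> *; rewrite divr_ge0 ?mulr_ge0// ltW ?r0 ?e0.
exists D; split; first by rewrite !e2.
move=> t2 t3 -> -> -> -> x y; rewrite /BLu2 /BLu3/=.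
rewrite (sq _ (r p1 * r p2 / (e p1 * e p2))); last 2 first.
- exact: ge.
- by rewrite expr_div_n !exprMn !r2// !e2//; field; rewrite !gt_eqF.
rewrite (sq _ (r p3 / (e p1 * e p2))); last 2 first.
- by rewrite divr_ge0 ?mulr_ge0// ltW ?r0 ?e0.
- by rewrite expr_div_n exprMn !r2// !e2//; field; rewrite !gt_eqF.
rewrite (sq _ (r p1 * r p3 / (e p1 * e p3))); last 2 first.
- exact: ge.
- by rewrite expr_div_n !exprMn !r2// !e2//; field; rewrite !gt_eqF.
rewrite (sq _ (r p2 / (e p1 * e p3))); last 2 first.
- by rewrite divr_ge0 ?mulr_ge0// ltW ?r0 ?e0.
- by rewrite expr_div_n exprMn !r2// !e2//; field; rewrite !gt_eqF.
by [].
Qed.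

Lemma ae_eq_of_integrals (f1 f2 : R -> R) (a : R) :
  measurable_fun setT f1 -> measurable_fun setT f2 -> (forall x, 0 <= f1 x) ->
  (\int[leb]_x (f1 x)%:E = a%:E)%E ->
  (forall A, measurable A -> (\int[leb]_(x in A) (f1 x)%:E = \int[leb]_(x in A) (f2 x)%:E)%E) ->
  {ae leb, forall x, f1 x = f2 x}.
Proof.
move=> m1 m2 f10 I1 E.
have i1 : leb.-integrable setT (EFin \o f1).
  apply/integrableP; split; first exact/measurable_EFinP.
  under eq_integral => x _ do rewrite /= ger0_norm//.
  by rewrite I1 ltry.
have m2E : measurable_fun setT (EFin \o f2) by exact/measurable_EFinP.
have H := @integral_ae_eq _ mR R leb setT measurableT (EFin \o f2) (EFin \o f1) i1 m2E
  (fun A _ mA => E A mA).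
by apply: ae_imply H => x /(_ I) [].
Qed.

Section weighted.
Variables (mu : {sigma_finite_measure set mR -> \bar R}) (w : R -> R).
Hypotheses (mw : measurable_fun setT w) (w0 : forall x, 0 < w x)
  (muE : forall A, measurable A -> (mu A = \int[leb]_(x in A) (w x)%:E)%E).

Let w_ge0 x : 0 <= w x. Proof. exact: ltW. Qed.

Lemma measurable_abs_powR (g : R -> R) p : measurable_fun setT g ->
  measurable_fun setT (fun x => `|g x| `^ p).
Proof.
move=> mg; apply: (measurableT_comp (measurable_powR p)).
exact: (measurableT_comp (@normr_measurable R setT) mg).
Qed.

Lemma wpow_integral (g : R -> R) p (A : set mR) : measurable_fun setT g -> measurable A ->
  (\int[mu]_(x in A) (`|g x| `^ p)%:E = \int[leb]_(x in A) (wpow w g p x)%:E)%E.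
Proof.
move=> mg mA; have mgp := measurable_abs_powR p mg.
exact: (@integral_density_set _ mR R leb mu w _ A mw w_ge0 muE mgp
  (fun x => powR_ge0 _ _) mA).
Qed.

Lemma Lfun_mass (g : mR -> R) (p : R) : 1 < p -> g \in Lfun mu p%:E ->
  measurable_fun setT (g : R -> R) /\ exists b, [/\ 0 <= b,
    (\int[leb]_x (wpow w g p x)%:E = b%:E)%E & ('N[mu]_p%:E[EFin \o g] = (b `^ p^-1)%:E)%E].
Proof.
move=> p1; have p0 : 0 < p by lra.
move=> /andP[]; rewrite inE /= => mg; rewrite inE /= /finite_norm => fin.
have mgR : measurable_fun setT (g : R -> R) by exact: mg.
split => //; pose I := (\int[leb]_x (wpow w g p x)%:E)%E.
have IE : (\int[mu]_x (`|(EFin \o g) x| `^ p) = I)%E.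
  rewrite /I -(wpow_integral p mgR measurableT).
  by apply: eq_integral => x _.
have I0 : (0 <= I)%E by apply: integral_ge0 => x _; rewrite lee_fin wpow_ge0.
have NE : ('N[mu]_p%:E[EFin \o g] = I `^ p^-1)%E by rewrite unlock IE.
have Ifin : I \is a fin_num.
  rewrite ge0_fin_numE//; apply: (@lty_poweRy _ _ p^-1).
    by rewrite invr_neq0// gt_eqF.
  by rewrite -NE.
exists (fine I); split; first exact: fine_ge0.
- by rewrite fineK.
- by rewrite NE -poweR_EFin fineK.
Qed.

Lemma wpow_eq0 (g : R -> R) p : measurable_fun setT g -> 0 < p ->
  (\int[leb]_x (wpow w g p x)%:E = 0)%E -> {ae mu, forall x, g x = 0}.
Proof.
move=> mg p0 I0; apply/(weight_ae mw w0 muE).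
apply: ae_imply (ae_zero (measurable_wpow mw p mg) (wpow_ge0 w0 g p) I0) => x /eqP.
rewrite mulf_eq0 (gt_eqF (w0 x)) orbF powR_eq0 => /andP[/eqP/normr0_eq0 //].
Qed.

Lemma wpow_ae0 (g : R -> R) p : 0 < p -> measurable_fun setT g ->
  {ae mu, forall x, g x = 0} -> (\int[leb]_x (wpow w g p x)%:E = 0)%E.
Proof.
move=> p0 mg /(weight_ae mw w0 muE) g0.
have mc : measurable_fun setT (cst 0 : R -> R) by exact: measurable_cst.
have := @ae_integral_eq _ mR R leb _ _ setT measurableT (measurable_wpow mw p mg) mc.
rewrite integral0; apply; apply: ae_imply g0 => x gx.
by rewrite /wpow gx normr0 powR0 ?gt_eqF// mul0r.
Qed.

(** The parameters are read off the normal density: [l = 1 / (2 s^2)] and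
    [K = b / (s sqrt(2 pi))]. *)
Lemma gaussian_power_of_pdf (g : R -> R) p b a s : measurable_fun setT g -> 0 < s ->
  {ae leb, forall x, wpow w g p x = b * np a s x} ->
  gaussian_power mu g p (b * ((Num.sqrt (pi *+ 2))^-1 / s)) (s ^+ 2 *+ 2)^-1 a.
Proof.
move=> mg s0 gE A mA; rewrite (wpow_integral p mg mA).
have mn : measurable_fun setT (fun x : R => b * np a s x).
  by apply: measurable_funM => //; exact: measurable_normal_pdf.
apply: (etrans (@ae_integral_eq _ mR R leb _ _ A mA (measurable_wpow mw p mg) mn gE)).
apply: eq_integral => x _; rewrite normal_pdf_pos// mulrA.
by rewrite [(_ - _) ^+ 2 / _]mulrC.
Qed.

(** With [K = 0] the measure is zero. With [l = 0] and [K > 0] it would be a positive multiple of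
    Lebesgue measure, of infinite mass, against the finite [b]. *)
Lemma gaussian_power_eq0 (g : R -> R) p b K l a : measurable_fun setT g ->
  (\int[leb]_x (wpow w g p x)%:E = b%:E)%E -> gaussian_power mu g p K l a ->
  0 <= K -> 0 <= l -> K = 0 \/ l = 0 -> b = 0.
Proof.
move=> mg Ib gp K0 l0 Kl; have := gp setT measurableT.
rewrite (wpow_integral p mg measurableT) Ib.
have [->|Kn] := eqVneq K 0.
  under eq_integral => x _ do rewrite mul0r.
  by rewrite integral0 => -[].
have -> : l = 0 by case: Kl => // /eqP; rewrite (negbTE Kn).
under eq_integral => x _ do rewrite mul0r oppr0 expR0 mulr1.
rewrite integral_cst//.
have T : leb setT = +oo%E by rewrite -set_itvNyy lebesgue_measure_itv.
move=> H; suff : b%:E = +oo%E by [].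
apply: (etrans H); apply: (etrans (congr1 (fun z => K%:E * z)%E T)).
by rewrite gt0_muley// lte_fin lt_neqAle eq_sym Kn.
Qed.

Lemma pdf_of_gaussian_power (g : R -> R) p b K l a : measurable_fun setT g ->
  (\int[leb]_x (wpow w g p x)%:E = b%:E)%E -> gaussian_power mu g p K l a ->
  0 < K -> 0 < l ->
  {ae leb, forall x, wpow w g p x = b * np a (Num.sqrt (l *+ 2)^-1) x}.
Proof.
move=> mg Ib gp K0 l0; set s := Num.sqrt _.
have l2 : 0 < (l *+ 2)^-1 by rewrite invr_gt0 mulrn_wgt0.
have s0 : 0 < s by rewrite sqrtr_gt0.
have s2 : s ^+ 2 = (l *+ 2)^-1 by rewrite sqr_sqrtr// ltW.
pose k : R := (Num.sqrt (pi *+ 2))^-1 / s.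
have k0 : 0 < k by rewrite divr_gt0// invr_gt0 sqrtr_gt0 mulrn_wgt0// pi_gt0.
have EK x : K * expR (- (l * (x - a) ^+ 2)) = K / k * np a s x.
  rewrite normal_pdf_pos// -/k [RHS]mulrA divfK ?gt_eqF//; congr (_ * expR (- _)).
  by rewrite s2; field; rewrite gt_eqF.
have mn : measurable_fun setT (np a s) by exact: measurable_normal_pdf.
have n0 x : 0 <= np a s x by exact: normal_pdf_ge0.
(* Comparing total masses over the line determines the amplitude. *)
have bE : b = K / k.
  have := gp setT measurableT; rewrite (wpow_integral p mg measurableT) Ib.
  under eq_integral => x _ do rewrite EK.
  rewrite (integral_scale mn n0 _ (integral_normal_pdf a s)) ?mulr1; first by move=> [].
  by rewrite divr_ge0// ltW.
apply: (ae_eq_of_integrals (measurable_wpow mw p mg) _ (wpow_ge0 w0 g p) Ib).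
  exact: measurable_funM.
move=> A mA; rewrite -(wpow_integral p mg mA) gp//.
by apply: eq_integral => x _; rewrite EK bE.
Qed.

End weighted.

End theorem_data.

Unset Implicit Arguments.
Set Strict Implicit.
Set Printing Implicit Defensive.

(** In the equality case of the second part, a function vanishing almost everywhere makes both sides
    0 whatever the other function is; this gives the first two alternatives. *)
Theorem theorem3 (R : realType)
    (mu : {sigma_finite_measure set (measurableTypeR R) -> \bar R})
    (hmu : lebesgue_or_gaussian mu)
    (p1 p2 p3 : R) (hp1 : 1 < p1) (hp2 : 1 < p2) (hp3 : 1 < p3)
    (hp : p1^-1 + p2^-1 + p3^-1 = 2)
    (t2 t3 : R) (ht2 : 0 < t2 < pi) (ht3 : 0 < t3 < pi)
    (hcos2 : cos t2 = Num.sqrt ((p1 - 1) * (p2 - 1)))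
    (hsin2 : sin t2 = Num.sqrt (p1 * p2 * (p3 - 1) / p3))
    (hcos3 : cos t3 = - Num.sqrt ((p1 - 1) * (p3 - 1)))
    (hsin3 : sin t3 = Num.sqrt (p1 * p3 * (p2 - 1) / p2)) :
  (forall (d : measure_display) (T : measurableType d) (P : probability T R)
      (X Y : {RV P >-> measurableTypeR R}),
    let X2 : T -> measurableTypeR R := fun w => cos t2 * X w + sin t2 * Y w in
    let X3 : T -> measurableTypeR R := fun w => cos t3 * X w + sin t3 * Y w in
    let XY : T -> measurableTypeR R * measurableTypeR R :=
      fun w => (X w, Y w) in
    finite_entropy P mu X -> finite_entropy P mu Y ->
    finite_entropy P mu X2 -> finite_entropy P mu X3 ->
    finite_entropy P (mu \x mu)%E XY ->
    let lhs := p1^-1 * entropy P mu X + p2^-1 * entropy P mu X2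
               + p3^-1 * entropy P mu X3 in
    let rhs := entropy P (mu \x mu)%E XY in
    lhs <= rhs /\
    (lhs = rhs <-> independent_gaussians_same_variance P X Y)) /\
  (forall g h : measurableTypeR R -> R,
    g \in Lfun mu p2%:E -> h \in Lfun mu p3%:E ->
    let lhs := ('N[mu]_((p1 / (p1 - 1))%:E)
                  [directional_convolution mu t2 t3 g h])%E in
    let rhs := ('N[mu]_(p2%:E) [EFin \o g] * 'N[mu]_(p3%:E) [EFin \o h])%E in
    (lhs <= rhs)%E /\
    (lhs = rhs <->
      [\/ g = cst 0 %[ae mu], h = cst 0 %[ae mu] |
          [/\ constant_sign mu g, constant_sign mu h &
              exists a2 a3 K2 K3 l : R,
                [/\ 0 <= K2, 0 <= K3, 0 <= l,
                    gaussian_power mu g p2 K2 l a2 &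
                    gaussian_power mu h p3 K3 l a3]]])).
Proof.
have [D [[D1 D2 D3] DE]] := BLdatum_of_exponents hp1 hp2 hp3 hp.
have {}DE x y := DE t2 t3 hcos2 hsin2 hcos3 hsin3 x y.
split.
  move=> d T P X Y X2 X3 XY e1 _ e2 e3 e lhs rhs.
  have X2E : X2 = (fun t => BLu2 D (X t, Y t)).
    by apply/funext => t; rewrite (DE _ _).1.
  have X3E : X3 = (fun t => BLu3 D (X t, Y t)).
    by apply/funext => t; rewrite (DE _ _).2.
  rewrite /lhs /rhs -D1 -D2 -D3 X2E X3E.
  apply: entropy_BL => //; [by rewrite -X2E|by rewrite -X3E].
move=> g h gL hL lhs rhs.
have [w [mw w0 muE wD]] := reference_weight hmu.
have [mg [b [b0 Ib Nb]]] := Lfun_mass mw w0 muE hp2 gL.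
have [mh [c [c0 Ic Nc]]] := Lfun_mass mw w0 muE hp3 hL.
have p20 : 0 < p2 by lra.
have p30 : 0 < p3 by lra.
have qE : p1 / (p1 - 1) = (1 - bd1 D ^+ 2)^-1.
  by rewrite D1; field; apply/andP; split; rewrite ?subr_eq0 gt_eqF//; lra.
have convE : directional_convolution mu t2 t3 g h = BLconv D mu g h.
  apply/funext => x; apply: eq_integral => y _.
  by rewrite (DE x y).1 (DE x y).2.
have rhsE : rhs = (b `^ (bd2 D ^+ 2) * c `^ (bd3 D ^+ 2))%:E.
  by rewrite /rhs Nb Nc D2 D3 EFinM.
have lhsE : lhs = ('N[mu]_((1 - bd1 D ^+ 2)^-1%:E) [BLconv D mu g h])%E.
  by rewrite /lhs qE convE.
have p2E : p2^-1 = bd2 D ^+ 2 by rewrite D2.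
have p3E : p3^-1 = bd3 D ^+ 2 by rewrite D3.
have le := young_le p20 p30 p2E p3E mw w0 muE (wD D) mg mh Ib Ic.
rewrite -lhsE -rhsE in le; split => //.
(* If one norm is 0 the right-hand side is 0, and the inequality just proved squeezes the left-hand
   side to 0. *)
have zero : b = 0 \/ c = 0 -> lhs = rhs.
  have dn (e : R) : 0 < e -> e ^+ 2 != 0 by move=> e0; rewrite gt_eqF// exprn_gt0.
  move=> bc; have r0 : rhs = 0%E.
    rewrite rhsE; case: bc => ->.
      by rewrite powR0 ?mul0r// dn// bd2_gt0.
    by rewrite [X in _ * X]powR0 ?mulr0// dn// bd3_gt0.
  by apply/eqP; rewrite eq_le le r0 Lnorm_ge0.
split.
  move=> E; have [b00|bn] := eqVneq b 0.
    apply: Or31; rewrite b00 in Ib.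
    by apply: ae_imply (wpow_eq0 mw w0 muE mg p20 Ib) => x ->.
  have [c00|cn] := eqVneq c 0.
    apply: Or32; rewrite c00 in Ic.
    by apply: ae_imply (wpow_eq0 mw w0 muE mh p30 Ic) => x ->.
  have bp : 0 < b by rewrite lt_neqAle eq_sym bn.
  have cp : 0 < c by rewrite lt_neqAle eq_sym cn.
  rewrite lhsE rhsE in E.
  have [sg sh [a2 [a3 [s [s0 Gg Gh]]]]] := young_eq p20 p30 p2E p3E mw w0 muE (wD D)
    mg mh Ib Ic bp cp E.
  apply: Or33; split.
  - by case: sg => H; [left|right]; apply/(weight_ae mw w0 muE).
  - by case: sh => H; [left|right]; apply/(weight_ae mw w0 muE).
  - exists a2, a3, (b * ((Num.sqrt (pi *+ 2))^-1 / s)), (c * ((Num.sqrt (pi *+ 2))^-1 / s)),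
      (s ^+ 2 *+ 2)^-1.
    have k0 : 0 <= (Num.sqrt (pi *+ 2))^-1 / s by rewrite divr_ge0 ?invr_ge0 ?sqrtr_ge0// ltW.
    split.
    + exact: mulr_ge0.
    + exact: mulr_ge0.
    + by rewrite invr_ge0 mulrn_wge0// sqr_ge0.
    + exact: (gaussian_power_of_pdf mw w0 muE mg s0 Gg).
    + exact: (gaussian_power_of_pdf mw w0 muE mh s0 Gh).
case=> [g0|h0|[sg sh [a2 [a3 [K2 [K3 [l [K20 K30 l0 Gg Gh]]]]]]]].
- apply: zero; left; apply: EFin_inj; rewrite -Ib.
  by apply: (wpow_ae0 mw w0 muE p20 mg); apply: ae_imply g0 => x; apply.
- apply: zero; right; apply: EFin_inj; rewrite -Ic.
  by apply: (wpow_ae0 mw w0 muE p30 mh); apply: ae_imply h0 => x; apply.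
(* Degenerate parameters [K2], [K3] or [l] give a function of zero norm; otherwise both powers are
   genuine Gaussian densities with the same deviation [1 / sqrt(2 l)]. *)
have [K2z|K2n] := eqVneq K2 0.
  apply: zero; left.
  by apply: (gaussian_power_eq0 mw w0 muE mg Ib Gg K20 l0); left.
have [K3z|K3n] := eqVneq K3 0.
  apply: zero; right.
  by apply: (gaussian_power_eq0 mw w0 muE mh Ic Gh K30 l0); left.
have [lz|ln] := eqVneq l 0.
  apply: zero; left.
  by apply: (gaussian_power_eq0 mw w0 muE mg Ib Gg K20 l0); right.
have K2p : 0 < K2 by rewrite lt_neqAle eq_sym K2n.
have K3p : 0 < K3 by rewrite lt_neqAle eq_sym K3n.
have lp : 0 < l by rewrite lt_neqAle eq_sym ln.
have s0 : 0 < Num.sqrt (l *+ 2)^-1 by rewrite sqrtr_gt0 invr_gt0 mulrn_wgt0.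
have Pg := pdf_of_gaussian_power mw w0 muE mg Ib Gg K2p lp.
have Ph := pdf_of_gaussian_power mw w0 muE mh Ic Gh K3p lp.
have sgl : {ae lebesgue_measure, forall x, 0 <= g x} \/ {ae lebesgue_measure, forall x, g x <= 0}.
  by case: sg => H; [left|right]; apply/(weight_ae mw w0 muE).
have shl : {ae lebesgue_measure, forall x, 0 <= h x} \/ {ae lebesgue_measure, forall x, h x <= 0}.
  by case: sh => H; [left|right]; apply/(weight_ae mw w0 muE).
rewrite lhsE rhsE.
exact: (young_conv p20 p30 p2E p3E mw w0 muE (wD D) mg mh b0 c0 s0 sgl shl Pg Ph).
Qed.
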